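(* Let $\Gamma$ be a countable discrete group that admits a faithful topological boundary, and let $\Lambda\leq\Gamma$ be an icc co-amenable subgroup. Suppose $\pi:\Gamma\to\mathcal{U}(\mathcal{H})$ is a unitary representation such that $\pi(\Gamma)''$ is a finite von Neumann algebra. If the restriction $\pi|_\Lambda$ extends to a von Neumann algebra isomorphism $\pi(\Lambda)''\cong\mathcal{L}(\Lambda)$, then $\pi$ extends to a von Neumann algebra isomorphism $\pi(\Gamma)''\cong\mathcal{L}(\Gamma)$.
   Context: A continuous action $\Gamma\curvearrowright X$ on a compact Hausdorff space is a topological boundary action if for every Borel probability measure $\nu$ on $X$ and every $x\in X$ there is a net $(g_i)$ in $\Gamma$ with $g_i\nu\to\delta_x$ weak*; it is faithful if no $g\neq e$ acts trivially. A group is icc if every non-trivial conjugacy class is infinite. $\Lambda\leq\Gamma$ is co-amenable if every continuous affine action of $\Gamma$ on a non-empty compact convex set with a $\Lambda$-fixed point has a $\Gamma$-fixed point. For a set $S$ of operators, $S''$ is its bicommutant. $\mathcal{L}(G)=\{\lambda_g:g\in G\}''\subset\mathcal{B}(\ell^2(G))$ is the group von Neumann algebra, $\lambda$ the left regular representation. A von Neumann algebra is finite if it has a normal faithful tracial state. ''$\pi|_\Lambda$ extends to an isomorphism'' means there is a von Neumann algebra isomorphism taking $\pi(h)$ to $\lambda_h$ for all $h\in\Lambda$; similarly for $\Gamma$. *)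

(* Defs.v *)
From HB Require Import structures.
From mathcomp Require Import all_boot all_order all_algebra.
From mathcomp Require Import sesquilinear finmap complex.
From mathcomp Require Import ring.
From mathcomp Require Import all_classical all_reals all_analysis.

Set Implicit Arguments.
Unset Strict Implicit.
Unset Printing Implicit Defensive.

Import Order.TTheory GRing.Theory Num.Theory.
Import numFieldNormedType.Exports.

Local Open Scope classical_set_scope.
Local Open Scope ring_scope.

Section unordered_sum.
Context {R : realType} {T : choiceType}.
Implicit Types f : T -> R[i].

Definition has_sum f (s : R[i]) := forall e : R[i], 0 < e ->
  exists A : {fset T}, forall B : {fset T}, (A `<=` B)%fset ->
    `|\sum_(t <- B) f t - s| < e.

(* The sum of an unordered family, with junk value 0 when it does not exist. *)
Definition usum f : R[i] := xget 0 [set s | has_sum f s].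

Lemma usumE f s : has_sum f s -> usum f = s.
Proof.
move=> fs; rewrite /usum; case: xgetP => [s' _ fs'|/(_ s)/(_ fs)//].
have [//|ss'] := eqVneq s' s.
have h : 0 < `|s' - s| / 2 by rewrite divr_gt0// normr_gt0 subr_eq0.
have [A HA] := fs _ h; have [B HB] := fs' _ h.
have := ltrD (HA _ (fsubsetUl A B)) (HB _ (fsubsetUr A B)).
rewrite -splitr => /(le_lt_trans (ler_normB _ _)).
by rewrite opprB [X in `|X|]addrC addrA subrK ltxx.
Qed.

Lemma has_sumD f g s t : has_sum f s -> has_sum g t ->
  has_sum (fun x => f x + g x) (s + t).
Proof.
move=> fs gt e e0; have e2 : 0 < e / 2 by rewrite divr_gt0.
have [A HA] := fs _ e2; have [B HB] := gt _ e2.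
exists (A `|` B)%fset => C; rewrite fsubUset => /andP[AC BC].
rewrite big_split/= opprD addrACA (splitr e).
by rewrite (le_lt_trans (ler_normD _ _))// ltrD ?HA ?HB.
Qed.

Lemma has_sumZ c f s : has_sum f s -> has_sum (fun x => c * f x) (c * s).
Proof.
move=> fs e e0; have c0 : 0 < `|c| + 1 by rewrite ltr_wpDl.
have [A HA] := fs (e / (`|c| + 1)) (divr_gt0 e0 c0).
exists A => B /HA; rewrite -mulr_sumr -mulrBr normrM ltr_pdivlMr// mulrC.
by apply: le_lt_trans; rewrite ler_wpM2r// lerDl.
Qed.

Lemma has_sumJ f s : has_sum f s -> has_sum (fun x => (f x)^*) (s^*).
Proof.
move=> fs e e0; have [A HA] := fs e e0.
by exists A => B /HA; rewrite -rmorph_sum -rmorphB norm_conjC.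
Qed.

Lemma ler_sum_fset f (A B : {fset T}) : (forall t, 0 <= f t) ->
  (A `<=` B)%fset -> \sum_(t <- A) f t <= \sum_(t <- B) f t.
Proof.
move=> f0 AB; rewrite (big_fsetID _ (fun t => t \in A) B)/=.
rewrite (_ : [fset t in B | t \in A]%fset = A).
  by rewrite lerDl sumr_ge0.
by apply/fsetP => t; rewrite !inE/= andbC; apply: andb_idr; exact: (fsubsetP AB).
Qed.

Lemma ge0_has_sum f (M : R[i]) : (forall t, 0 <= f t) ->
  (forall A : {fset T}, \sum_(t <- A) f t <= M) ->
  exists2 s, has_sum f s & forall A : {fset T}, \sum_(t <- A) f t <= s.
Proof.
move=> f0 fM; pose S (A : {fset T}) := complex.Re (\sum_(t <- A) f t).
have SE (A : {fset T}) : \sum_(t <- A) f t = (S A)%:C%C.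
  by rewrite RRe_real// ger0_real// sumr_ge0.
have supS : has_sup (range S).
  split; first by exists (S fset0); exists fset0.
  exists (complex.Re M) => _ [A _ <-].
  by move: (fM A); rewrite lecE => /andP[].
exists (sup (range S))%:C%C => [e e0|A]; last first.
  by rewrite SE lecR; apply: sup_upper_bound => //; exists A.
have eE : e = (complex.Re e)%:C%C by rewrite RRe_real// gtr0_real.
have e0' : 0 < complex.Re e by move: e0; rewrite {1}eE ltcR.
have [_ [A _ <-] HA] := sup_adherent e0' supS.
exists A => B AB; have SAB : S A <= S B.
  by rewrite -lecR -!SE ler_sum_fset.
have Sle : S B <= sup (range S) by apply: sup_upper_bound => //; exists B.
rewrite SE -rmorphB/= normc_def/= expr0n/= addr0 sqrtr_sqr eE ltcR.
rewrite ler0_norm ?subr_le0// opprB ltrBlDl -ltrBlDr.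
exact: lt_le_trans HA SAB.
Qed.

Lemma norm_has_sum f (M : R[i]) :
  (forall A : {fset T}, \sum_(t <- A) `|f t| <= M) -> exists s, has_sum f s.
Proof.
move=> fM.
have sum_le g : (forall t, 0 <= g t <= `|f t| *+ 2) -> exists s, has_sum g s.
  move=> g0f; have [||s gs _] := @ge0_has_sum g (M *+ 2); last by exists s.
    by move=> t; case/andP: (g0f t).
  move=> A; rewrite (le_trans (ler_sum _ (fun t _ => proj2 (andP (g0f t)))))//.
  by rewrite sumrMnl lerMn2r fM.
have ReP (z : R[i]) : 0 <= `|z| + 'Re z <= `|z| *+ 2.
  have := (leif_normC_Re_Creal z).1; rewrite real_ler_norml ?Creal_Re//.
  by case/andP=> h1 h2; rewrite -lerBlDl sub0r h1 mulr2n lerD2l.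
have [s1 h1] := sum_le _ (fun t => ReP (f t)).
have [|s2 h2] := sum_le (fun t => `|f t| + 'Im (f t)).
  by move=> t; have := ReP (- ('i * f t)); rewrite normrN normrM normCi mul1r raddfN/= ReMil opprK.
have [|s3 h3] := sum_le (fun t => `|f t|).
  by move=> t; rewrite normr_ge0 mulr2n lerDl normr_ge0.
exists (s1 + 'i * s2 + - (1 + 'i) * s3).
have := has_sumD (has_sumD h1 (has_sumZ 'i h2)) (has_sumZ (- (1 + 'i)) h3).
congr has_sum; apply/funext => t; rewrite [in RHS](Crect (f t)).
by rewrite mulNr mulrDr mulrDl mul1r; ring.
Qed.
End unordered_sum.

Section l2.
Context (R : realType) (T : choiceType).

Let sqr_normB_ge0 (x y : R[i]) : 0 <= (`|x| - `|y|) ^+ 2.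
Proof. by rewrite real_exprn_even_ge0// rpredB. Qed.

Definition square_summable : {pred T -> R[i]} := fun a =>
  `[< exists M, forall A : {fset T}, \sum_(t <- A) `|a t| ^+ 2 <= M >].

Fact square_summable_submod : submod_closed square_summable.
Proof.
have sq_ge0 (z : R[i]) : 0 <= `|z| ^+ 2 by rewrite exprn_ge0.
split=> [|c a b /asboolP[M aM] /asboolP[N bN]]; apply/asboolP.
  by exists 0 => A; rewrite big1// => t _; rewrite normr0 expr0n.
exists (`|c| ^+ 2 * M *+ 2 + N *+ 2) => A.
apply: (@le_trans _ _ (\sum_(t <- A)
    (`|c| ^+ 2 * `|a t| ^+ 2 *+ 2 + `|b t| ^+ 2 *+ 2))).
  apply: ler_sum => t _; rewrite -exprMn -normrM.
  have -> : (c *: a + b) t = c * a t + b t by [].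
  set x := c * a t; set y := b t.
  rewrite (le_trans (lerXn2r 2 _ _ (ler_normD x y)))// ?nnegrE ?addr_ge0//.
  by rewrite -subr_ge0 (_ : _ - _ = (`|x| - `|y|) ^+ 2)//; ring.
rewrite big_split/= !sumrMnl -mulr_sumr lerD// lerMn2r//=.
by rewrite ler_wpM2l.
Qed.

HB.instance Definition _ := GRing.isSubmodClosed.Build R[i] (T -> R[i])
  square_summable square_summable_submod.

Record l2 := L2 {l2val :> T -> R[i]; _ : l2val \in square_summable}.

HB.instance Definition _ := [isSub for l2val].
HB.instance Definition _ := [Choice of l2 by <:].
HB.instance Definition _ := [SubChoice_isSubLmodule of l2 by <:].

Definition l2dot (a b : l2) : R[i] := usum (fun t => a t * (b t)^*).

Lemma l2dotP (a b : l2) : has_sum (fun t => a t * (b t)^*) (l2dot a b).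
Proof.
have /asboolP[M aM] := valP a; have /asboolP[N bN] := valP b.
have [|s sE] := @norm_has_sum R T (fun t => a t * (b t)^*) (M + N); last first.
  by rewrite /l2dot (usumE sE).
move=> A; apply: (le_trans _ (lerD (aM A) (bN A))); rewrite -big_split/=.
apply: ler_sum => t _; rewrite normrM norm_conjC.
have := sqr_normB_ge0 (a t) (b t).
have : 0 <= `|a t| * `|b t| by rewrite mulr_ge0.
set x := `|a t|; set y := `|b t| => xy0 h; rewrite -subr_ge0.
by rewrite (_ : _ - _ = (x - y) ^+ 2 + x * y) ?addr_ge0//; ring.
Qed.

Fact l2dot_bilinear : bilinear_for *%R (Num.conj \; *%R) l2dot.
Proof.
split=> u c a b.
  apply: usumE; have := has_sumD (has_sumZ c (l2dotP a u)) (l2dotP b u).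
  by congr has_sum; apply/funext => t /=; rewrite [RHS]mulrDl mulrA.
apply: usumE; have := has_sumD (has_sumZ c^* (l2dotP u a)) (l2dotP u b).
congr has_sum; apply/funext => t /=.
by rewrite [in RHS]rmorphD rmorphM [RHS]mulrDr mulrCA.
Qed.

HB.instance Definition _ := bilinear_isBilinear.Build R[i] l2 l2 R[i]
  *%R (Num.conj \; *%R) l2dot l2dot_bilinear.

Fact l2dot_hermitian a b : l2dot a b = (-1) ^+ false * (l2dot b a)^*.
Proof.
rewrite expr0 mul1r; apply: usumE; have := has_sumJ (l2dotP b a).
by congr has_sum; apply/funext => t /=; rewrite rmorphM/= conjCK mulrC.
Qed.

HB.instance Definition _ := isHermitianSesquilinear.Build R[i] l2 false
  Num.conj l2dot l2dot_hermitian.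

Fact l2dot_gt0 (a : l2) : a != 0 -> 0 < l2dot a a.
Proof.
move=> a0.
have aaE t : a t * (a t)^* = `|a t| ^+ 2 by rewrite normCK.
have /asboolP[M aM] := valP a.
have [||s /usumE sE sge] := @ge0_has_sum R T (fun t => a t * (a t)^*) M.
- by move=> t; rewrite aaE exprn_ge0.
- by move=> A; under eq_bigr do rewrite aaE; exact: aM.
rewrite /l2dot sE.
have [t at0] : exists t, a t != 0.
  apply: contrapT => /forallNP h; move/negP: a0; apply.
  by apply/eqP/val_inj/funext => t; apply/eqP; have /negP := h t; rewrite negbK.
apply: lt_le_trans (sge [fset t]%fset).
by rewrite big_seq_fset1 aaE exprn_gt0// normr_gt0.
Qed.

HB.instance Definition _ := isDotProduct.Build R[i] l2 l2dot l2dot_gt0.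

End l2.

Section operators.
Context {R : realType} {H : lmodType R[i]} (dot : {dot H for Num.conj}).
Implicit Types (x y : H) (A B : H -> H) (M : set (H -> H)).

Definition hnorm x : R[i] := sqrtC (dot x x).

Definition hilbert_complete := forall u : nat -> H,
  (forall e : R[i], 0 < e -> exists N, forall m n, (N <= m)%N -> (N <= n)%N ->
    hnorm (u m - u n) < e) ->
  exists l, forall e : R[i], 0 < e -> exists N, forall n, (N <= n)%N ->
    hnorm (u n - l) < e.

(* Operators are bare functions; every set of operators considered below is
   contained in [bounded_op]. *)
Definition bounded_op A :=
  linear A /\ exists c : R[i], forall x, hnorm (A x) <= c * hnorm x.

Definition adjoint A B := forall x y, dot (A x) y = dot x (B y).

Definition commutant M : set (H -> H) :=
  [set A | bounded_op A /\ forall B, M B -> A \o B = B \o A].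

Definition bicommutant M := commutant (commutant M).

Definition unitary_op A := [/\ linear A, set_surj setT setT A &
  forall x y, dot (A x) (A y) = dot x y].

Definition unitary_representation (G : groupType) (pi : G -> H -> H) :=
  [/\ forall g, unitary_op (pi g), pi 1%g = id &
      forall g h, pi (g * h)%g = pi g \o pi h].

(* In a complex space this makes [B - A] positive, in particular self-adjoint. *)
Definition op_le A B := forall x, 0 <= dot (B x - A x) x.

Definition tracial_state M (tau : (H -> H) -> R[i]) :=
  [/\ forall (c : R[i]) A B, M A -> M B -> tau (c *: A + B) = c * tau A + tau B,
      forall A B, M A -> M B -> adjoint A B -> 0 <= tau (B \o A),
      tau id = 1 &
      forall A B, M A -> M B -> tau (A \o B) = tau (B \o A)].

Definition faithful_state M (tau : (H -> H) -> R[i]) := forall A B,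
  M A -> M B -> adjoint A B -> tau (B \o A) = 0 -> A = 0.

(* [S] is the least upper bound in [M] of the upward directed set [D]. *)
Definition directed_op_sup M (D : set (H -> H)) S :=
  [/\ D `<=` M, D !=set0,
      forall A B, D A -> D B -> exists2 C, D C & op_le A C /\ op_le B C,
      M S /\ (forall A, D A -> op_le A S) &
      forall B, M B -> (forall A, D A -> op_le A B) -> op_le S B].

(* Preservation of suprema of bounded increasing nets of positive elements. *)
Definition normal_state M (tau : (H -> H) -> R[i]) := forall D S,
  (forall A, D A -> op_le 0 A) -> directed_op_sup M D S ->
  supremums (tau @` D) (tau S).

Definition finite_vN_algebra M := exists tau : (H -> H) -> R[i],
  [/\ tracial_state M tau, faithful_state M tau & normal_state M tau].

End operators.

Definition vN_isomorphism (R : realType) (H K : lmodType R[i])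
    (dotH : {dot H for Num.conj}) (dotK : {dot K for Num.conj})
    (M : set (H -> H)) (N : set (K -> K)) (phi : (H -> H) -> K -> K) :=
  [/\ set_bij M N phi,
      forall (c : R[i]) A B, M A -> M B ->
        phi (c *: A + B) = c *: phi A + phi B,
      forall A B, M A -> M B -> phi (A \o B) = phi A \o phi B &
      forall A B, M A -> M B -> adjoint dotH A B ->
        adjoint dotK (phi A) (phi B)].

Section group_von_Neumann_algebra.
Context (R : realType) (G : groupType).

Fact left_regular_subproof (g : G) (a : l2 R G) :
  (fun t => a (g^-1 * t)%g) \in @square_summable R G.
Proof.
have /asboolP[M aM] := valP a; apply/asboolP; exists M => A.
have := aM [fset (g^-1 * t)%g | t in A]%fset.
by rewrite big_imfset//= => x y _ _ /mulgI.
Qed.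

Definition left_regular (g : G) (a : l2 R G) : l2 R G :=
  L2 (left_regular_subproof g a).

Definition group_vN_algebra : set (l2 R G -> l2 R G) :=
  bicommutant (@l2dot R G) (range left_regular).

Definition extends_to_vN_isomorphism (H : lmodType R[i])
    (dot : {dot H for Num.conj}) (pi : G -> H -> H) :=
  exists phi : (H -> H) -> l2 R G -> l2 R G,
    vN_isomorphism dot (@l2dot R G)
      (bicommutant dot (range pi)) group_vN_algebra phi /\
    forall g, phi (pi g) = left_regular g.

End group_von_Neumann_algebra.

Section group_actions.
Context (R : realType) (G : groupType).

Definition icc := forall g : G, g != 1%g ->
  infinite_set [set (g ^ h)%g | h in [set: G]].

(* [G] is discrete: joint continuity amounts to continuity of each [act g]. *)
Definition continuous_action (X : topologicalType) (act : G -> X -> X) :=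
  [/\ forall g, continuous (act g), forall x, act 1%g x = x &
      forall g h x, act (g * h)%g x = act g (act h x)].

Definition directed_preorder (I : Type) (le : I -> I -> Prop) :=
  [/\ inhabited I, forall i, le i i,
      forall i j k, le i j -> le j k -> le i k &
      forall i j, exists k, le i k /\ le j k].

(* Convergence of a net indexed by [le] is convergence along this filter. *)
Definition tail_filter (I : Type) (le : I -> I -> Prop) : set_system I :=
  filter_from setT (fun i => [set j | le i j]).

Definition borel (X : ptopologicalType) := g_sigma_algebraType (@open X).

Definition weak_star_cvg (X : ptopologicalType) (I : Type)
    (le : I -> I -> Prop) (mu : I -> set (borel X) -> \bar R)
    (nu : set (borel X) -> \bar R) :=
  forall f : X -> R, continuous f ->
    (\int[mu i]_y (f y)%:E)%E @[i --> tail_filter le] -->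
    (\int[nu]_y (f y)%:E)%E.

(* Regularity of [nu] would change nothing: only its integrals of continuous
   functions matter, and those are also given by a regular Borel measure. *)
Definition topological_boundary (X : ptopologicalType) (act : G -> X -> X) :=
  forall (nu : probability (borel X) R) (x : X),
  exists (I : Type) (le : I -> I -> Prop) (g : I -> G),
    directed_preorder le /\
    weak_star_cvg le
      (fun i => pushforward nu (act (g i) : borel X -> borel X))
      (dirac (x : borel X)).

Definition faithful_action (X : Type) (act : G -> X -> X) :=
  forall g, g != 1%g -> ~ forall x, act g x = x.

Definition admits_faithful_topological_boundary :=
  exists (X : ptopologicalType) (act : G -> X -> X),
    [/\ compact [set: X], hausdorff_space X, continuous_action act,
        topological_boundary act & faithful_action act].

Definition continuous_affine_action (E : tvsType R) (K : set E)
    (act : G -> E -> E) :=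
  [/\ forall g x, K x -> K (act g x),
      forall g, {within K, continuous (act g)},
      forall x, K x -> act 1%g x = x,
      forall g h x, K x -> act (g * h)%g x = act g (act h x) &
      forall g x y (t : R), K x -> K y -> 0 <= t <= 1 ->
        act g (t *: x + (1 - t) *: y) = t *: act g x + (1 - t) *: act g y].

(* Compact convex sets live in Hausdorff locally convex real vector spaces
   ([tvsType] includes local convexity). *)
Definition coamenable (S : pred G) := forall (E : tvsType R) (K : set E)
    (act : G -> E -> E),
  hausdorff_space E -> compact K -> convex_set K -> K !=set0 ->
  continuous_affine_action K act ->
  (exists2 x, K x & forall h, h \in S -> act h x = x) ->
  exists2 x, K x & forall g, act g x = x.

End group_actions.

(* Main.v *)
Require Import Defs.
From HB Require Import structures.
From mathcomp Require Import all_boot all_order all_algebra.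
From mathcomp Require Import sesquilinear finmap complex.
From mathcomp Require Import ring lra.
From mathcomp Require Import all_classical all_reals all_analysis.
From mathcomp Require Import measurable_realfun.

Set Implicit Arguments.
Unset Strict Implicit.
Unset Printing Implicit Defensive.

Import Order.TTheory GRing.Theory Num.Theory.
Import numFieldNormedType.Exports.

Local Open Scope classical_set_scope.
Local Open Scope ring_scope.

(** Let tau be a faithful normal trace on pi(Gamma)''. The point is that
    tau (pi g) = 0 for every g <> 1; then, Gamma being icc, the intertwiners
    between pi and the left regular representation have total ranges on both
    sides, and they carry pi(Gamma)'' onto L(Gamma).

    On Lambda, the normal state tau is, up to a small compression, dominated by
    the canonical trace of L(Lambda), for which averages over many distinct
    conjugates of h <> 1 are small; hence tau (pi h) = 0.

    For Gamma, consider the positive maps k from bounded functions on Gamma to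
    operators on the GNS space of tau o pi with k(1) = 1, encoded by their
    matrix coefficients. They form a compact convex set on which Gamma acts
    affinely. Since every Lambda-orbit in the GNS space is orthonormal, functions
    on Lambda act diagonally along it, and maximising a sum of such pieces gives
    a Lambda-fixed k; co-amenability then gives a Gamma-fixed one. Composing k
    with an orbit map yields a positive functional on continuous functions on the
    boundary. Choose g x <> x and F with F x = 1, F (g x) = 0, and push the
    functional towards the point mass at x: Cauchy-Schwarz for the two terms of
    <pi(g s), pi(s)> = k_F + k_(1-F) shows that tau (pi g) is arbitrarily
    small. The same displacement function shows that Gamma is icc. *)

(** * Hilbert spaces *)

(** Finiteness enters through tau(pi(s^-1 g s)) = tau(pi g). Once tau vanishes on Lambda off 1, this
    makes the Lambda-orbit of every pi(s) orthonormal in the GNS space, not only the orbit of pi(1).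
    It also removes from the last estimate the element s supplied by the boundary, over which there
    is no control.

    The hypothesis on Lambda is purely algebraic, whereas domination requires the transported
    canonical trace to be normal. Normality is recovered from the order: positive operators are
    squares up to scaling, so an isomorphism and its inverse preserve the order and hence suprema.
    Domination itself is an exhaustion by Zorn's lemma over chains of positive contractions, which
    is why square roots and suprema of chains come first.

    The GNS space is never constructed. Recording a positive map by real numbers k(f, y, z) makes
    compactness an instance of Tychonoff's theorem and places the convex set in a real locally
    convex space, as [coamenable] demands. *)

Section complex_reals.
Context {R : realType}.
Implicit Types z w : R[i].

Lemma ReD z w : complex.Re (z + w) = complex.Re z + complex.Re w.
Proof. by case: z w => a b [c d]. Qed.

Lemma ReN z : complex.Re (- z) = - complex.Re z.
Proof. by case: z. Qed.

Lemma ReB z w : complex.Re (z - w) = complex.Re z - complex.Re w.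
Proof. by rewrite ReD ReN. Qed.

Lemma ReJ z : complex.Re (Num.conj z) = complex.Re z.
Proof. by case: z. Qed.

Lemma ReZ (t : R) z : complex.Re (t%:C%C * z) = t * complex.Re z.
Proof. by case: z => a b /=; rewrite mul0r subr0. Qed.

Lemma ReMi z : complex.Re ('i%C * z) = - complex.Im z.
Proof. by case: z => a b /=; rewrite mul0r mul1r sub0r. Qed.

Lemma Re_eq z w : complex.Re z = complex.Re w ->
  complex.Re ('i%C * z) = complex.Re ('i%C * w) -> z = w.
Proof. by rewrite !ReMi; case: z w => a b [c d] /= -> /oppr_inj ->. Qed.

Lemma ge0_ReE z : 0 <= z -> z = (complex.Re z)%:C%C.
Proof. by move=> z0; rewrite RRe_real// ger0_real. Qed.

Lemma ge0_Re z : 0 <= z -> 0 <= complex.Re z.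
Proof. by rewrite lecE => /andP[]. Qed.

Lemma conj_realC (t : R) : Num.conj (t%:C%C : R[i]) = t%:C%C.
Proof. by apply/eqP; rewrite eq_complex /= oppr0 !eqxx. Qed.

Lemma conj_iC : Num.conj ('i%C : R[i]) = - 'i%C.
Proof. by apply/eqP; rewrite eq_complex /= oppr0 !eqxx. Qed.

Lemma mul_iC_iC : 'i%C * 'i%C = -1 :> R[i].
Proof. by rewrite -expr2 sqr_i. Qed.

(* Letting t tend to 0 from both sides kills the linear coefficient. *)
Lemma quadratic_ge0_linear_eq0 (a b : R) :
  (forall t, 0 <= t * a *+ 2 + t ^+ 2 * b) -> a = 0.
Proof.
move=> h; apply/eqP; apply: contraT => a0.
have b0 : 0 < 1 + `|b| by rewrite ltr_pwDl.
have a2 : 0 < a ^+ 2 by rewrite exprn_even_gt0.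
(* This t has the sign opposite to a and is small enough for the linear term to beat the quadratic
   one. *)
have := h (- a / (1 + `|b|)); rewrite leNgt => /negP[].
have -> : - a / (1 + `|b|) * a *+ 2 + (- a / (1 + `|b|)) ^+ 2 * b =
  a ^+ 2 * (b - 2 * (1 + `|b|)) / (1 + `|b|) ^+ 2.
  by field; rewrite gt_eqF.
rewrite pmulr_llt0 ?invr_gt0 ?exprn_gt0// pmulr_rlt0// subr_lt0.
by have := ler_norm b; have := normr_ge0 b; lra.
Qed.

Lemma ler_epsP (a b : R) : (forall e, 0 < e -> a <= b + e) -> a <= b.
Proof. by move=> h; apply/ler_addgt0Pr => e /h. Qed.

End complex_reals.

Section linear_maps.
Context {R : pzRingType} {U V : lmodType R} {A : U -> V} (lA : linear A).

Lemma linD x y : A (x + y) = A x + A y.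
Proof. by have := lA 1 x y; rewrite !scale1r. Qed.

Lemma lin0 : A 0 = 0.
Proof. by apply: (@addrI _ (A 0)); rewrite -linD !addr0. Qed.

Lemma linZ c x : A (c *: x) = c *: A x.
Proof. by have := lA c x 0; rewrite lin0 !addr0. Qed.

Lemma linN x : A (- x) = - A x.
Proof. by rewrite -scaleN1r linZ scaleN1r. Qed.

Lemma linB x y : A (x - y) = A x - A y.
Proof. by rewrite linD linN. Qed.

Lemma lin_sum (I : Type) (s : seq I) (F : I -> U) :
  A (\sum_(i <- s) F i) = \sum_(i <- s) A (F i).
Proof.
elim: s => [|i s IH]; first by rewrite !big_nil lin0.
by rewrite !big_cons linD IH.
Qed.

End linear_maps.

Section hilbert.
Context {R : realType} {H : lmodType R[i]} (dot : {dot H for Num.conj}).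
Implicit Types (x y z : H) (a b : R[i]).

Lemma dotDl x y z : dot (x + y) z = dot x z + dot y z.
Proof. exact: linearDl. Qed.
Lemma dotDr x y z : dot z (x + y) = dot z x + dot z y.
Proof. exact: linearDr. Qed.
Lemma dotNl x z : dot (- x) z = - dot x z.
Proof. exact: linearNl. Qed.
Lemma dotNr x z : dot z (- x) = - dot z x.
Proof. exact: linearNr. Qed.
Lemma dotBl x y z : dot (x - y) z = dot x z - dot y z.
Proof. by rewrite dotDl dotNl. Qed.
Lemma dotBr x y z : dot z (x - y) = dot z x - dot z y.
Proof. by rewrite dotDr dotNr. Qed.
Lemma dotZl a x z : dot (a *: x) z = a * dot x z.
Proof. by rewrite linearZl_LR. Qed.
Lemma dotZr a x z : dot z (a *: x) = Num.conj a * dot z x.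
Proof. by rewrite linearZr_LR. Qed.
Lemma dot0l z : dot 0 z = 0. Proof. exact: linear0l. Qed.
Lemma dot0r z : dot z 0 = 0. Proof. exact: linear0r. Qed.
Lemma dotC x y : dot x y = Num.conj (dot y x).
Proof. by rewrite hermC expr0 mul1r. Qed.

Lemma dot_suml (I : Type) (s : seq I) (F : I -> H) z :
  dot (\sum_(i <- s) F i) z = \sum_(i <- s) dot (F i) z.
Proof.
elim: s => [|i s IH]; first by rewrite !big_nil dot0l.
by rewrite !big_cons dotDl IH.
Qed.
Lemma dot_sumr (I : Type) (s : seq I) (F : I -> H) z :
  dot z (\sum_(i <- s) F i) = \sum_(i <- s) dot z (F i).
Proof.
elim: s => [|i s IH]; first by rewrite !big_nil dot0r.
by rewrite !big_cons dotDr IH.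
Qed.

Lemma dot_ge0 x : 0 <= dot x x.
Proof.
have [->|x0] := eqVneq x 0; first by rewrite dot0l.
exact/ltW/neq0_dnorm_gt0.
Qed.

Lemma dot_eq0 x : dot x x = 0 -> x = 0.
Proof.
have [//|x0 xx] := eqVneq x 0.
have : 0 < dot x x by exact: neq0_dnorm_gt0.
by rewrite xx ltxx.
Qed.

Lemma dotl_eq0 x : (forall y, dot x y = 0) -> x = 0.
Proof. by move=> /(_ x)/dot_eq0. Qed.

Lemma dotl_inj x y : (forall z, dot x z = dot y z) -> x = y.
Proof.
move=> h; apply/eqP; rewrite -subr_eq0; apply/eqP/dotl_eq0 => z.
by rewrite dotBl h subrr.
Qed.

Lemma dotr_inj x y : (forall z, dot z x = dot z y) -> x = y.
Proof. by move=> h; apply: dotl_inj => z; rewrite dotC h -dotC. Qed.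

(** Estimates are carried out over R with the real part; a complex identity is recovered from the
    real parts at x and at i x, see [dot_Re_eq]. *)
Definition rdot x y : R := complex.Re (dot x y).
Definition nrm x : R := Num.sqrt (rdot x x).

Lemma rdotC x y : rdot x y = rdot y x.
Proof. by rewrite /rdot dotC ReJ. Qed.
Lemma rdotDl x y z : rdot (x + y) z = rdot x z + rdot y z.
Proof. by rewrite /rdot dotDl ReD. Qed.
Lemma rdotBl x y z : rdot (x - y) z = rdot x z - rdot y z.
Proof. by rewrite /rdot dotBl ReB. Qed.
Lemma rdotDr x y z : rdot z (x + y) = rdot z x + rdot z y.
Proof. by rewrite /rdot dotDr ReD. Qed.
Lemma rdotBr x y z : rdot z (x - y) = rdot z x - rdot z y.
Proof. by rewrite /rdot dotBr ReB. Qed.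
Lemma rdotZl (t : R) x z : rdot (t%:C%C *: x) z = t * rdot x z.
Proof. by rewrite /rdot dotZl ReZ. Qed.
Lemma rdotZr (t : R) x z : rdot z (t%:C%C *: x) = t * rdot z x.
Proof. by rewrite rdotC rdotZl rdotC. Qed.
Lemma rdot0r z : rdot z 0 = 0. Proof. by rewrite /rdot dot0r. Qed.

Lemma rdot_ge0 x : 0 <= rdot x x. Proof. exact/ge0_Re/dot_ge0. Qed.
Lemma dotxxE x : dot x x = (rdot x x)%:C%C. Proof. exact/ge0_ReE/dot_ge0. Qed.
Lemma nrm_ge0 x : 0 <= nrm x. Proof. exact: sqrtr_ge0. Qed.
Lemma nrm2E x : nrm x ^+ 2 = rdot x x. Proof. exact/sqr_sqrtr/rdot_ge0. Qed.

Lemma nrm_eq0 x : nrm x = 0 -> x = 0.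
Proof.
by move=> x0; apply: dot_eq0; rewrite dotxxE -nrm2E x0 expr0n.
Qed.

Lemma nrm0 : nrm 0 = 0. Proof. by rewrite /nrm rdot0r sqrtr0. Qed.

Lemma hnormE x : hnorm dot x = (nrm x)%:C%C.
Proof.
apply/eqP; rewrite -(@eqrXn2 _ 2)// ?sqrtC_ge0 ?dot_ge0 ?ler0c ?nrm_ge0//.
by rewrite /hnorm sqrtCK -rmorphXn nrm2E dotxxE.
Qed.

Lemma rdot_CS2 x y : rdot x y ^+ 2 <= rdot x x * rdot y y.
Proof.
have [y0|y0] := eqVneq (rdot y y) 0.
  have -> : y = 0 by apply: nrm_eq0; rewrite /nrm y0 sqrtr0.
  by rewrite !rdot0r expr0n mulr0.
have y1 : 0 < rdot y y by rewrite lt_def y0 rdot_ge0.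
have := rdot_ge0 ((rdot y y)%:C%C *: x - (rdot x y)%:C%C *: y).
rewrite rdotBl !rdotBr !rdotZl !rdotZr (rdotC y x).
set p := rdot y y; set q := rdot x y; set r := rdot x x => h.
have : 0 <= p * (r * p - q ^+ 2).
  apply: le_trans h _; rewrite le_eqVlt; apply/orP; left; apply/eqP; ring.
by rewrite pmulr_rge0// subr_ge0.
Qed.

Lemma rdot_CS x y : `|rdot x y| <= nrm x * nrm y.
Proof.
rewrite -(@ler_pXn2r _ 2)// ?nnegrE ?mulr_ge0 ?nrm_ge0//.
by rewrite real_normK ?num_real// exprMn !nrm2E rdot_CS2.
Qed.

Lemma rdot_le x y : rdot x y <= nrm x * nrm y.
Proof. exact: le_trans (ler_norm _) (rdot_CS _ _). Qed.

Lemma nrmD x y : nrm (x + y) <= nrm x + nrm y.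
Proof.
rewrite -(@ler_pXn2r _ 2)// ?nnegrE ?addr_ge0 ?nrm_ge0// nrm2E.
rewrite rdotDl !rdotDr sqrrD !nrm2E (rdotC y x).
by have := rdot_le x y; lra.
Qed.

Lemma nrmN x : nrm (- x) = nrm x.
Proof. by rewrite /nrm /rdot dotNl dotNr opprK. Qed.

Lemma nrmBC x y : nrm (x - y) = nrm (y - x).
Proof. by rewrite -nrmN opprB. Qed.

Lemma nrmBD x y z : nrm (x - z) <= nrm (x - y) + nrm (y - z).
Proof. by rewrite -[x in leLHS](subrK y) -addrA nrmD. Qed.

Lemma nrmZ (t : R) x : nrm (t%:C%C *: x) = `|t| * nrm x.
Proof.
rewrite /nrm rdotZl rdotZr mulrA -expr2 sqrtrM ?sqr_ge0//.
by rewrite sqrtr_sqr.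
Qed.

Lemma parallelogram x y :
  rdot (x + y) (x + y) + rdot (x - y) (x - y) = (rdot x x + rdot y y) *+ 2.
Proof. by rewrite !rdotBl !rdotBr !rdotDl !rdotDr; ring. Qed.

Lemma dot_Re_eq x y z w : rdot x y = rdot z w ->
  rdot ('i%C *: x) y = rdot ('i%C *: z) w -> dot x y = dot z w.
Proof. by move=> h1 h2; apply: Re_eq => //; move: h2; rewrite /rdot !dotZl. Qed.

Section completeness.
Hypothesis H_complete : hilbert_complete dot.

Lemma cauchy_has_limit (u : nat -> H) :
  (forall e : R, 0 < e -> exists N, forall m n, (N <= m)%N -> (N <= n)%N ->
    nrm (u m - u n) < e) ->
  exists l, forall e : R, 0 < e -> exists N, forall n, (N <= n)%N ->
    nrm (u n - l) < e.
Proof.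
move=> cu; have [e e0|l hl] := H_complete (u := u).
  have eE : e = (complex.Re e)%:C%C by apply: ge0_ReE; apply: ltW.
  have e0' : 0 < complex.Re e by move: e0; rewrite eE ltcR.
  have [N HN] := cu _ e0'; exists N => m n Nm Nn.
  by rewrite hnormE eE ltcR HN.
exists l => e e0; have e0' : 0 < e%:C%C :> R[i] by rewrite ltcR.
by have [N HN] := hl _ e0'; exists N => n /HN; rewrite hnormE ltcR.
Qed.

Lemma invSn_lt (e : R) : 0 < e -> exists N, forall n, (N <= n)%N ->
  n.+1%:R^-1 < e.
Proof.
move=> e0; exists (Num.bound e^-1) => n Nn.
rewrite invf_plt ?posrE//; apply: (lt_le_trans (archi_boundP _)).
  by rewrite invr_ge0 ltW.
by rewrite ler_nat (leq_trans Nn).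
Qed.

(* The functional is given by its graph [G], a subspace of [H * C]; the
   representing vector minimises [|x|^2 - 2 Re c] over [G], so the domain need
   not be closed. *)
Lemma riesz_representation (G : H -> R[i] -> Prop) (K : R) :
  G 0 0 -> (forall a x c y d, G x c -> G y d -> G (a *: x + y) (a * c + d)) ->
  (forall x c, G x c -> complex.Re c <= K * nrm x) -> 0 <= K ->
  exists z, [/\ nrm z <= K, forall x c, G x c -> c = dot x z &
    forall e, 0 < e -> exists x c, G x c /\ nrm (x - z) < e].
Proof.
move=> G0 Glin GK K0.
pose J x c := rdot x x - complex.Re c *+ 2.
pose E := [set - J p.1 p.2 | p in [set p | G p.1 p.2]].
have Jge x c : G x c -> - K ^+ 2 <= J x c.
  move=> /GK h; rewrite /J -nrm2E; have := sqr_ge0 (nrm x - K).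
  by rewrite sqrrB; move: (nrm_ge0 x) h; lra.
have supE : has_sup E.
  split; first by exists (- J 0 0), (0, 0).
  by exists (K ^+ 2) => _ [[x c] /= /Jge h <-]; rewrite lerNl.
have [m mJ Jnear] : exists2 m, forall x c, G x c -> 0 <= m + J x c &
    forall n, exists p : H * R[i], G p.1 p.2 /\ m + J p.1 p.2 < n.+1%:R^-1.
  exists (sup E) => [x c Gxc|n].
    rewrite -lerBlDr sub0r.
    by apply: sup_upper_bound => //; exists (x, c).
  have n0 : 0 < n.+1%:R^-1 :> R by rewrite invr_gt0.
  have [_ [[x c] /= Gxc <-] h] := sup_adherent n0 supE.
  exists (x, c); split=> //=; move: h.
  by move: (_^-1) (J x c) (sup E) => i j k; lra.
have [p Hp] := choice Jnear.
have Gp n : G (p n).1 (p n).2 by case: (Hp n).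
have Jp n : m + J (p n).1 (p n).2 < n.+1%:R^-1 by case: (Hp n).
pose u n := (p n).1.
have dist i j : nrm (u i - u j) ^+ 2 < (i.+1%:R^-1 + j.+1%:R^-1) *+ 2.
  (* J is at least -m at the midpoint of u_i and u_j, so the parallelogram law turns near-minimality
     of both points into closeness. *)
  have G1 := Glin (2^-1)%:C%C _ _ _ _ (Gp i) G0.
  have G2 := Glin (2^-1)%:C%C _ _ _ _ (Gp j) G1.
  rewrite !addr0 in G2; have := mJ _ _ G2.
  rewrite /J ReD !ReZ rdotDl !rdotDr !rdotZl !rdotZr.
  rewrite nrm2E rdotBl !rdotBr /u.
  have := Jp i; have := Jp j; rewrite /J (rdotC (p j).1 (p i).1).
  move: (i.+1%:R^-1) (j.+1%:R^-1) => v w.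
  lra.
have [e e0|z zlim] := cauchy_has_limit (u := u).
  have e4 : 0 < e ^+ 2 / 4 by rewrite divr_gt0// exprn_gt0.
  have [N HN] := invSn_lt e4; exists N => i j Ni Nj.
  rewrite -(@ltr_pXn2r _ 2)// ?nnegrE ?nrm_ge0// ?ltW//.
  have := dist i j; have := HN _ Ni; have := HN _ Nj.
  by move: (i.+1%:R^-1) (j.+1%:R^-1) (e ^+ 2) => v w e2; lra.
have zapp e : 0 < e -> exists n, nrm (u n - z) < e /\ n.+1%:R^-1 < e.
  move=> e0; have [N HN] := zlim _ e0; have [N' HN'] := invSn_lt e0.
  exists (maxn N N'); split; first by rewrite HN// leq_maxl.
  by rewrite HN'// leq_maxr.
(* First variation of J at the minimiser in the direction w. As z need not lie in the domain, a
   nearby u_n takes its place. *)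
have zRe w d : G w d -> complex.Re d = rdot w z.
  move=> Gwd; apply/esym/eqP; rewrite -subr_eq0; apply/eqP.
  apply: (@quadratic_ge0_linear_eq0 _ _ (rdot w w)) => t.
  rewrite -[leRHS]addr0; apply: ler_epsP => e e0.
  have c0 : 0 < 1 + `|t| * nrm w *+ 2.
    by rewrite ltr_pwDl// mulrn_wge0// mulr_ge0// nrm_ge0.
  have [n [h1 h2]] := zapp (e / (1 + `|t| * nrm w *+ 2)) (divr_gt0 e0 c0).
  have := mJ _ _ (Glin t%:C%C _ _ _ _ Gwd (Gp n)).
  rewrite /J ReD ReZ rdotDl !rdotDr !rdotZl !rdotZr -/(u n).
  have := Jp n; rewrite /J -/(u n) (rdotC (u n) w).
  have h3 : t * rdot w (u n) <= t * rdot w z + `|t| * nrm w * nrm (u n - z).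
    rewrite -lerBlDl -mulrBr -rdotBr.
    rewrite (le_trans (ler_norm _))// normrM -mulrA ler_wpM2l//.
    exact: rdot_CS.
  have h4 : `|t| * nrm w * nrm (u n - z) <=
      `|t| * nrm w * (e / (1 + `|t| * nrm w *+ 2)).
    by rewrite ler_wpM2l ?mulr_ge0 ?nrm_ge0// ltW.
  have h5 : e / (1 + `|t| * nrm w *+ 2) +
     `|t| * nrm w * (e / (1 + `|t| * nrm w *+ 2)) *+ 2 = e.
    move: c0; set q := `|t| * nrm w => c0.
    rewrite -[X in X + _]mul1r -mulrnAl -mulrDl mulrC divfK// gt_eqF//.
  move: h2 h3 h4 h5; move: (n.+1%:R^-1) => N1.
  move: (e / _) => e1; rewrite expr2.
  lra.
have zE w d : G w d -> d = dot w z.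
  move=> Gwd; apply: Re_eq; first exact: zRe.
  have := zRe _ _ (Glin 'i%C _ _ _ _ Gwd G0).
  by rewrite !addr0 /rdot dotZl.
exists z; split=> //; last first.
  by move=> e /zapp[n [h _]]; exists (u n), (p n).2; split; first exact: Gp.
(* |z|^2 is close to <u_n, z> = Re c_n <= K |u_n|, which is close to K |z|. *)
have : nrm z ^+ 2 <= K * nrm z.
  apply: ler_epsP => e e0.
  have c0 : 0 < K + nrm z + 1 by rewrite ltr_wpDl// addr_ge0// nrm_ge0.
  have [n [h _]] := zapp (e / (K + nrm z + 1)) (divr_gt0 e0 c0).
  have h1 := zRe _ _ (Gp n); rewrite -/(u n) in h1.
  have h2 := GK _ _ (Gp n); rewrite -/(u n) in h2.
  have h3 : nrm (u n) <= nrm z + nrm (u n - z).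
    by rewrite addrC -{1}[u n](subrK z) nrmD.
  have h4 := rdot_le (z - u n) z; rewrite rdotBl nrmBC -nrm2E in h4.
  have h5 : nrm (u n - z) * (K + nrm z) <= e.
    rewrite ltW// (lt_le_trans (y := e / (K + nrm z + 1) * (K + nrm z + 1)))//.
      rewrite (le_lt_trans (y := nrm (u n - z) * (K + nrm z + 1)))//.
        by rewrite ler_wpM2l ?nrm_ge0// lerDl.
      by rewrite ltr_pM2r.
    by rewrite divfK// gt_eqF.
  have h6 : K * nrm (u n) <= K * (nrm z + nrm (u n - z)) by rewrite ler_wpM2l.
  move: h1 h2 h4 h5 h6; move: (nrm (u n - z)) => r.
  move: (rdot (u n) z) (complex.Re _) (nrm (u n)) => p1 p2 p3.
  move: (nrm z ^+ 2) => q; move: (nrm z) => zz.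
  nra.
have [->|z0] := eqVneq (nrm z) 0; first by rewrite mulr0.
have z1 : 0 < nrm z by rewrite lt_def z0 nrm_ge0.
by rewrite expr2 ler_pM2r.
Qed.

End completeness.
End hilbert.

(** * Order on bounded operators *)

Local Notation normc := ComplexField.Normc.normc.

Section adjoints.
Context {R : realType}.

(** Boundedness with a real nonnegative constant, and between two spaces, as intertwiners
    require. *)
Definition bmap {H K : lmodType R[i]} (dotH : {dot H for Num.conj})
    (dotK : {dot K for Num.conj}) (V : H -> K) :=
  linear V /\ exists2 c : R, 0 <= c & forall x, nrm dotK (V x) <= c * nrm dotH x.

Definition adj {H K : lmodType R[i]} (dotH : {dot H for Num.conj})
    (dotK : {dot K for Num.conj}) (V : H -> K) (W : K -> H) :=
  forall x y, dotK (V x) y = dotH x (W y).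

Section one_space.
Context {H : lmodType R[i]} (dot : {dot H for Num.conj}).

Lemma bounded_opE (A : H -> H) : bounded_op dot A <-> bmap dot dot A.
Proof.
split=> -[lA [c Ac]]; split=> //; last first.
  by exists c%:C%C => x; rewrite !hnormE -rmorphM lecR.
(* On the zero space nothing forces the real part of c to be nonnegative. *)
exists (Num.max 0 (complex.Re c)); first by rewrite le_max lexx.
move=> x; have := Ac x; rewrite !hnormE mulrC lecE ReZ => /andP[_] h.
rewrite (le_trans h)// mulrC ler_wpM2r ?nrm_ge0//.
by rewrite le_max lexx orbT.
Qed.

Lemma bmap_id : bmap dot dot id.
Proof. by split=> //; exists 1 => // x; rewrite mul1r. Qed.

End one_space.

Lemma nrmZC {H : lmodType R[i]} (dot : {dot H for Num.conj}) (a : R[i]) x :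
  nrm dot (a *: x) = normc a * nrm dot x.
Proof.
rewrite /nrm /rdot dotZl dotZr mulrA dotxxE mulrC ReZ mulrC sqrtrM.
  by congr (_ * _); case: a => p q /=; congr Num.sqrt; ring.
by case: a => p q /=; rewrite mulrN opprK addr_ge0// -expr2 sqr_ge0.
Qed.

Lemma normc_ge0 (a : R[i]) : 0 <= normc a.
Proof. by case: a => p q; exact: sqrtr_ge0. Qed.

Section two_spaces.
Context {H K L : lmodType R[i]} (dotH : {dot H for Num.conj})
  (dotK : {dot K for Num.conj}) (dotL : {dot L for Num.conj}).

Lemma bmap_comp (V : K -> L) (W : H -> K) :
  bmap dotK dotL V -> bmap dotH dotK W -> bmap dotH dotL (V \o W).
Proof.
move=> [lV [c c0 Vc]] [lW [d d0 Wd]]; split.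
  by move=> a x y /=; rewrite lW lV.
exists (c * d); first by rewrite mulr_ge0.
by move=> x /=; rewrite (le_trans (Vc _))// -mulrA ler_wpM2l.
Qed.

Lemma bmap_lin (a : R[i]) (V W : H -> K) :
  bmap dotH dotK V -> bmap dotH dotK W -> bmap dotH dotK (a *: V + W).
Proof.
move=> [lV [c c0 Vc]] [lW [d d0 Wd]]; split.
  move=> b x y; have E z : (a *: V + W) z = a *: V z + W z by [].
  rewrite !E lV lW !scalerDr !scalerA (mulrC a b) -!addrA; congr (_ + _).
  by rewrite addrCA.
exists (normc a * c + d); first by rewrite addr_ge0// mulr_ge0// normc_ge0.
move=> x; have E z : (a *: V + W) z = a *: V z + W z by [].
rewrite E (le_trans (nrmD _ _ _))// mulrDl lerD// nrmZC -mulrA.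
by rewrite ler_wpM2l// normc_ge0.
Qed.

Lemma adj_sym (V : H -> K) W : adj dotH dotK V W -> adj dotK dotH W V.
Proof. by move=> h x y; rewrite dotC -h -dotC. Qed.

Lemma bmap_adj (V : H -> K) : hilbert_complete dotH -> bmap dotH dotK V ->
  exists2 W, bmap dotK dotH W & adj dotH dotK V W.
Proof.
move=> Hc [lV [c c0 Vc]].
have ex y : exists z, nrm dotH z <= c * nrm dotK y /\
    forall x, dotK (V x) y = dotH x z.
  have [||||z [z1 z2 _]] := @riesz_representation R H dotH Hc
    (fun x d => d = dotK (V x) y) (c * nrm dotK y).
  - by rewrite (lin0 lV) dot0l.
  - by move=> a x d x' d' -> ->; rewrite lV dotDl dotZl.
  - move=> x _ ->; rewrite (le_trans (rdot_le _ _ _))//.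
    by rewrite mulrAC ler_wpM2r ?nrm_ge0.
  - by rewrite mulr_ge0 ?nrm_ge0.
  by exists z; split=> // x; exact: z2.
have [W hW] := choice ex.
have aW : adj dotH dotK V W by move=> x y; case: (hW y).
exists W => //; split; last by exists c => // y; case: (hW y).
move=> a x y; apply: (@dotr_inj _ _ dotH) => z.
by rewrite dotDr dotZr -!aW dotDr dotZr.
Qed.

End two_spaces.
End adjoints.

Section positive_operators.
Context {R : realType} {H : lmodType R[i]} (dot : {dot H for Num.conj}).
Implicit Types (A B x y : H -> H).
Local Notation nrm := (nrm dot).
Local Notation rdot := (rdot dot).

Definition ole A B := forall v, rdot (A v) v <= rdot (B v) v.

Definition selfadj A := linear A /\ adjoint dot A A.

Definition segment B A := [/\ selfadj A, ole 0 A & ole A B].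

Lemma selfadj_rdotC A v w : selfadj A -> rdot (A v) w = rdot v (A w).
Proof. by move=> [_ h]; rewrite /(rdot _ _) h. Qed.

Lemma selfadj_dotE A v : selfadj A -> dot (A v) v = (rdot (A v) v)%:C%C.
Proof.
move=> [_ h]; apply/esym/RRe_real/complex_realP.
have := dotC dot (A v) v; rewrite -(h v v).
case: (dot (A v) v) => a b [] /eqP; rewrite -subr_eq0 opprK -mulr2n.
by rewrite mulrn_eq0/= => /eqP ->; exists a.
Qed.

Lemma op_le_ole A B : op_le dot A B -> ole A B.
Proof. by move=> h v; have /ge0_Re := h v; rewrite dotBl ReB subr_ge0. Qed.

Lemma ole_op_le A B : selfadj A -> selfadj B -> ole A B -> op_le dot A B.
Proof.
move=> sA sB h v; rewrite dotBl !selfadj_dotE// -rmorphB/= ler0c subr_ge0.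
exact: h.
Qed.

Lemma selfadj0 : selfadj 0.
Proof.
split; first by move=> a v w; rewrite scaler0 addr0.
by move=> v w; rewrite dot0l dot0r.
Qed.

Lemma selfadj_id : selfadj id. Proof. by []. Qed.

Lemma selfadjD A B : selfadj A -> selfadj B -> selfadj (A + B).
Proof.
move=> [lA aA] [lB aB]; split.
  by move=> a v w; rewrite !fctE lA lB scalerDr addrACA.
by move=> v w; rewrite !fctE dotDl dotDr aA aB.
Qed.

Lemma selfadjZ (t : R) A : selfadj A -> selfadj (t%:C%C *: A).
Proof.
move=> [lA aA]; split.
  by move=> a v w; rewrite !fctE lA scalerDr !scalerA mulrC.
by move=> v w; rewrite !fctE dotZl dotZr aA conj_realC.
Qed.

Lemma selfadjB A B : selfadj A -> selfadj B -> selfadj (A - B).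
Proof.
move=> sA sB; have := selfadjD sA (selfadjZ (-1) sB).
by rewrite rmorphN1 scaleN1r.
Qed.

Lemma selfadj_sandwich A B B' : selfadj A -> linear B -> linear B' ->
  adjoint dot B B' -> selfadj (B' \o A \o B).
Proof.
move=> [lA aA] lB lB' BB'; split.
  by move=> a v w /=; rewrite lB lA lB'.
move=> v w /=; have h := adj_sym BB'.
by rewrite h aA BB'.
Qed.

Lemma selfadj_square A : selfadj A -> selfadj (A \o A).
Proof. by move=> [lA aA]; apply: (@selfadj_sandwich id). Qed.

(** Polarisation: the quadratic form of A is real, and its values at v + w and i v + w give the
    imaginary and the real part of the identity. *)
Lemma op_ge0_selfadj A : linear A -> op_le dot 0 A -> selfadj A.
Proof.
move=> lA A0; split=> // v w.
have im u : complex.Im (dot (A u) u) = 0.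
  by have := A0 u; rewrite subr0 => /ger0_Im.
have := im (v + w); have := im ('i%C *: v + w).
rewrite !(linD lA) (linZ lA) !dotDl !dotDr !dotZl !dotZr conj_iC.
rewrite [dot v (A w)]dotC; move: (im v) (im w).
case: (dot (A v) v) (dot (A w) w) (dot (A v) w) (dot (A w) v).
move=> a b [c d] [e f] [g h]; rewrite /= => -> ->.
rewrite !(mul0r, mulr0, mul1r, mulN1r, mulNr, mulrN, add0r, addr0, sub0r, subr0,
  opprK, oppr0) => h1 h2; apply/eqP; rewrite eq_complex/=.
by apply/andP; split; apply/eqP; lra.
Qed.

Lemma ole_refl A : ole A A. Proof. by []. Qed.
Lemma ole_trans A B C : ole A B -> ole B C -> ole A C.
Proof. by move=> h1 h2 v; exact: le_trans (h1 v) (h2 v). Qed.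

Lemma ole_anti A B : selfadj A -> selfadj B -> ole A B -> ole B A -> A = B.
Proof.
move=> sA sB AB BA; apply/eqP; rewrite -subr_eq0; apply/eqP/funext => v.
have sD := selfadjB sA sB; have lD := sD.1.
have D0 u : rdot ((A - B) u) u = 0.
  by rewrite rdotBl; apply/eqP; rewrite subr_eq0 eq_le AB BA.
apply: (@nrm_eq0 _ _ dot); rewrite /(nrm _).
move: (A - B) sD lD D0 => D sD lD D0.
(* Polarising the vanishing form of D at v and D v leaves 2 |D v|^2 = 0. *)
have := D0 (v + D v).
rewrite (linD lD) rdotDl !rdotDr !D0 addr0 add0r.
rewrite [rdot (D (D v)) v](selfadj_rdotC _ _ sD).
by rewrite -mulr2n => /eqP; rewrite mulrn_eq0/= => /eqP ->; rewrite sqrtr0.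
Qed.

Lemma ole0_CS A v w : selfadj A -> ole 0 A ->
  rdot (A v) w ^+ 2 <= rdot (A v) v * rdot (A w) w.
Proof.
move=> sA A0; have lA := sA.1.
have A0' u : 0 <= rdot (A u) u by have := A0 u; rewrite rdotC rdot0r.
have sym : rdot (A w) v = rdot (A v) w by rewrite selfadj_rdotC// rdotC.
have q t : 0 <= rdot (A v) v + t * rdot (A v) w *+ 2 + t ^+ 2 * rdot (A w) w.
  have := A0' (v + t%:C%C *: w); rewrite (linD lA) (linZ lA).
  rewrite rdotDl !rdotDr !rdotZl !rdotZr sym; congr (0 <= _); ring.
have [w0|w0] := eqVneq (rdot (A w) w) 0.
  suff -> : rdot (A v) w = 0 by rewrite expr0n mulr_ge0.
  apply/eqP; apply: contraT => b0.
  (* This t would give the quadratic the value -1. *)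
  have := q (- (rdot (A v) v + 1) / (rdot (A v) w *+ 2)).
  rewrite w0 mulr0 addr0 -mulr_natl mulrCA mulr_natl divfK; first by lra.
  by rewrite mulrn_eq0.
have w1 : 0 < rdot (A w) w by rewrite lt_def w0 A0'.
have := q (- rdot (A v) w / rdot (A w) w).
rewrite -(pmulr_lge0 _ w1) => h.
have E : (rdot (A v) v + - rdot (A v) w / rdot (A w) w * rdot (A v) w *+ 2 +
  (- rdot (A v) w / rdot (A w) w) ^+ 2 * rdot (A w) w) * rdot (A w) w =
  rdot (A v) v * rdot (A w) w - rdot (A v) w ^+ 2 by field.
by move: h; rewrite E subr_ge0.
Qed.

(** A^2 <= A for a positive contraction: Cauchy-Schwarz for the form of A at v and A v gives |A v|^4
    <= <A v, v> |A v|^2. It is the tool that turns small values of a form into small norms. *)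
Lemma segment_nrm2 A v : segment id A -> rdot (A v) (A v) <= rdot (A v) v.
Proof.
move=> [sA A0 A1]; have h := ole0_CS v (A v) sA A0.
have h1 := A1 (A v); have h2 := A0 v; rewrite rdotC rdot0r in h2.
have [z|z] := eqVneq (rdot (A v) (A v)) 0; first by rewrite z.
have z1 : 0 < rdot (A v) (A v) by rewrite lt_def z rdot_ge0.
rewrite -(ler_pM2r z1) -expr2 (le_trans h)//; first exact: ler_wpM2l.
Qed.

Lemma segment_nrm A v : segment id A -> nrm (A v) <= nrm v.
Proof.
move=> sA; rewrite ler_wsqrtr// (le_trans (segment_nrm2 v sA))//.
by case: sA => _ _; exact.
Qed.

Lemma segment_bmap A : segment id A -> bmap dot dot A.
Proof.
move=> sA; split; first by case: sA => -[].
by exists 1 => // v; rewrite mul1r segment_nrm.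
Qed.

Lemma segment_sub A B : segment id A -> segment id B -> ole A B ->
  segment id (B - A).
Proof.
move=> [sA A0 A1] [sB B0 B1] AB; split; first exact: selfadjB.
  by move=> v; rewrite rdotBl rdotC rdot0r subr_ge0.
move=> v; rewrite rdotBl lerBlDr (le_trans (B1 v))// lerDl.
by have := A0 v; rewrite rdotC rdot0r.
Qed.

Section completeness.
Hypothesis H_complete : hilbert_complete dot.

(** Along the chain <A v, v> increases to a supremum, and [segment_nrm2] for B - A bounds |B v - A
    v|^2 by <B v, v> - <A v, v>; hence the vectors A v converge. S is their strong limit, so it
    commutes with every bounded operator that commutes with the whole chain. *)
Lemma chain_sup (D : set (H -> H)) : total_on D ole -> D !=set0 ->
  D `<=` segment id ->
  exists S, [/\ segment id S, forall A, D A -> ole A S,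
    forall v c, (forall A, D A -> rdot (A v) v <= c) -> rdot (S v) v <= c,
    forall v e, 0 < e -> exists2 A, D A &
      forall B, D B -> ole A B -> nrm (B v - S v) <= e &
    forall C, bmap dot dot C -> (forall A, D A -> A \o C = C \o A) ->
      S \o C = C \o S].
Proof.
move=> Dtot [A0 DA0] D01.
have maxD A B : D A -> D B -> exists C, [/\ D C, ole A C & ole B C].
  move=> DA DB; have [AB|BA] := Dtot _ _ DA DB.
    by exists B; split.
  by exists A; split.
have dist A B v : D A -> D B -> ole A B ->
    rdot (B v - A v) (B v - A v) <= rdot (B v) v - rdot (A v) v.
  move=> DA DB AB; rewrite -rdotBl.
  exact: (segment_nrm2 v (segment_sub (D01 _ DA) (D01 _ DB) AB)).
pose cvgD v l := forall e, 0 < e -> exists2 A, D A &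
  forall B, D B -> ole A B -> nrm (B v - l) <= e.
have ex v : exists l, cvgD v l.
  pose E := [set rdot (A v) v | A in D].
  have supE : has_sup E.
    split; first by exists (rdot (A0 v) v), A0.
    exists (rdot v v) => _ [A DA <-].
    by case: (D01 _ DA) => _ _; exact.
  have [q qub qn] : exists2 q, forall A, D A -> rdot (A v) v <= q &
      forall n, exists A, D A /\ q < rdot (A v) v + n.+1%:R^-1.
    exists (sup E) => [A DA|n].
      by apply: sup_upper_bound => //; exists A.
    have n0 : 0 < n.+1%:R^-1 :> R by rewrite invr_gt0.
    have [_ [A DA <-] h] := sup_adherent n0 supE.
    by exists A; split=> //; rewrite -ltrBlDr.
  have [A hA] := choice qn.
  have DA n : D (A n) by case: (hA n).
  have Aq n : q < rdot (A n v) v + n.+1%:R^-1 by case: (hA n).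
  have step n B : D B -> ole (A n) B ->
      rdot (B v - A n v) (B v - A n v) < n.+1%:R^-1.
    move=> DB AB; have := dist _ _ v (DA n) DB AB.
    by have := Aq n; have := qub _ DB; move: (n.+1%:R^-1) => w; lra.
  have [e e0|l lim] := cauchy_has_limit (dot := dot) H_complete (u := fun n => A n v).
    have e2 : 0 < e ^+ 2 by rewrite exprn_gt0.
    have [N HN] := invSn_lt e2; exists N => i j Ni Nj.
    rewrite -(@ltr_pXn2r _ 2)// ?nnegrE ?nrm_ge0// ?ltW// nrm2E.
    have [AB|BA] := Dtot _ _ (DA i) (DA j).
      rewrite -nrm2E nrmBC nrm2E.
      exact: lt_trans (step _ _ (DA j) AB) (HN _ Ni).
    exact: lt_trans (step _ _ (DA i) BA) (HN _ Nj).
  exists l => e e0; have e2 : 0 < e / 2 by rewrite divr_gt0.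
  have [N HN] := lim _ e2.
  have [N' HN'] := invSn_lt (exprn_gt0 2 e2).
  exists (A (maxn N N')); first exact: DA.
  move=> B DB AB; rewrite (le_trans (nrmBD _ _ (A (maxn N N') v) _))//.
  rewrite (splitr e) lerD//; last by rewrite ltW// HN// leq_maxl.
  rewrite -(@ler_pXn2r _ 2)// ?nnegrE ?nrm_ge0// ?ltW// nrm2E.
  exact: lt_trans (step _ _ DB AB) (HN' _ (leq_maxr _ _)).
have uniq v l l' : cvgD v l -> cvgD v l' -> l = l'.
  move=> h h'; apply/eqP; rewrite -subr_eq0; apply/eqP/(@nrm_eq0 _ _ dot).
  apply/eqP; rewrite eq_le nrm_ge0 andbT; apply: ler_epsP => e e0.
  have e2 : 0 < e / 2 by rewrite divr_gt0.
  have [A DA hA] := h _ e2; have [A' DA' hA'] := h' _ e2.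
  have [B [DB AB AB']] := maxD _ _ DA DA'.
  rewrite add0r (le_trans (nrmBD _ _ (B v) _))// (splitr e) lerD//.
    by rewrite nrmBC hA.
  exact: hA'.
have [S hS] := choice ex.
have linS : linear S.
  move=> a v w; apply: uniq (hS _) _ => e e0.
  have a0 : 0 < normc a + 1 by rewrite ltr_wpDl// normc_ge0.
  have e1 : 0 < e / 2 / (normc a + 1) by rewrite !divr_gt0.
  have e2 : 0 < e / 2 by rewrite divr_gt0.
  have [A DA hA] := hS v _ e1; have [A' DA' hA'] := hS w _ e2.
  have [B [DB AB AB']] := maxD _ _ DA DA'.
  exists B => // C DC BC; have [[lC _] _ _] := D01 _ DC.
  rewrite lC opprD addrACA -scalerBr (le_trans (nrmD _ _ _))// (splitr e).
  rewrite lerD//; last by apply: hA' => //; exact: ole_trans BC.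
  rewrite nrmZC (le_trans (y := normc a * (e / 2 / (normc a + 1))))//.
    rewrite ler_wpM2l ?normc_ge0// hA//; exact: ole_trans BC.
  rewrite mulrCA -[leRHS]mulr1 ler_wpM2l ?ltW// ltr_pdivrMr// mul1r.
  by rewrite ltrDl.
have near v e : 0 < e -> forall A, D A -> exists B, [/\ D B, ole A B &
    `|rdot (B v) v - rdot (S v) v| <= e].
  move=> e0 A DA.
  have c0 : 0 < nrm v + 1 by rewrite ltr_wpDl// nrm_ge0.
  have [A' DA' hA'] := hS v _ (divr_gt0 e0 c0).
  have [B [DB AB AB']] := maxD _ _ DA DA'; exists B; split=> //.
  rewrite -rdotBl (le_trans (rdot_CS _ _ _))//.
  rewrite (le_trans (y := e / (nrm v + 1) * nrm v))//.
    by rewrite ler_wpM2r ?nrm_ge0// hA'.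
  by rewrite mulrAC -mulrA ler_piMr ?ltW// ltr_pdivrMr// mul1r ltrDl.
have ubS A : D A -> ole A S.
  move=> DA v; apply: ler_epsP => e e0; have [B [DB AB h]] := near v e e0 A DA.
  by rewrite (le_trans (AB v))// -lerBlDl (le_trans (ler_norm _)).
have lubS v c : (forall A, D A -> rdot (A v) v <= c) -> rdot (S v) v <= c.
  move=> h; apply: ler_epsP => e e0; have [B [DB _ h']] := near v e e0 A0 DA0.
  have := ler_norm (- (rdot (B v) v - rdot (S v) v)); rewrite normrN.
  by have := h _ DB; lra.
have approx v w e : 0 < e ->
    exists B, [/\ D B, nrm (B v - S v) <= e & nrm (B w - S w) <= e].
  move=> e0; have [A DA hA] := hS v _ e0; have [A' DA' hA'] := hS w _ e0.
  have [B [DB AB AB']] := maxD _ _ DA DA'.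
  by exists B; split=> //; [exact: hA|exact: hA'].
have symS v w : rdot (S v) w <= rdot v (S w).
  apply: ler_epsP => e e0.
  have c0 : 0 < nrm v + nrm w + 1 by rewrite ltr_wpDl// addr_ge0// nrm_ge0.
  have [B [DB h1 h2]] := approx v w _ (divr_gt0 e0 c0).
  have [sB _ _] := D01 _ DB.
  have E := selfadj_rdotC v w sB.
  have h3 := rdot_le dot (S v - B v) w; have h4 := rdot_le dot v (B w - S w).
  rewrite nrmBC rdotBl in h3; rewrite rdotBr in h4.
  have h5 : nrm (B v - S v) * nrm w + nrm v * nrm (B w - S w) <= e.
    apply: (@le_trans _ _ (e / (nrm v + nrm w + 1) * (nrm v + nrm w))).
      rewrite mulrDr addrC lerD//; first by rewrite mulrC ler_wpM2r ?nrm_ge0.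
      by rewrite ler_wpM2r ?nrm_ge0.
    by rewrite mulrAC -mulrA ler_piMr ?ltW// ltr_pdivrMr// mul1r ltrDl.
  lra.
have symS' v w : rdot (S v) w = rdot v (S w).
  apply/eqP; rewrite eq_le symS/=.
  by rewrite [leLHS]rdotC [leRHS]rdotC symS.
have sS : selfadj S.
  split=> // v w; apply: dot_Re_eq; first exact: symS'.
  by rewrite -(linZ linS) symS'.
exists S; split=> //.
  split=> // v; first by rewrite rdotC rdot0r (le_trans _ (ubS _ DA0 v))//;
    case: (D01 _ DA0) => _ /(_ v); rewrite rdotC rdot0r.
  by apply: lubS => A DA; case: (D01 _ DA) => _ _; exact.
move=> C [lC [c c0 Cc]] comC; apply/funext => v /=; apply: uniq (hS _) _ => e e0.
have c1 : 0 < c + 1 by rewrite ltr_wpDl.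
have [A DA hA] := hS v _ (divr_gt0 e0 c1).
exists A => // B DB AB.
have -> : B (C v) = C (B v) by have := comC _ DB => /(congr1 (fun f => f v)).
rewrite -(linB lC) (le_trans (Cc _))//.
apply: (@le_trans _ _ (c * (e / (c + 1)))); first by rewrite ler_wpM2l// hA.
by rewrite mulrCA ler_piMr ?ltW// ltr_pdivrMr// mul1r ltrDl.
Qed.
End completeness.
End positive_operators.

(** * Products of commuting positive operators and square roots of positive contractions *)

Section square_roots.
Context {R : realType} {H : lmodType R[i]} (dot : {dot H for Num.conj}).
Implicit Types (A B x y : H -> H).
Local Notation nrm := (nrm dot).
Local Notation rdot := (rdot dot).
Local Notation ole := (ole dot).
Local Notation selfadj := (selfadj dot).
Local Notation segment := (segment dot).

Lemma ole0E A : ole 0 A <-> forall v, 0 <= rdot (A v) v.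
Proof.
split=> A0 v; first by have := A0 v; rewrite [leLHS]rdotC rdot0r.
by rewrite [leLHS]rdotC rdot0r.
Qed.

Lemma fun_comp_eq A B v : A \o B = B \o A -> A (B v) = B (A v).
Proof. by move/(congr1 (fun f => f v)). Qed.

(* The iteration x_{k+1} = x_k - x_k^2, for which x = sum_{i<k} x_i^2 + x_k. *)
Fixpoint square_remainder x k :=
  if k is k'.+1 then square_remainder x k' -
    (square_remainder x k' \o square_remainder x k') else x.

Lemma square_remainder_segment x k :
  segment id x -> segment id (square_remainder x k).
Proof.
move=> xs; elim: k => [//|k IH] /=; set z := square_remainder x k in IH *.
have [sz z0 z1] := IH; split.
- by apply: selfadjB => //; exact: selfadj_square.
- apply/ole0E => v; rewrite rdotBl subr_ge0 /=.
  by rewrite (selfadj_rdotC (z v) _ sz) segment_nrm2.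
- move=> v; rewrite rdotBl /= (selfadj_rdotC (z v) _ sz).
  by rewrite lerBlDr (le_trans (z1 v))// lerDl rdot_ge0.
Qed.

Lemma square_remainder_comm x k C : linear C -> x \o C = C \o x ->
  square_remainder x k \o C = C \o square_remainder x k.
Proof.
move=> lC xC; elim: k => [//|k IH] /=; set z := square_remainder x k in IH *.
apply/funext => v; rewrite /= !fctE /= (linB lC).
by rewrite !(fun_comp_eq _ IH).
Qed.

Lemma square_remainder_sum x n v : segment id x ->
  rdot (x v) v = \sum_(k < n) rdot (square_remainder x k v)
    (square_remainder x k v) + rdot (square_remainder x n v) v.
Proof.
move=> xs; elim: n => [|n IH]; first by rewrite big_ord0 add0r.
rewrite big_ord_recr/= -addrA IH; congr (_ + _).
rewrite rdotBl /=.
have [sz _ _] := square_remainder_segment n xs.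
by rewrite (selfadj_rdotC (square_remainder x n v) _ sz) addrC subrK.
Qed.

(** The squares |x_k v|^2 add up to at most <x v, v>, so they cannot all stay above e^2. *)
Lemma square_remainder_small x v e : segment id x -> 0 < e ->
  exists n, nrm (square_remainder x n v) < e.
Proof.
move=> xs e0; apply: contrapT => /forallNP h.
have e2 : 0 < e ^+ 2 by rewrite exprn_gt0.
pose n := Num.bound (rdot (x v) v / e ^+ 2).
have [_ z0 _] := square_remainder_segment n xs.
have := square_remainder_sum n v xs; apply/eqP; rewrite lt_eqF//.
have -> : rdot (x v) v = rdot (x v) v / e ^+ 2 * e ^+ 2 by rewrite divfK// gt_eqF.
have h1 : rdot (x v) v / e ^+ 2 * e ^+ 2 < n%:R * e ^+ 2.
  rewrite ltr_pM2r// archi_boundP// divr_ge0 ?sqr_ge0//.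
  by case: xs => _ /ole0E.
apply: (lt_le_trans h1); rewrite -[leLHS]addr0 lerD//; last by move/ole0E: z0.
rewrite mulr_natl -[n in leLHS]card_ord -sumr_const ler_sum// => i _.
rewrite -nrm2E ler_pXn2r// ?nnegrE ?nrm_ge0 ?(ltW e0)//.
by rewrite leNgt; apply/negP/h.
Qed.

(** Proved without square roots, whose construction depends on it: after substituting x = sum x_k^2
    + x_n, each square contributes <y x_k v, x_k v> >= 0, and the remainder can be made small at
    v. *)
Lemma ole0_comp x y : segment id x -> selfadj y -> ole 0 y ->
  x \o y = y \o x -> ole 0 (y \o x).
Proof.
move=> xs [ly ay] /ole0E y0 xy; apply/ole0E => v /=.
pose z k := square_remainder x k.
have zy k := square_remainder_comm k ly xy.
have zs k := square_remainder_segment k xs.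
have E n : rdot (y (x v)) v = \sum_(k < n) rdot (y (z k v)) (z k v) +
    rdot (y (z n v)) v.
  elim: n => [|n IH]; first by rewrite big_ord0 add0r.
  rewrite big_ord_recr/= -addrA IH; congr (_ + _).
  rewrite /z /= !fctE /= (linB ly) rdotBl.
  have [sz _ _] := zs n.
  rewrite -[y (square_remainder x n (square_remainder x n v))](fun_comp_eq _ (zy n)).
  by rewrite (selfadj_rdotC (y _) _ sz) addrC subrK.
rewrite -[leRHS]addr0; apply: ler_epsP => e e0.
have c0 : 0 < nrm (y v) + 1 by rewrite ltr_wpDl// nrm_ge0.
have [n hn] := square_remainder_small v xs (divr_gt0 e0 c0).
have h1 : 0 <= \sum_(k < n) rdot (y (z k v)) (z k v) by apply: sumr_ge0.
have h2 : `|rdot (y (z n v)) v| <= e.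
  have -> : rdot (y (z n v)) v = rdot (z n v) (y v).
    by rewrite /(rdot _ _) ay.
  rewrite (le_trans (rdot_CS _ _ _))//.
  apply: (@le_trans _ _ (e / (nrm (y v) + 1) * nrm (y v))).
    by rewrite ler_wpM2r ?nrm_ge0// ltW.
  by rewrite mulrAC -mulrA ler_piMr ?ltW// ltr_pdivrMr// mul1r ltrDl.
rewrite addr0 (E n); move: h1 h2; rewrite ler_norml => h1 /andP[h2 _].
lra.
Qed.

Section completeness.
Hypothesis H_complete : hilbert_complete dot.

(* Iterates converging to 1 - sqrt x. *)
Fixpoint sqrt_iter x k := if k is k'.+1 then
  (2^-1)%:C%C *: (id - x + (sqrt_iter x k' \o sqrt_iter x k')) else 0.

Lemma sqrt_iterS x k v : sqrt_iter x k.+1 v =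
  (2^-1)%:C%C *: (v - x v + sqrt_iter x k (sqrt_iter x k v)).
Proof. by []. Qed.

Lemma sqrt_iter_segment x k : segment id x -> segment id (sqrt_iter x k).
Proof.
move=> [sx x0 x1]; elim: k => [|k IH] /=.
  split; [exact: selfadj0|exact: ole_refl|].
  by apply/ole0E => v; exact: rdot_ge0.
set z := sqrt_iter x k in IH *; have [sz z0 z1] := IH.
have E v : rdot (((2^-1)%:C%C *: (id - x + (z \o z))) v) v =
    2^-1 * (rdot v v - rdot (x v) v + rdot (z v) (z v)).
  rewrite rdotZl rdotDl rdotBl /=.
  by rewrite (selfadj_rdotC (z v) _ sz).
split.
- by apply/selfadjZ/selfadjD; [exact: selfadjB|exact: selfadj_square].
- apply/ole0E => v; rewrite E mulr_ge0// addr_ge0 ?rdot_ge0// subr_ge0.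
  exact: x1.
- move=> v; rewrite E; have := segment_nrm2 v IH; have := z1 v.
  by have /ole0E/(_ v) := x0; lra.
Qed.

Lemma sqrt_iter_comm x k C : linear C -> x \o C = C \o x ->
  sqrt_iter x k \o C = C \o sqrt_iter x k.
Proof.
move=> lC xC; elim: k => [|k IH] /=.
  by apply/funext => v; rewrite /= (lin0 lC).
apply/funext => v; rewrite /= !fctE /= (linZ lC) (linD lC) (linB lC).
by rewrite !(fun_comp_eq _ IH) (fun_comp_eq _ xC).
Qed.

(** For consecutive iterates z and w the next increment is half of w^2 - z^2 = (w + z) (w - z), a
    product of commuting positive operators. *)
Lemma sqrt_iter_mono x k : segment id x ->
  ole (sqrt_iter x k) (sqrt_iter x k.+1).
Proof.
move=> xs; have zs := @sqrt_iter_segment x ^~ xs.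
elim: k => [|k IH]; first by case: (zs 1).
set z := sqrt_iter x k in IH *; set w := sqrt_iter x k.+1 in IH *.
have [sz z0 z1] : segment id z by exact: zs.
have [sw w0 w1] : segment id w by exact: zs.
have [lz _] := sz; have [lw _] := sw.
have zw : w \o z = z \o w.
  apply: sqrt_iter_comm => //; apply/esym/sqrt_iter_comm => //.
  by case: xs => -[].
have h : ole 0 ((w + z) \o (w - z)).
  apply: ole0_comp.
  - by apply: segment_sub.
  - exact: selfadjD.
  - by apply/ole0E => v; rewrite rdotDl addr_ge0//; [move/ole0E: w0|move/ole0E: z0].
  - apply/funext => v; rewrite /= !fctE !(linD lw) !(linD lz) !(linN lw) !(linN lz).
    by rewrite (fun_comp_eq _ zw) opprD addrACA.
have {}h v : rdot (z (z v)) v <= rdot (w (w v)) v.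
  move/ole0E: h => /(_ v) /=; have wzE u : (w + z) u = w u + z u by [].
  rewrite wzE (linB lw) (linB lz) (fun_comp_eq _ zw).
  by rewrite addrA subrK rdotBl subr_ge0.
move=> v; have := h v.
have -> : rdot (w v) v = 2^-1 * (rdot (v - x v) v + rdot (z (z v)) v).
  by rewrite /w sqrt_iterS -/z rdotZl [rdot (_ + z _) v]rdotDl.
move=> h0; rewrite sqrt_iterS -/w rdotZl [in leRHS]rdotDl.
lra.
Qed.

Lemma sqrt_iter_le x i j : segment id x -> (i <= j)%N ->
  ole (sqrt_iter x i) (sqrt_iter x j).
Proof.
move=> xs; elim: j => [|j IH]; first by rewrite leqn0 => /eqP ->.
rewrite leq_eqVlt => /predU1P[->//|]; rewrite ltnS => /IH h.
exact: ole_trans h (sqrt_iter_mono _ xs).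
Qed.

Lemma segment_sqrt x : segment id x ->
  exists c, [/\ segment id c, forall v, c (c v) = x v &
    forall C, bmap dot dot C -> x \o C = C \o x -> c \o C = C \o c].
Proof.
move=> xs; have zs := @sqrt_iter_segment x ^~ xs.
pose D := range (sqrt_iter x).
have [|||S [Ss ubS lubS limS comS]] := chain_sup H_complete (D := D).
- move=> _ _ [i _ <-] [j _ <-].
  by case/orP: (leq_total i j) => ij; [left|right]; exact: sqrt_iter_le.
- by exists (sqrt_iter x 0), 0%N.
- by move=> _ [i _ <-]; exact: zs.
have [sS S0 S1] := Ss; have [lS _] := sS.
have lim v e : 0 < e -> exists N, forall n, (N <= n)%N ->
    nrm (sqrt_iter x n v - S v) <= e.
  move=> e0; have [_ [N _ <-] h] := limS v e e0.
  by exists N => n Nn; apply: h; [exists n|exact: sqrt_iter_le].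
(* The fixed point equation S = (1 - x + S^2) / 2 says that (1 - S)^2 = x. *)
have SE v : S v = (2^-1)%:C%C *: (v - x v + S (S v)).
  apply/eqP; rewrite -subr_eq0; apply/eqP/(@nrm_eq0 _ _ dot)/eqP.
  rewrite eq_le nrm_ge0 andbT; apply: ler_epsP => e e0; rewrite add0r.
  have e2 : 0 < e / 2 by rewrite divr_gt0.
  have [N1 h1] := lim v _ e2; have [N2 h2] := lim (S v) _ e2.
  pose n := maxn N1 N2.
  have h1' := h1 n (leq_maxl _ _); have h1'' := h1 n.+1 (leqW (leq_maxl _ _)).
  have h2' := h2 n (leq_maxr _ _).
  rewrite (le_trans (nrmBD _ _ (sqrt_iter x n.+1 v) _))// (splitr e).
  rewrite lerD//; first by rewrite nrmBC.
  rewrite /= !fctE -scalerBr nrmZ ger0_norm// opprD addrACA subrr add0r.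
  set z := sqrt_iter x n in h1' h2' *.
  have [[lz _] _ _] := zs n; rewrite -/z in lz.
  have h3 := nrmBD dot (z (z v)) (z (S v)) (S (S v)).
  have h4 : nrm (z (z v) - z (S v)) <= e / 2.
    by rewrite -(linB lz) (le_trans (segment_nrm _ (zs n))).
  lra.
have s1 : segment id (id : H -> H).
  split; [exact: selfadj_id| |exact: ole_refl].
  by apply/ole0E => v; exact: rdot_ge0.
exists (id - S); split.
- exact: segment_sub.
- move=> v; rewrite !fctE (linB lS).
  have := SE v; set w := S v; set u := S w => wE.
  have E : w + w = v - x v + u.
    rewrite wE -scalerDl -rmorphD/= (_ : 2^-1 + 2^-1 = 1 :> R) ?rmorph1 ?scale1r//.
    by rewrite -[RHS](@divff _ 2)// mulrDl mul1r.
  by rewrite opprB addrACA -opprD E opprD addrA addrAC addrK subKr.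
- move=> C bC xC; have [lC _] := bC; apply/funext => v.
  rewrite /= !fctE (linB lC); congr (_ - _).
  apply: (fun_comp_eq v (comS _ bC _)) => _ [i _ <-].
  exact: sqrt_iter_comm.
Qed.

End completeness.
End square_roots.

(** * Von Neumann algebras and domination of normal functionals *)

Section von_Neumann_algebras.
Context {R : realType} {H : lmodType R[i]} (dot : {dot H for Num.conj}).
Implicit Types (A B x y : H -> H) (M : set (H -> H)).
Local Notation nrm := (nrm dot).
Local Notation rdot := (rdot dot).
Local Notation ole := (ole dot).
Local Notation selfadj := (selfadj dot).
Local Notation segment := (segment dot).

(** The commutant of a self-adjoint set of bounded operators. Membership of suprema and square roots
    then reduces to commutation. *)
Definition vN_algebra M := exists2 C, M = commutant dot C &
  forall A, C A -> bmap dot dot A /\ exists2 B, C B & adjoint dot A B.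

Lemma segment0 : segment id 0.
Proof.
split; [exact: selfadj0|exact: ole_refl|].
by apply/ole0E => v; exact: rdot_ge0.
Qed.

Lemma segment_id : segment id id.
Proof.
split; [exact: selfadj_id| |exact: ole_refl].
by apply/ole0E => v; exact: rdot_ge0.
Qed.

Lemma adjoint_comp A A' B B' : adjoint dot A A' -> adjoint dot B B' ->
  adjoint dot (A \o B) (B' \o A').
Proof. by move=> hA hB v w /=; rewrite hA hB. Qed.

Lemma selfadj_gram A A' : linear A -> linear A' -> adjoint dot A A' ->
  selfadj (A' \o A).
Proof. by move=> lA lA' AA'; exact: (@selfadj_sandwich _ _ dot id). Qed.

Lemma rdot_gram A A' v : adjoint dot A A' ->
  rdot (A' (A v)) v = rdot (A v) (A v).
Proof. by move=> /adj_sym h; rewrite /(rdot _ _) h. Qed.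

Lemma bicommutant_vN_algebra (X : set (H -> H)) : hilbert_complete dot ->
  (forall A, X A -> linear A /\ exists2 B, X B & adjoint dot A B) ->
  vN_algebra (bicommutant dot X).
Proof.
move=> Hc X_adj; exists (commutant dot X) => // A [bA comA].
have bA' : bmap dot dot A by apply/bounded_opE.
split=> //; have [B bB AB] := bmap_adj Hc bA'.
exists B => //; split; first by apply/bounded_opE.
move=> C XC; have [lC [D XD CD]] := X_adj _ XC.
apply/funext => v; apply: (@dotr_inj _ _ dot) => w /=.
have CD' := adj_sym CD; rewrite -AB -CD' -CD' -AB.
by have /(congr1 (fun f => f w))/= := comA _ XD => ->.
Qed.

Section algebra.
Hypothesis H_complete : hilbert_complete dot.
Variable M : set (H -> H).
Hypothesis vM : vN_algebra M.

Lemma vN_bmap A : M A -> bmap dot dot A.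
Proof. by case: vM => C -> _ [] /bounded_opE. Qed.

Lemma vN_linear A : M A -> linear A.
Proof. by case/vN_bmap. Qed.

Lemma vN_id : M id.
Proof.
by case: vM => C -> _; split=> //; apply/bounded_opE; exact: bmap_id.
Qed.

Lemma vN_lin (c : R[i]) A B : M A -> M B -> M (c *: A + B).
Proof.
case: vM => C -> hC [/bounded_opE bA cA] [/bounded_opE bB cB]; split.
  by apply/bounded_opE/bmap_lin.
move=> D CD; have [[lD _] _] := hC _ CD.
apply/funext => v; rewrite /= !fctE lD.
by rewrite (fun_comp_eq v (cA _ CD)) (fun_comp_eq v (cB _ CD)).
Qed.

Lemma vN_comp A B : M A -> M B -> M (A \o B).
Proof.
case: vM => C -> hC [/bounded_opE bA cA] [/bounded_opE bB cB]; split.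
  by apply/bounded_opE/(bmap_comp bA bB).
move=> D CD; apply/funext => v /=.
by rewrite (fun_comp_eq v (cB _ CD)) (fun_comp_eq (B v) (cA _ CD)).
Qed.

Lemma vN0 : M 0.
Proof. by have := vN_lin (-1) vN_id vN_id; rewrite scaleN1r addNr. Qed.

Lemma vNZ (c : R[i]) A : M A -> M (c *: A).
Proof. by move=> MA; have := vN_lin c MA vN0; rewrite addr0. Qed.

Lemma vND A B : M A -> M B -> M (A + B).
Proof. by move=> MA MB; have := vN_lin 1 MA MB; rewrite scale1r. Qed.

Lemma vNB A B : M A -> M B -> M (A - B).
Proof.
by move=> MA MB; have := vN_lin (-1) MB MA; rewrite scaleN1r addrC.
Qed.

Lemma vN_adj A : M A -> exists2 B, M B & adjoint dot A B.
Proof.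
move=> MA; have [B bB AB] := bmap_adj H_complete (vN_bmap MA).
exists B => //; case: vM MA => C -> hC [_ cA]; split; first exact/bounded_opE.
move=> D CD; have [[lD _] [E CE DE]] := hC _ CD.
apply/funext => v; apply: (@dotr_inj _ _ dot) => w /=.
have DE' := adj_sym DE; rewrite -AB -DE' -DE' -AB.
by rewrite (fun_comp_eq w (cA _ CE)).
Qed.

(** The last clause asks for the supremum of the quadratic forms at each vector. This implies that S
    is the least upper bound, and it makes vector functionals normal at once. *)
Definition is_chain_sup (D : set (H -> H)) S :=
  [/\ total_on D ole, D !=set0, D `<=` M `&` segment id & M S] /\
  [/\ segment id S, forall A, D A -> ole A S &
      forall v c, (forall A, D A -> rdot (A v) v <= c) -> rdot (S v) v <= c].

Lemma vN_chain_sup (D : set (H -> H)) :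
  total_on D ole -> D !=set0 -> D `<=` M `&` segment id ->
  exists S, is_chain_sup D S.
Proof.
move=> Dtot D0 DM.
have [|S [Ss ubS lubS _ comS]] := chain_sup H_complete Dtot D0.
  by move=> A /DM[].
exists S; split; split=> //.
have MD A : D A -> M A by case/DM.
case: vM MD => C -> hC MD; split.
  by apply/bounded_opE; exact: segment_bmap.
move=> E CE; have [bE _] := hC _ CE; apply: comS => // A DA.
by case: (MD _ DA) => _; exact.
Qed.

Lemma vN_sqrt x : M x -> segment id x ->
  exists c, [/\ M c, segment id c & x = c \o c].
Proof.
move=> Mx xs; have [c [cs ccx comc]] := segment_sqrt H_complete xs.
exists c; split=> //; last by apply/funext => v; rewrite /= ccx.
case: vM Mx => C -> hC [_ cx]; split.
  by apply/bounded_opE; exact: segment_bmap.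
by move=> E CE; have [bE _] := hC _ CE; apply: comc => //; exact: cx.
Qed.

Lemma vN_Zorn (F : set (H -> H)) : F !=set0 -> F `<=` M `&` segment id ->
  (forall D S, D `<=` F -> is_chain_sup D S -> F S) ->
  exists2 x, F x & forall y, F y -> ole x y -> y = x.
Proof.
move=> [x0 Fx0] FM Fsup.
pose T := {x | F x}; pose le (s t : T) := `[< ole (sval s) (sval t) >].
have [||| |[x Fx] max] := @Zorn T le.
- by move=> s; apply/asboolP; exact: ole_refl.
- by move=> r s t /asboolP rs /asboolP st; apply/asboolP/(ole_trans rs st).
- move=> [s Fs] [t Ft] /asboolP/= st /asboolP/= ts.
  have [[_ [ss _ _]] [_ [st' _ _]]] := (FM _ Fs, FM _ Ft).
  have E := ole_anti ss st' st ts; rewrite E in Fs *.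
  by congr exist; exact: Prop_irrelevance.
- move=> A Atot; have [A0|/set0P[a Aa]] := eqVneq A set0.
    by exists (exist _ x0 Fx0) => s; rewrite A0.
  pose D := sval @` A.
  have DF : D `<=` F by move=> _ [[s Fs] _ <-].
  have [|||S hS] := @vN_chain_sup D.
  + move=> _ _ [s As <-] [t At <-].
    by have [/asboolP h|/asboolP h] := Atot _ _ As At; [left|right].
  + by exists (sval a), a.
  + by move=> d /DF/FM.
  have FS := Fsup _ _ DF hS; exists (exist _ S FS) => s As.
  by apply/asboolP; case: hS => _ [_ h _]; apply: h; exists s.
exists x => // y Fy xy.
have le_xy : le (exist _ x Fx) (exist _ y Fy) by apply/asboolP.
by have /(congr1 sval) := max _ le_xy.
Qed.

Definition positive_functional (w : (H -> H) -> R) :=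
  [/\ forall A B, M A -> M B -> w (A + B) = w A + w B,
      forall (t : R) A, M A -> w (t%:C%C *: A) = t * w A &
      forall A B, M A -> M B -> adjoint dot A B -> 0 <= w (B \o A)].

(** Normality along chains is what an application of Zorn's lemma consumes. *)
Definition chain_normal (w : (H -> H) -> R) := forall D S, is_chain_sup D S ->
  forall c, (forall A, D A -> w A <= c) -> w S <= c.

Section functional.
Variable w : (H -> H) -> R.
Hypothesis wpos : positive_functional w.

Lemma posfunD A B : M A -> M B -> w (A + B) = w A + w B.
Proof. by move=> MA MB; case: wpos => + _ _; apply. Qed.
Lemma posfunZ (t : R) A : M A -> w (t%:C%C *: A) = t * w A.
Proof. by move=> MA; case: wpos => _ + _; apply. Qed.
Lemma posfunN A : M A -> w (- A) = - w A.
Proof. by move=> MA; have := posfunZ (-1) MA; rewrite rmorphN1 scaleN1r mulN1r. Qed.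
Lemma posfunB A B : M A -> M B -> w (A - B) = w A - w B.
Proof.
move=> MA MB; rewrite posfunD ?posfunN//.
by rewrite -scaleN1r; exact: vNZ.
Qed.
Lemma posfun0 : w 0 = 0.
Proof. by have := posfunZ 0 vN0; rewrite mul0r scaler0. Qed.

Lemma selfadj_scale_segment x : M x -> selfadj x -> ole 0 x ->
  exists2 t : R, 0 < t & segment id (t%:C%C *: x).
Proof.
move=> Mx sx /ole0E x0; have [_ [c c0 xc]] := vN_bmap Mx.
have c1 : 0 < c + 1 by rewrite ltr_wpDl.
exists (c + 1)^-1; first by rewrite invr_gt0.
split; first exact: selfadjZ.
  by apply/ole0E => v; rewrite rdotZl mulr_ge0// invr_ge0 ltW.
move=> v; rewrite rdotZl mulrC ler_pdivrMr//.
rewrite (le_trans (rdot_le _ _ _))// -nrm2E.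
rewrite (le_trans (ler_wpM2r (nrm_ge0 _ _) (xc v)))//.
rewrite -mulrA -expr2 mulrC ler_wpM2l ?sqr_ge0//.
by rewrite lerDl.
Qed.

(** [positive_functional] speaks only of products of an operator with its adjoint; a square root
    brings a positive operator into this form. *)
Lemma posfun_ge0 x : M x -> selfadj x -> ole 0 x -> 0 <= w x.
Proof.
move=> Mx sx x0; have [t t0 ts] := selfadj_scale_segment Mx sx x0.
have [c [Mc [[_ ac] _ _] E]] := vN_sqrt (vNZ _ Mx) ts.
have : 0 <= w (t%:C%C *: x) by rewrite E; case: wpos => _ _; exact.
by rewrite posfunZ// pmulr_rge0.
Qed.

Lemma posfun_le x y : M x -> M y -> selfadj x -> selfadj y -> ole x y ->
  w x <= w y.
Proof.
move=> Mx My sx sy xy; rewrite -subr_ge0 -posfunB//.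
apply: posfun_ge0; [exact: vNB|exact: selfadjB|].
by apply/ole0E => v; rewrite rdotBl subr_ge0.
Qed.

End functional.
End algebra.
End von_Neumann_algebras.

(** * Domination of a normal functional by a faithful normal trace *)

Section noncommutative_radon_nikodym.
Context {R : realType} {H : lmodType R[i]} (dot : {dot H for Num.conj}).
Hypothesis H_complete : hilbert_complete dot.
Variable M : set (H -> H).
Hypothesis vM : vN_algebra dot M.
Implicit Types (A B x y b r : H -> H).
Local Notation nrm := (nrm dot).
Local Notation rdot := (rdot dot).
Local Notation ole := (ole dot).
Local Notation selfadj := (selfadj dot).
Local Notation segment := (segment dot).
Variables t w : (H -> H) -> R.
Hypotheses (tpos : positive_functional dot M t)
  (tnormal : chain_normal dot M t)
  (ttrace : forall A B, M A -> M B -> adjoint dot A B -> t (B \o A) = t (A \o B))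
  (tfaithful : forall A B, M A -> M B -> adjoint dot A B -> t (B \o A) = 0 -> A = 0).
Hypotheses (wpos : positive_functional dot M w)
  (wnormal : chain_normal dot M w).

(** The compression w(y . y) lies below C t: a Radon-Nikodym bound that involves no density. *)
Definition dominated_by (C : R) y := forall A B, M A -> M B ->
  adjoint dot A B -> w (y \o (B \o (A \o y))) <= C * t (B \o A).

Let w0 := posfun_ge0 H_complete vM wpos.
Let t0 := posfun_ge0 H_complete vM tpos.
Let wD := posfunD wpos.
Let tD := posfunD tpos.
Let wZ := posfunZ wpos.
Let tZ := posfunZ tpos.
Let wle := posfun_le H_complete vM wpos.
Let tle := posfun_le H_complete vM tpos.

Lemma trace_gt0 r : M r -> segment id r -> r <> 0 -> 0 < t r.
Proof.
move=> Mr rs r0; have [c [Mc [[lc ac] _ _] rE]] := vN_sqrt H_complete vM Mr rs.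
have [sr r0' _] := rs.
rewrite lt_def t0// andbT; apply/eqP => tr; apply: r0.
have -> : r = c \o c by [].
have -> : c = 0 by apply: (tfaithful Mc Mc ac); rewrite -rE.
by apply/funext.
Qed.

Lemma compress_adjoint y A B : selfadj y -> adjoint dot A B ->
  adjoint dot (A \o y) (y \o B).
Proof. by move=> [_ ay] AB; exact: (adjoint_comp AB ay). Qed.

(** Let x be maximal in the order interval from 0 to r with C t(x) <= w(x), and y = r - x. Below y
    the functional w is at most C t, because an operator violating this could be added to x. *)
Lemma dominated_exists r : M r -> segment id r -> r <> 0 ->
  exists y C, [/\ M y, segment r y, y <> 0, 0 <= C & dominated_by C y].
Proof.
move=> Mr rs r0; have [sr r0' r1] := rs.
have tr := trace_gt0 Mr rs r0.
(* This C satisfies w r < C t r, so x cannot be all of r and y is nonzero. *)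
pose C := (w r + 1) / t r.
have C0 : 0 < C by rewrite divr_gt0// ltr_wpDl// w0.
have Ctr : w r < C * t r by rewrite divfK ?gt_eqF// ltrDl.
pose F := [set x | [/\ M x, segment r x & C * t x <= w x]].
have FM : F `<=` M `&` segment id.
  move=> x [Mx [sx x0 xr] _]; split=> //; split=> //.
  exact: ole_trans xr r1.
have [||x [Mx [sx x0 xr] Cx] xmax] := vN_Zorn H_complete vM (F := F) _ FM.
- exists 0; split; [exact: (vN0 vM)|split; [exact: selfadj0|exact: ole_refl|exact: r0']|].
  by rewrite (posfun0 vM tpos) (posfun0 vM wpos) mulr0.
- move=> D S DF [[Dtot Dn DM MS] [Ss ubS lubS]].
  have [sS S0 S1] := Ss.
  split=> //.
    split=> // v; apply: lubS => A /DF[_ [_ _]]; exact.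
  rewrite mulrC -ler_pdivlMr//; apply: (@tnormal D S) => // A DA.
  have [MA [sA _ _] CA] := DF _ DA.
  rewrite ler_pdivlMr// mulrC (le_trans CA)//.
  by apply: wle => //; exact: ubS.
have sy : selfadj (r - x) by exact: selfadjB.
have My : M (r - x) by exact: (vNB vM).
have y0 : ole 0 (r - x).
  by apply/ole0E => v; rewrite rdotBl subr_ge0.
have yr : ole (r - x) r.
  by move=> v; rewrite rdotBl gerBl; move/ole0E: x0.
have ys : segment id (r - x) by split=> //; exact: ole_trans yr r1.
have dom z : M z -> selfadj z -> ole 0 z -> ole z (r - x) -> w z <= C * t z.
  move=> Mz sz z0 zy; rewrite leNgt; apply/negP => wz.
  have Fxz : F (x + z).
    split; first exact: (vND vM).
      split; first exact: selfadjD.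
        apply/ole0E => v; rewrite rdotDl addr_ge0//.
          by move/ole0E: x0.
        by move/ole0E: z0.
      by move=> v; have := zy v; rewrite rdotBl rdotDl; lra.
    by rewrite tD// wD// mulrDr lerD// ltW.
  have E : z = 0.
    apply: (addrI x); rewrite addr0; apply: xmax => // v.
    by rewrite rdotDl lerDl; move/ole0E: z0.
  by move: wz; rewrite E (posfun0 vM tpos) (posfun0 vM wpos) mulr0 ltxx.
have yn0 : r - x <> 0.
  by move=> /eqP; rewrite subr_eq0 => /eqP E; move: Ctr; rewrite E ltNge Cx.
move: (r - x) sy My y0 yr ys dom yn0 => y sy My y0 yr ys dom yn0.
exists y, C; split=> //; last 2 first.
- exact: ltW.
- move=> A B MA MB AB; have [lA [k k0 Ak]] := vN_bmap vM MA.
  have lB := vN_linear vM MB; have [ly ay] := sy.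
  have k1 : 0 < k + 1 by rewrite ltr_wpDl.
  have ABy := compress_adjoint sy AB.
  have lAy : linear (A \o y) by move=> a u v; rewrite /= ly lA.
  have lyB : linear (y \o B) by move=> a u v; rewrite /= lB ly.
  pose z := (y \o B) \o (A \o y).
  have MAy := vN_comp vM MA My; have MyB := vN_comp vM My MB.
  have Mz : M z := vN_comp vM MyB MAy.
  have sz : selfadj z by exact: selfadj_gram.
  have zE v : rdot (z v) v = nrm (A (y v)) ^+ 2.
    by rewrite nrm2E; exact: (rdot_gram v ABy).
  (* The trace property moves y inside: t(y B A y) = t(A y y B) <= t(A B) = t(B A), since y is a
     contraction. *)
  have tz : t z <= t (B \o A).
    have E1 : t z = t ((A \o y) \o (y \o B)).
      exact: ttrace.
    rewrite E1 (ttrace MA MB AB); apply: tle.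
    + exact: (vN_comp vM).
    + exact: (vN_comp vM).
    + exact: (selfadj_gram lyB lAy (adj_sym ABy)).
    + exact: (selfadj_gram lB lA (adj_sym AB)).
    + move=> v; rewrite (rdot_gram v (adj_sym ABy)) (rdot_gram v (adj_sym AB)).
      by rewrite -!nrm2E ler_pXn2r ?nnegrE ?nrm_ge0// /= segment_nrm.
  apply: (@le_trans _ _ (C * t z)); last by rewrite ler_wpM2l// ltW.
  (* With k a bound for A, y B A y is at most k^2 y^2 <= k^2 y, so after division by (k + 1)^2 it
     lies below y, where the bound [dom] applies. *)
  have k2 : 0 < ((k + 1) ^+ 2)^-1 by rewrite invr_gt0 exprn_gt0.
  have := dom (((k + 1) ^+ 2)^-1%:C%C *: z) (vNZ vM _ Mz) (selfadjZ _ sz).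
  rewrite wZ// tZ// mulrCA ler_pM2l//; apply.
    by apply/ole0E => v; rewrite rdotZl mulr_ge0 ?(ltW k2)// zE sqr_ge0.
  move=> v; rewrite rdotZl zE mulrC ler_pdivrMr ?exprn_gt0//.
  apply: (@le_trans _ _ ((k * nrm (y v)) ^+ 2)).
    by rewrite ler_pXn2r ?nnegrE ?mulr_ge0 ?nrm_ge0.
  rewrite exprMn mulrC nrm2E; apply: ler_pM => //; rewrite ?rdot_ge0 ?sqr_ge0//.
    exact: segment_nrm2.
  by rewrite ler_pXn2r ?nnegrE ?(ltW k1)// lerDl.
Qed.

Lemma compress_sandwich y A B : M y -> selfadj y -> M A -> M B ->
  adjoint dot A B -> [/\ M (y \o (B \o (A \o y))),
    selfadj (y \o (B \o (A \o y))) &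
    forall v, rdot (y (B (A (y v)))) v = rdot (A (y v)) (A (y v))].
Proof.
move=> My sy MA MB AB; have ABy := compress_adjoint sy AB; split.
- exact: (vN_comp vM My (vN_comp vM MB (vN_comp vM MA My))).
- exact: (selfadj_gram (vN_linear vM (vN_comp vM MA My))
    (vN_linear vM (vN_comp vM My MB)) ABy).
- by move=> v; exact: (rdot_gram v ABy).
Qed.

(** The factor 2 comes from |A y v + A z v|^2 <= 2 |A y v|^2 + 2 |A z v|^2. *)
Lemma dominated_add C C' y z : M y -> selfadj y -> M z -> selfadj z ->
  dominated_by C y -> dominated_by C' z -> dominated_by ((C + C') *+ 2) (y + z).
Proof.
move=> My sy Mz sz yC zC A B MA MB AB.
have [M1 s1 E1] := compress_sandwich My sy MA MB AB.
have [M2 s2 E2] := compress_sandwich Mz sz MA MB AB.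
have [M3 s3 E3] := compress_sandwich (vND vM My Mz) (selfadjD sy sz) MA MB AB.
set P := y \o _ in M1 s1; set Q := z \o _ in M2 s2; set S := (y + z) \o _ in M3 s3 *.
apply: (@le_trans _ _ (w (2%:C%C *: (P + Q)))).
  apply: wle => //; first by apply/(vNZ vM)/(vND vM).
    exact/selfadjZ/selfadjD.
  move=> v; rewrite rdotZl [rdot ((P + Q) v) v]rdotDl.
  have -> : rdot (P v) v = rdot (A (y v)) (A (y v)) by exact: E1.
  have -> : rdot (Q v) v = rdot (A (z v)) (A (z v)) by exact: E2.
  have -> : rdot (S v) v = rdot (A ((y + z) v)) (A ((y + z) v)) by exact: E3.
  have yzE : (y + z) v = y v + z v by [].
  rewrite yzE (linD (vN_linear vM MA)).
  have := parallelogram dot (A (y v)) (A (z v)).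
  have := rdot_ge0 dot (A (y v) - A (z v)); lra.
rewrite wZ ?wD//; last exact: (vND vM).
have := yC A B MA MB AB; have := zC A B MA MB AB; rewrite -/P -/Q; lra.
Qed.

(** The constants C need not stay bounded along a chain, so dominated operators themselves are not
    closed under suprema. Zorn's lemma is applied instead to the operators b that dominated
    operators approximate from below up to arbitrarily small w-mass; normality of w closes this set
    under suprema. A maximal b is the identity, since [dominated_exists] for 1 - b would enlarge
    it. *)
Lemma dominated_approx e : 0 < e -> exists b C,
  [/\ M b, segment id b, w (id - b) <= e, 0 <= C & dominated_by C b].
Proof.
have Mid := vN_id vM.
pose G := [set b | [/\ M b, segment id b & forall e, 0 < e -> exists b' C,
  [/\ M b', segment b b', w (b - b') <= e, 0 <= C & dominated_by C b']]].
have GM : G `<=` M `&` segment id by move=> b [].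
have [||b [Mb bs bG] bmax] := vN_Zorn H_complete vM (F := G) _ GM.
- exists 0; split; [exact: (vN0 vM)|exact: segment0|move=> e0 e00].
  exists 0, 0; split => //; first exact: (vN0 vM).
  + by split; [exact: selfadj0|exact: ole_refl|exact: ole_refl].
  + by rewrite subrr (posfun0 vM wpos) ltW.
  + move=> A B _ _ _; rewrite mul0r.
    have -> : 0 \o (B \o (A \o 0)) = 0 :> (H -> H) by [].
    by rewrite (posfun0 vM wpos).
- move=> D S DG [[Dtot Dn DM MS] [Ss ubS lubS]]; split=> // e0 e00.
  have e2 : 0 < e0 / 2 by rewrite divr_gt0.
  have [A DA hA] : exists2 A, D A & w S - e0 / 2 < w A.
    apply: contrapT => h.
    have : w S <= w S - e0 / 2.
      apply: (@wnormal D S) => // A DA; rewrite leNgt; apply/negP => hA.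
      by apply: h; exists A.
    by lra.
  have [MA sA AG] := DG _ DA; have [b' [C [Mb' [sb' b0 bA] wb C0 Cb]]] := AG _ e2.
  exists b', C; split=> //.
    by split=> //; exact: ole_trans bA (ubS _ DA).
  move: wb; rewrite !(posfunB vM wpos)//; lra.
move=> e0; have [/eqP|/eqP r0] := eqVneq (id - b) 0.
  rewrite subr_eq0 => /eqP E; have [b' [C [Mb' bs' wb C0 Cb]]] := bG _ e0.
  by exists b', C; rewrite E; split=> //; rewrite -E.
have [sb b0 b1] := bs.
have Mr := vNB vM Mid Mb.
have rs : segment id (id - b).
  exact: segment_sub (segment_id dot) _.
have [y [C [My [sy y0 yr] yn0 C0 Cy]]] := dominated_exists Mr rs r0.
have y1 v : rdot (b v) v + rdot (y v) v <= rdot v v.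
  by have := yr v; rewrite rdotBl; lra.
exfalso; apply: yn0; apply: (addrI b); rewrite addr0; apply: bmax; last first.
  by move=> v; rewrite rdotDl lerDl; move/ole0E: y0.
split; first exact: (vND vM).
- split; first exact: selfadjD.
    apply/ole0E => v; rewrite rdotDl addr_ge0//; first by move/ole0E: b0.
    by move/ole0E: y0.
  by move=> v; rewrite rdotDl.
- move=> e1 /bG[b' [C' [Mb' [sb' b0' bb'] wb C0' Cb]]].
  exists (b' + y), ((C' + C) *+ 2); split.
  + exact: (vND vM).
  + split; first exact: selfadjD.
      apply/ole0E => v; rewrite rdotDl addr_ge0//; first by move/ole0E: b0'.
      by move/ole0E: y0.
    by move=> v; rewrite !rdotDl lerD2r.
  + by rewrite opprD addrACA subrr addr0.
  + by rewrite mulrn_wge0// addr_ge0.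
  + exact: dominated_add.
Qed.

End noncommutative_radon_nikodym.

(** * Intertwiners with the regular representation *)

Section square_summable_sequences.
Context {R : realType}.

Lemma real_cauchy_has_limit (u : nat -> R) :
  (forall e : R, 0 < e -> exists N, forall m n, (N <= m)%N -> (N <= n)%N ->
    `|u m - u n| < e) ->
  exists l, forall e : R, 0 < e -> exists N, forall n, (N <= n)%N ->
    `|u n - l| < e.
Proof.
move=> cu; have /cauchy_cvgP/cvg_ex[l ul] : cauchy (u @ \oo).
  apply/cauchy_ballP => e e0; have [N HN] := cu e e0.
  exists (u @` [set n | (N <= n)%N], u @` [set n | (N <= n)%N]).
    by split; exists N => // n Nn; exists n.
  by move=> [_ _] [/= [m Nm <-] [n Nn <-]]; apply: HN.
exists l => e e0; have /cvgrPdist_lt/(_ e e0)[N _ HN] := ul.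
by exists N => n /HN; rewrite distrC.
Qed.

Definition abs2 (z : R[i]) : R := complex.Re z ^+ 2 + complex.Im z ^+ 2.

Lemma abs2E z : `|z| ^+ 2 = (abs2 z)%:C%C.
Proof. by rewrite add_Re2_Im2. Qed.

Lemma mulJ_abs2 z : z * Num.conj z = (abs2 z)%:C%C.
Proof. by rewrite -normCK abs2E. Qed.

Lemma abs2_ge0 z : 0 <= abs2 z.
Proof. by rewrite addr_ge0 ?sqr_ge0. Qed.

Lemma abs2D z w : abs2 (z + w) <= abs2 z *+ 2 + abs2 w *+ 2.
Proof.
rewrite /abs2; case: z w => a b [c d] /=.
have := sqr_ge0 (a - c); have := sqr_ge0 (b - d); rewrite !expr2; lra.
Qed.

Section family.
Context {T : choiceType}.
Implicit Types (f : T -> R[i]) (a b : l2 R T).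
Local Notation dot2 := (@l2dot R T : {dot l2 R T for Num.conj}).

Lemma has_sum_finite f (A : {fset T}) : (forall t, t \notin A -> f t = 0) ->
  has_sum f (\sum_(t <- A) f t).
Proof.
move=> f0 e e0; exists A => B AB; rewrite (big_fsetID _ (fun t => t \in A) B)/=.
rewrite (_ : [fset t in B | t \in A]%fset = A).
  rewrite [X in _ + X - _]big1_fset ?addr0 ?subrr ?normr0//.
  by move=> t; rewrite !inE => /andP[_ /f0].
by apply/fsetP => t; rewrite !inE/= andbC; apply: andb_idr; exact: (fsubsetP AB).
Qed.

Lemma has_sum_reindex f s (p q : T -> T) : cancel p q -> cancel q p ->
  has_sum f s -> has_sum (f \o p) s.
Proof.
move=> pK qK fs e e0; have [A HA] := fs e e0.
exists [fset q t | t in A]%fset => B AB.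
have -> : \sum_(t <- B) (f \o p) t = \sum_(t <- [fset p t | t in B]%fset) f t.
  by rewrite big_imfset//= => x y _ _; exact: can_inj pK _ _.
apply: HA; apply/fsubsetP => t tA; apply/imfsetP; exists (q t); last by rewrite qK.
by apply: (fsubsetP AB); apply/imfsetP; exists t.
Qed.

Lemma l2_sum_le a (A : {fset T}) : \sum_(t <- A) abs2 (a t) <= rdot dot2 a a.
Proof.
have /asboolP[M aM] := valP a.
have aaE t : a t * Num.conj (a t) = `|a t| ^+ 2 by rewrite normCK.
have [||s /usumE sE sge] := @ge0_has_sum R T (fun t => a t * Num.conj (a t)) M.
- by move=> t; rewrite aaE exprn_ge0.
- by move=> B; under eq_bigr do rewrite aaE; exact: aM.
rewrite -lecR rmorph_sum/= -dotxxE [leRHS]sE (le_trans _ (sge A))//.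
by rewrite le_eqVlt; apply/orP; left; apply/eqP/eq_bigr => t _; rewrite mulJ_abs2.
Qed.

Lemma l2_abs2_le a t : abs2 (a t) <= rdot dot2 a a.
Proof. by have := l2_sum_le a [fset t]%fset; rewrite big_seq_fset1. Qed.

Lemma l2_le a (M : R) : (forall A : {fset T}, \sum_(t <- A) abs2 (a t) <= M) ->
  rdot dot2 a a <= M.
Proof.
move=> aM; apply: ler_epsP => e e0.
have e0' : 0 < e%:C%C :> R[i] by rewrite ltcR.
have [A /(_ A (fsubset_refl A))] := l2dotP a a e0'.
under eq_bigr do rewrite mulJ_abs2.
rewrite -rmorph_sum/= dotxxE -rmorphB/= normc_def/= expr0n addr0 sqrtr_sqr ltcR.
by rewrite ltr_norml => /andP[h _]; have := aM A; lra.
Qed.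

Lemma square_summableP f : (exists M : R, forall A : {fset T},
  \sum_(t <- A) abs2 (f t) <= M) -> f \in @square_summable R T.
Proof.
move=> [M fM]; apply/asboolP; exists M%:C%C => A.
by under eq_bigr do rewrite abs2E; rewrite -rmorph_sum lecR.
Qed.

Lemma l2_ext a b : (forall t, a t = b t) -> a = b.
Proof. by move=> ab; apply/val_inj/funext. Qed.

(** Coordinatewise limits form the candidate a. A finite sum of |u_n - a|^2 is compared with one
    later u_m that is close to a on that finite set; each of the two parts is at most e / 4 and is
    doubled by [abs2D]. *)
Lemma l2_complete : hilbert_complete dot2.
Proof.
suff cplx (u : nat -> l2 R T) :
    (forall e : R, 0 < e -> exists N, forall m n, (N <= m)%N -> (N <= n)%N ->
      nrm dot2 (u m - u n) < e) ->
    exists l, forall e : R, 0 < e -> exists N, forall n, (N <= n)%N ->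
      nrm dot2 (u n - l) < e.
  move=> u cu; have [e e0|l hl] := cplx u.
    have e0' : 0 < e%:C%C :> R[i] by rewrite ltcR.
    have [N HN] := cu _ e0'; exists N => m n Nm Nn.
    by have := HN _ _ Nm Nn; rewrite hnormE ltcR.
  exists l => e e0; have eE : e = (complex.Re e)%:C%C by exact/ge0_ReE/ltW.
  have e0' : 0 < complex.Re e by move: e0; rewrite eE ltcR.
  by have [N HN] := hl _ e0'; exists N => n /HN h; rewrite hnormE eE ltcR.
move=> cu.
have ptw t : exists l : R[i], forall e : R, 0 < e ->
    exists N, forall n, (N <= n)%N -> abs2 (u n t - l) < e.
  have cRI (F : R[i] -> R) : (forall z w, F (z - w) = F z - F w) ->
      (forall z, F z ^+ 2 <= abs2 z) -> exists l, forall e : R, 0 < e ->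
      exists N, forall n, (N <= n)%N -> `|F (u n t) - l| < e.
    move=> FB F2; apply: real_cauchy_has_limit => e e0.
    have [N HN] := cu e e0; exists N => m n Nm Nn.
    rewrite -(@ltr_pXn2r _ 2) ?nnegrE ?(ltW e0)// real_normK ?num_real// -FB.
    rewrite (le_lt_trans (F2 _))// (le_lt_trans (l2_abs2_le (u m - u n) t))//.
    by rewrite -nrm2E ltr_pXn2r ?nnegrE ?nrm_ge0 ?(ltW e0)// HN.
  have [||p hp] := cRI (@complex.Re R); first exact: ReB.
    by move=> z; rewrite lerDl sqr_ge0.
  have [||q hq] := cRI (@complex.Im R); first by move=> [? ?] [? ?].
    by move=> z; rewrite lerDr sqr_ge0.
  exists (Complex p q) => e e0.
  have s0 : 0 < Num.sqrt (e / 2) by rewrite sqrtr_gt0 divr_gt0.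
  have [N HN] := hp _ s0; have [N' HN'] := hq _ s0.
  have s2 : Num.sqrt (e / 2) ^+ 2 = e / 2 by rewrite sqr_sqrtr// divr_ge0// ltW.
  exists (maxn N N') => n; rewrite geq_max => /andP[/HN h /HN' h'].
  have sq (x : R) : `|x| < Num.sqrt (e / 2) -> x ^+ 2 < e / 2.
    by move=> xe; rewrite -s2 -real_normK ?num_real// ltr_pXn2r ?nnegrE ?(ltW s0).
  rewrite /abs2 (splitr e); case: (u n t) h h' => x y /= h h'.
  by rewrite ltrD// sq.
have [a ha] := choice ptw.
have tail e : 0 < e -> exists N, forall n, (N <= n)%N -> forall A : {fset T},
    \sum_(t <- A) abs2 (u n t - a t) <= e.
  move=> e0; have s0 : 0 < Num.sqrt (e / 4) by rewrite sqrtr_gt0 divr_gt0.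
  have s2 : Num.sqrt (e / 4) ^+ 2 = e / 4 by rewrite sqr_sqrtr// divr_ge0// ltW.
  have [N HN] := cu _ s0; exists N => n Nn A.
  have d0 : 0 < e / 4 / (#|` A|.+1)%:R by rewrite !divr_gt0.
  have [m Nm hm] : exists2 m, (N <= m)%N &
      forall t, t \in A -> abs2 (u m t - a t) <= e / 4 / (#|` A|.+1)%:R.
    have /choice[k hk] t := ha t _ d0.
    exists (maxn N (\max_(t <- A) k t)); first exact: leq_maxl.
    move=> t tA; rewrite ltW// hk// (leq_trans _ (leq_maxr _ _))//.
    by rewrite (big_fsetD1 t)//= leq_maxl.
  apply: (@le_trans _ _ (\sum_(t <- A) (abs2 (u n t - u m t) *+ 2 +
      abs2 (u m t - a t) *+ 2))).
    apply: ler_sum => t _.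
    by rewrite -(subrKA (u m t)) abs2D.
  rewrite big_split/= !sumrMnl.
  have h1 : \sum_(t <- A) abs2 (u n t - u m t) <= e / 4.
    rewrite (le_trans (l2_sum_le (u n - u m) A))// -nrm2E -s2.
    by rewrite ler_pXn2r ?nnegrE ?nrm_ge0 ?(ltW s0)// ltW// HN.
  have h2 : \sum_(t <- A) abs2 (u m t - a t) <= e / 4.
    apply: (@le_trans _ _ (\sum_(t <- A) (e / 4 / (#|` A|.+1)%:R))).
      by rewrite big_seq [leRHS]big_seq; apply: ler_sum => t /hm.
    rewrite big_const_seq count_predT iter_addr_0 -[_ *+ _]mulr_natr.
    rewrite mulrAC -mulrA ler_piMr// ?divr_ge0 ?(ltW e0)//.
    by rewrite ler_pdivrMr// mul1r ler_nat.
  lra.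
have aS : a \in @square_summable R T.
  apply: square_summableP; have [N HN] := tail 1 ltr01.
  exists (rdot dot2 (u N) (u N) *+ 2 + 1 *+ 2) => A.
  apply: (@le_trans _ _ (\sum_(t <- A) (abs2 (u N t) *+ 2 +
      abs2 (a t - u N t) *+ 2))).
    apply: ler_sum => t _; have := abs2D (u N t) (a t - u N t).
    by rewrite [u N t + _]addrC subrK.
  rewrite big_split/= !sumrMnl lerD// lerMn2r/=; first exact: l2_sum_le.
  rewrite (le_trans _ (HN N (leqnn _) A))//; apply: ler_sum => t _.
  by rewrite -opprB /abs2; case: (_ - _) => x y /=; rewrite !sqrrN.
exists (L2 aS) => e e0.
have [N HN] := tail (e ^+ 2 / 2) (divr_gt0 (exprn_gt0 2 e0) (ltr0Sn _ 1)).
exists N => n Nn; rewrite -(@ltr_pXn2r _ 2) ?nnegrE ?nrm_ge0 ?(ltW e0)// nrm2E.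
apply: (@le_lt_trans _ _ (e ^+ 2 / 2)); first by apply: l2_le; exact: HN.
by rewrite ltr_pdivrMr// ltr_pMr ?exprn_gt0// ltr1n.
Qed.

Fact l2delta_subproof (t : T) :
  (fun s => (s == t)%:R) \in @square_summable R T.
Proof.
apply: square_summableP; exists 1 => A; have [tA|tA] := boolP (t \in A).
  rewrite (big_fsetD1 t)//= big1_fset ?addr0 ?eqxx.
    by rewrite /abs2/= expr1n expr0n addr0.
  by move=> s; rewrite !inE => /andP[/negPf -> _]; rewrite /abs2/= expr0n addr0.
rewrite big1_seq// => s /andP[_ sA]; rewrite (_ : s == t = false).
  by rewrite /abs2/= expr0n addr0.
by apply: contraNF tA => /eqP <-.
Qed.

Definition l2delta t : l2 R T := L2 (l2delta_subproof t).

Lemma l2dot_delta a t : dot2 a (l2delta t) = a t.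
Proof.
apply: usumE; have := @has_sum_finite
  (fun s => a s * Num.conj (l2delta t s)) [fset t]%fset.
rewrite big_seq_fset1 /= eqxx rmorph1 mulr1; apply=> s.
by rewrite inE => /negPf/= ->; rewrite rmorph0 mulr0.
Qed.

End family.
End square_summable_sequences.

Section unitary_representations.
Context {R : realType} {G : groupType} {H : lmodType R[i]}
  (dot : {dot H for Num.conj}) (pi : G -> H -> H).
Hypothesis pi_rep : unitary_representation dot pi.

Lemma rep_linear g : linear (pi g).
Proof. by case: pi_rep => /(_ g)[]. Qed.

Lemma rep_dot g x y : dot (pi g x) (pi g y) = dot x y.
Proof. by case: pi_rep => /(_ g)[]. Qed.

Lemma rep1 x : pi 1%g x = x.
Proof. by case: pi_rep => _ ->. Qed.

Lemma repM g h x : pi (g * h)%g x = pi g (pi h x).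
Proof. by case: pi_rep => _ _ ->. Qed.

Lemma repK g x : pi g (pi g^-1%g x) = x.
Proof. by rewrite -repM mulgV rep1. Qed.

Lemma rep_adjoint g : adjoint dot (pi g) (pi g^-1%g).
Proof. by move=> x y; rewrite -[y in LHS](repK g) rep_dot. Qed.

Lemma rep_nrm g x : nrm dot (pi g x) = nrm dot x.
Proof. by rewrite /nrm /rdot rep_dot. Qed.

Lemma rep_bmap g : bmap dot dot (pi g).
Proof.
split; first exact: rep_linear.
by exists 1 => // x; rewrite rep_nrm mul1r.
Qed.

Lemma rep_bicommutant g : bicommutant dot (range pi) (pi g).
Proof.
split; first exact/bounded_opE/rep_bmap.
by move=> A [_ comA]; rewrite comA//; exists g.
Qed.

Lemma rep_vN_algebra : hilbert_complete dot ->
  vN_algebra dot (bicommutant dot (range pi)).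
Proof.
move=> Hc; apply: bicommutant_vN_algebra => // _ [g _ <-].
split; first exact: rep_linear.
by exists (pi g^-1%g); [exists g^-1%g|exact: rep_adjoint].
Qed.

Lemma rep_commutant A : bmap dot dot A ->
  (forall g x, A (pi g x) = pi g (A x)) -> commutant dot (range pi) A.
Proof.
move=> bA h; split; first exact/bounded_opE.
by move=> _ [g _ <-]; apply/funext => x /=.
Qed.

Lemma commutant_rep A g x : commutant dot (range pi) A -> A (pi g x) = pi g (A x).
Proof.
by move=> [_ /(_ (pi g))] h; apply: (fun_comp_eq x (h _)); exists g.
Qed.

End unitary_representations.

(** * Transferring operators along intertwiners *)

Section moments.
Context {R : realType} {H : lmodType R[i]} (dot : {dot H for Num.conj}).

Lemma bernoulli_unbounded (r K : R) : 1 < r -> exists j, K < r ^+ (2 ^ j).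
Proof.
move=> r1; have r0 : 0 < r - 1 by rewrite subr_gt0.
have h n : 1 + n%:R * (r - 1) <= r ^+ n.
  elim: n => [|n IH]; first by rewrite mul0r addr0.
  rewrite exprS -natr1 mulrDl mul1r addrA.
  have : 0 <= r * (r ^+ n - (1 + n%:R * (r - 1))).
    by rewrite mulr_ge0 ?subr_ge0// ltW// (lt_trans ltr01).
  have : 0 <= n%:R * (r - 1) * (r - 1) by rewrite !mulr_ge0// ltW.
  rewrite mulrBr mulrDr mulr1; lra.
exists (Num.bound `|K / (r - 1)|); set n := Num.bound _.
apply: lt_le_trans (h _).
have : K / (r - 1) < (2 ^ n)%:R.
  apply: lt_le_trans (_ : n%:R <= _); last first.
    by rewrite ler_nat ltnW// ltn_expl.
  by apply: (le_lt_trans (ler_norm _)); exact: archi_boundP.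
rewrite ltr_pdivrMr//; lra.
Qed.

(* For u_n = B^n u_0 with B self-adjoint this is the spectral radius bound
   |B u_0| <= c |u_0|, obtained by iterating Cauchy-Schwarz. *)
Lemma moment_bound (u : nat -> H) (c K : R) : 0 < c ->
  (forall n m, rdot dot (u n.+1) (u m) = rdot dot (u n) (u m.+1)) ->
  (forall n, nrm dot (u n) <= K * c ^+ n) -> nrm dot (u 1) <= c * nrm dot (u 0).
Proof.
move=> c0 sym uK; have shift n m : rdot dot (u (n + m)%N) (u 0%N) = rdot dot (u n) (u m).
  by elim: m n => [|m IH] n; [rewrite addn0|rewrite -sym -IH addSnnS].
have sq n : nrm dot (u n) ^+ 2 <= nrm dot (u (n * 2)%N) * nrm dot (u 0%N).
  by rewrite nrm2E -shift addnn -muln2 rdot_le.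
have [a0|a0] := eqVneq (nrm dot (u 0%N)) 0.
  have := sq 1%N; rewrite a0 !mulr0 => h.
  by rewrite -(@ler_pXn2r _ 2) ?nnegrE ?nrm_ge0// expr0n.
have a1 : 0 < nrm dot (u 0%N) by rewrite lt_def a0 nrm_ge0.
rewrite leNgt; apply/negP => h.
set a := nrm dot (u 0%N) in a0 a1 h *.
pose r := nrm dot (u 1%N) / (c * a).
have ca : 0 < c * a by rewrite mulr_gt0.
have r1 : 1 < r by rewrite ltr_pdivlMr// mul1r.
(* Each step of [sq] doubles the exponent; as r > 1, this lower bound outgrows K c^(2^j). *)
have low j : a * (r * c) ^+ (2 ^ j) <= nrm dot (u (2 ^ j)%N).
  elim: j => [|j IH].
    rewrite expn0 expr1 (_ : a * (r * c) = nrm dot (u 1%N))// /r.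
    by field; rewrite a0 gt_eqF.
  have rc : 0 <= r * c by rewrite mulr_ge0 ?(ltW c0) ?(ltW (lt_trans ltr01 r1)).
  rewrite expnSr -(ler_pM2r a1) (le_trans _ (sq _))// exprM.
  rewrite (_ : a * _ * a = (a * (r * c) ^+ (2 ^ j)) ^+ 2); last by ring.
  by rewrite ler_pXn2r// nnegrE ?nrm_ge0// mulr_ge0 ?(ltW a1) ?exprn_ge0.
have [j hj] := bernoulli_unbounded (K / a) r1.
have := le_trans (low j) (uK _); rewrite exprMn mulrA ler_pM2r ?exprn_gt0//.
by rewrite mulrC -ler_pdivlMr// leNgt hj.
Qed.

End moments.

Section intertwiners.
Context {R : realType} {G : groupType} {H1 H2 : lmodType R[i]}
  (d1 : {dot H1 for Num.conj}) (d2 : {dot H2 for Num.conj})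
  (pi1 : G -> H1 -> H1) (pi2 : G -> H2 -> H2).

Definition intertwiner (V : H1 -> H2) :=
  bmap d1 d2 V /\ forall g x, V (pi1 g x) = pi2 g (V x).

(** Density of the span of all ranges, expressed through its orthogonal complement. *)
Definition total_intertwiners := forall z,
  (forall V x, intertwiner V -> d2 (V x) z = 0) -> z = 0.

End intertwiners.

Section transfer.
Context {R : realType} {G : groupType} {H1 H2 : lmodType R[i]}
  (d1 : {dot H1 for Num.conj}) (d2 : {dot H2 for Num.conj})
  (pi1 : G -> H1 -> H1) (pi2 : G -> H2 -> H2).
Hypotheses (c1 : hilbert_complete d1) (c2 : hilbert_complete d2)
  (rep_1 : unitary_representation d1 pi1) (rep_2 : unitary_representation d2 pi2).
Local Notation M1 := (bicommutant d1 (range pi1)).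
Local Notation M2 := (bicommutant d2 (range pi2)).

Lemma intertwiner_adj V : intertwiner d1 d2 pi1 pi2 V ->
  exists2 W, intertwiner d2 d1 pi2 pi1 W & adj d1 d2 V W.
Proof.
move=> [bV Vpi]; have [W bW VW] := bmap_adj c1 bV.
exists W => //; split=> // g x; apply: (@dotr_inj _ _ d1) => y.
rewrite -VW -[g in LHS]invgK -(rep_adjoint rep_2) -Vpi VW.
by rewrite (rep_adjoint rep_1) invgK.
Qed.

Lemma intertwiner_comp V W : intertwiner d1 d2 pi1 pi2 V ->
  intertwiner d2 d1 pi2 pi1 W -> commutant d1 (range pi1) (W \o V).
Proof.
move=> [bV Vpi] [bW Wpi]; apply: rep_commutant; first exact: bmap_comp bW bV.
by move=> g x /=; rewrite Vpi Wpi.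
Qed.

Lemma commutant_intertwiner C V : commutant d2 (range pi2) C ->
  intertwiner d1 d2 pi1 pi2 V -> intertwiner d1 d2 pi1 pi2 (C \o V).
Proof.
move=> hC [bV Vpi]; have [/bounded_opE bC _] := hC.
split; first exact: bmap_comp bC bV.
by move=> g x /=; rewrite Vpi (commutant_rep _ _ hC).
Qed.

Lemma commutant_adj C : commutant d2 (range pi2) C ->
  exists2 D, commutant d2 (range pi2) D & adjoint d2 C D.
Proof.
move=> hC; have [/bounded_opE bC _] := hC.
have [D bD CD] := bmap_adj c2 bC; exists D => //.
apply: rep_commutant => // g x; apply: (@dotr_inj _ _ d2) => y.
rewrite -CD -[g in LHS]invgK -(rep_adjoint rep_2) -(commutant_rep _ _ hC) CD.
by rewrite (rep_adjoint rep_2) invgK.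
Qed.

Let I := {V | intertwiner d1 d2 pi1 pi2 V}.
Let ev (B : H1 -> H1) (s : seq (I * H1)) : H2 :=
  \sum_(p <- s) sval p.1 (B p.2).

Let lin_I (V : I) : linear (sval V).
Proof. by have [[]] := svalP V. Qed.

(* Elements of the bicommutant commute with V_j^* V_i, which makes
   sum V_i x_i |-> sum V_i (A x_i) well defined and bounded. *)
Lemma bicommutant_span_bound A : M1 A ->
  exists2 K : R, 0 <= K & forall s, nrm d2 (ev A s) <= K * nrm d2 (ev id s).
Proof.
move=> MA; have vM := rep_vN_algebra rep_1 c1.
have [A' MA' AA'] := vN_adj c1 vM MA.
have [lA [k k0 Ak]] := vN_bmap vM MA.
pose B := A' \o A; have MB : M1 B := vN_comp vM MA' MA.
have [lB [c c0 Bc]] := vN_bmap vM MB.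
have adjB : adjoint d1 B B := adjoint_comp (adj_sym AA') AA'.
have comm C (V W : I) x y : M1 C -> forall C', adjoint d1 C C' ->
    d2 (sval V (C x)) (sval W y) = d2 (sval V x) (sval W (C' y)).
  move=> [_ comC] C' CC'; have [W' iW' WW'] := intertwiner_adj (svalP W).
  have WW := adj_sym WW'; rewrite -WW -WW.
  have := comC _ (intertwiner_comp (svalP V) iW').
  by move=> /(congr1 (fun f => f x)) /= <-; rewrite CC'.
have c1' : 0 < c + 1 by rewrite ltr_wpDl.
(* |ev A s|^2 = <ev B s, ev s> with B = A' A, and [moment_bound] gives |ev B s| <= (c + 1) |ev
   s|. *)
exists (Num.sqrt (c + 1)); first exact: sqrtr_ge0.
move=> s; pose u n := ev (iter n B) s.
have sym n m : rdot d2 (u n.+1) (u m) = rdot d2 (u n) (u m.+1).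
  rewrite /rdot /u /ev !dot_suml; congr complex.Re; apply: eq_bigr => p _.
  by rewrite !dot_sumr; apply: eq_bigr => q _ /=; exact: comm.
have iterB n x : nrm d1 (iter n B x) <= (c + 1) ^+ n * nrm d1 x.
  elim: n => [|n IH]; first by rewrite mul1r.
  by rewrite iterS (le_trans (Bc _))// exprS -mulrA ler_pM ?nrm_ge0// lerDl.
have u01 : nrm d2 (u 1) <= (c + 1) * nrm d2 (u 0).
  (* [xget] picks an operator bound for each V; one exists because V is bounded, so the default
     value never occurs. *)
  pose K := \sum_(p <- s) xget 0 [set e : R | 0 <= e /\
    forall x, nrm d2 (sval p.1 x) <= e * nrm d1 x] * nrm d1 p.2.
  apply: (@moment_bound _ _ _ _ _ K) => // n.
  rewrite /u /ev /K mulr_suml; elim: (s) => [|p s' IH].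
    by rewrite !big_nil nrm0.
  rewrite !big_cons (le_trans (nrmD _ _ _))// lerD//.
  case: xgetP => [e _ [e0 he]|noe].
    by rewrite (le_trans (he _))// -mulrA ler_wpM2l// mulrC.
  case: p.1 (noe) => V [[lV [e e0 he]] iV] /= noe'.
  by have := noe' e; case.
rewrite -(@ler_pXn2r _ 2) ?nnegrE ?mulr_ge0 ?sqrtr_ge0 ?nrm_ge0//.
have sc : Num.sqrt (c + 1) ^+ 2 = c + 1 by rewrite sqr_sqrtr ?(ltW c1').
rewrite exprMn sc.
have -> : nrm d2 (ev A s) ^+ 2 = rdot d2 (u 1%N) (u 0%N).
  rewrite nrm2E /rdot /u /ev !dot_suml; congr complex.Re; apply: eq_bigr => p _.
  rewrite !dot_sumr; apply: eq_bigr => q _ /=.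
  by rewrite -(comm A' _ _ _ _ MA' A (adj_sym AA')).
rewrite (le_trans (rdot_le _ _ _))// expr2 mulrA ler_wpM2r ?nrm_ge0//.
Qed.

(** A is the adjoint of the map sum V_i x_i |-> sum V_i (T' x_i), which is defined only on the span
    of the ranges. A z is obtained directly from Riesz representation of a functional given by its
    graph; totality makes it unique, whence linearity and commutation with the commutant. *)
Lemma transfer T : total_intertwiners d1 d2 pi1 pi2 -> M1 T ->
  exists2 A, M2 A & forall W y, intertwiner d2 d1 pi2 pi1 W -> W (A y) = T (W y).
Proof.
move=> tot MT; have vM := rep_vN_algebra rep_1 c1.
have [T' MT' TT'] := vN_adj c1 vM MT.
have lT' := vN_linear vM MT'.
have [K K0 hK] := bicommutant_span_bound MT'.
have ex z : exists w, nrm d2 w <= K * nrm d2 z /\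
    forall V x, intertwiner d1 d2 pi1 pi2 V -> d2 (V (T' x)) z = d2 (V x) w.
  pose Gr x c := exists s, x = ev id s /\ c = d2 (ev T' s) z.
  have [||||w [w1 w2 _]] := @riesz_representation R H2 d2 c2 Gr (K * nrm d2 z).
  - by exists [::]; rewrite /ev !big_nil dot0l.
  - move=> a _ _ _ _ [s [-> ->]] [s' [-> ->]].
    exists ([seq (p.1, a *: p.2) | p <- s] ++ s'); rewrite /ev !big_cat !big_map /=.
    rewrite dotDl scaler_sumr !dot_suml mulr_sumr; split; congr (_ + _).
      by apply: eq_bigr => p _; rewrite (linZ (lin_I _)).
    by apply: eq_bigr => p _; rewrite (linZ lT') (linZ (lin_I _)) dotZl.
  - move=> _ _ [s [-> ->]]; rewrite (le_trans (rdot_le _ _ _))// mulrAC.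
    by rewrite ler_wpM2r ?nrm_ge0.
  - by rewrite mulr_ge0 ?nrm_ge0.
  exists w; split=> // V x iV; apply: w2; exists [:: (exist _ V iV, x)].
  by rewrite /ev !big_seq1.
have [A hA] := choice ex.
have AE z V x : intertwiner d1 d2 pi1 pi2 V -> d2 (V (T' x)) z = d2 (V x) (A z).
  by case: (hA z) => _; exact.
have uniq z w : (forall V x, intertwiner d1 d2 pi1 pi2 V ->
    d2 (V (T' x)) z = d2 (V x) w) -> A z = w.
  move=> h; apply/eqP; rewrite -subr_eq0; apply/eqP/tot => V x iV.
  by rewrite dotBr -(AE _ _ _ iV) -(h _ _ iV) subrr.
have lA : linear A.
  by move=> a x y; apply: uniq => V z iV; rewrite !dotDr !dotZr -!AE.
have bA : bmap d2 d2 A by split=> //; exists K => // z; case: (hA z).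
exists A.
  split; first exact/bounded_opE.
  move=> C hC; have [D hD CD] := commutant_adj hC.
  apply/funext => z /=; apply: uniq => V x iV.
  have DC := adj_sym CD; rewrite -DC.
  by have := AE z _ x (commutant_intertwiner hD iV); rewrite /= => ->; rewrite DC.
move=> W y iW; have [V iV WV] : exists2 V, intertwiner d1 d2 pi1 pi2 V & adj d2 d1 W V.
  have [bW Wpi] := iW; have [V bV WV] := bmap_adj c2 bW.
  exists V => //; split=> // g x; apply: (@dotr_inj _ _ d2) => v.
  rewrite -WV -[g in LHS]invgK -(rep_adjoint rep_1) -Wpi WV.
  by rewrite (rep_adjoint rep_2) invgK.
apply: (@dotl_inj _ _ d1) => x.
by rewrite WV dotC -AE// -dotC -WV TT'.
Qed.

End transfer.

Section isomorphism.
Context {R : realType} {G : groupType} {H1 H2 : lmodType R[i]}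
  (d1 : {dot H1 for Num.conj}) (d2 : {dot H2 for Num.conj})
  (pi1 : G -> H1 -> H1) (pi2 : G -> H2 -> H2).
Hypotheses (c1 : hilbert_complete d1) (c2 : hilbert_complete d2)
  (rep_1 : unitary_representation d1 pi1) (rep_2 : unitary_representation d2 pi2).
Local Notation M1 := (bicommutant d1 (range pi1)).
Local Notation M2 := (bicommutant d2 (range pi2)).
Hypotheses (tot12 : total_intertwiners d1 d2 pi1 pi2)
  (tot21 : total_intertwiners d2 d1 pi2 pi1).

Let vM1 := rep_vN_algebra rep_1 c1.
Let vM2 := rep_vN_algebra rep_2 c2.

(** The graph of the isomorphism. Corresponding operators exist and are unique in both directions,
    so each algebraic property follows by checking that the expected operator corresponds. *)
Let corr (A : H2 -> H2) (T : H1 -> H1) :=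
  (forall V x, intertwiner d1 d2 pi1 pi2 V -> V (T x) = A (V x)) /\
  (forall W y, intertwiner d2 d1 pi2 pi1 W -> W (A y) = T (W y)).

Let separated z : (forall W, intertwiner d2 d1 pi2 pi1 W -> W z = 0) -> z = 0.
Proof.
move=> Wz; apply: tot12 => V x iV.
have [W iW VW] := intertwiner_adj c1 rep_1 rep_2 iV.
by rewrite VW Wz// dot0r.
Qed.

Let separated' z : (forall V, intertwiner d1 d2 pi1 pi2 V -> V z = 0) -> z = 0.
Proof.
move=> Vz; apply: tot21 => W y iW.
have [V iV WV] := intertwiner_adj c2 rep_2 rep_1 iW.
by rewrite WV Vz// dot0r.
Qed.

Let corr1 T : M1 T -> exists2 A, M2 A & corr A T.
Proof.
move=> MT; have [A MA AT] := transfer c1 c2 rep_1 rep_2 tot12 MT.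
exists A => //; split=> // V x iV; apply/eqP; rewrite -subr_eq0; apply/eqP.
apply: separated => W iW; have [[lW _] _] := iW; rewrite (linB lW) AT//.
have [_ /(_ _ (intertwiner_comp iV iW))] := MT.
by move=> /(congr1 (fun f => f x)) /= <-; rewrite subrr.
Qed.

Let corr2 A : M2 A -> exists2 T, M1 T & corr A T.
Proof.
move=> MA; have [T MT AT] := transfer c2 c1 rep_2 rep_1 tot21 MA.
exists T => //; split=> // W y iW; apply/eqP; rewrite -subr_eq0; apply/eqP.
apply: separated' => V iV; have [[lV _] _] := iV; rewrite (linB lV) AT//.
have [_ /(_ _ (intertwiner_comp iW iV))] := MA.
by move=> /(congr1 (fun f => f y)) /= <-; rewrite subrr.
Qed.

Let corr_inj1 A A' T : M2 A -> M2 A' -> corr A T -> corr A' T -> A = A'.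
Proof.
move=> MA MA' [_ h] [_ h']; apply/funext => y; apply/eqP; rewrite -subr_eq0.
apply/eqP/separated => W iW; have [[lW _] _] := iW.
by rewrite (linB lW) h// h'// subrr.
Qed.

Let corr_inj2 A T T' : M1 T -> M1 T' -> corr A T -> corr A T' -> T = T'.
Proof.
move=> MT MT' [h _] [h' _]; apply/funext => y; apply/eqP; rewrite -subr_eq0.
apply/eqP/separated' => V iV; have [[lV _] _] := iV.
by rewrite (linB lV) h// h'// subrr.
Qed.

Lemma total_intertwiners_isomorphism : exists phi,
  vN_isomorphism d2 d1 M2 M1 phi /\ forall g, phi (pi2 g) = pi1 g.
Proof.
have ex A : exists T, M2 A -> M1 T /\ corr A T.
  have [/corr2[T MT AT]|nA] := pselect (M2 A); first by exists T.
  by exists 0.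
have [phi hphi] := choice ex.
have Mphi A : M2 A -> M1 (phi A) by move=> /hphi[].
have Cphi A : M2 A -> corr A (phi A) by move=> /hphi[].
have phiE A T : M2 A -> M1 T -> corr A T -> phi A = T.
  by move=> MA MT AT; apply: (corr_inj2 _ MT (Cphi _ MA) AT); exact: Mphi.
exists phi; split; last first.
  move=> g; apply: phiE; try exact: rep_bicommutant.
  by split=> [V x [_ ->]|W y [_ ->]].
split.
- split; first by move=> A /Mphi.
    move=> A A' /set_mem MA /set_mem MA' E.
    by apply: (corr_inj1 MA MA' (Cphi _ MA)); rewrite E; exact: Cphi.
  by move=> T MT; have [A MA AT] := corr1 MT; exists A => //; exact: phiE.
- move=> c A B MA MB; apply: phiE; first exact: (vN_lin vM2).
    by apply: (vN_lin vM1); exact: Mphi.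
  have [a1 a2] := Cphi _ MA; have [b1 b2] := Cphi _ MB.
  split=> [V x iV|W y iW].
    by have [[lV _] _] := iV; rewrite !fctE lV a1// b1.
  by have [[lW _] _] := iW; rewrite !fctE lW a2// b2.
- move=> A B MA MB; apply: phiE; first exact: (vN_comp vM2).
    by apply: (vN_comp vM1); exact: Mphi.
  have [a1 a2] := Cphi _ MA; have [b1 b2] := Cphi _ MB.
  by split=> [V x iV|W y iW] /=; [rewrite a1// b1|rewrite a2// b2].
- move=> A B MA MB AB; have [T MT phiAT] := vN_adj c1 vM1 (Mphi _ MA).
  suff -> : phi B = T by [].
  apply: phiE => //; have [a1 a2] := Cphi _ MA.
  have TpA := adj_sym phiAT; have BA := adj_sym AB.
  split=> [V x iV|W y iW].
    apply: (@dotr_inj _ _ d2) => z.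
    have [W iW VW] := intertwiner_adj c1 rep_1 rep_2 iV; have WV := adj_sym VW.
    by rewrite -WV -phiAT -a2// WV -AB.
  apply: (@dotr_inj _ _ d1) => z.
  have [V iV WV] := intertwiner_adj c2 rep_2 rep_1 iW; have VW := adj_sym WV.
  by rewrite -VW -AB -a1// VW phiAT.
Qed.

End isomorphism.

Section regular_representation.
Context {R : realType} {G : groupType}.
Implicit Types (g h : G) (a b : l2 R G).
Local Notation dot2 := (@l2dot R G : {dot l2 R G for Num.conj}).
Local Notation lam := (@left_regular R G).

Fact right_regular_subproof g a :
  (fun t => a (t * g)%g) \in @square_summable R G.
Proof.
have /asboolP[M aM] := valP a; apply/asboolP; exists M => A.
have := aM [fset (t * g)%g | t in A]%fset.
by rewrite big_imfset//= => x y _ _ /mulIg.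
Qed.

Definition right_regular g a : l2 R G := L2 (right_regular_subproof g a).

Lemma left_regular_rep : unitary_representation dot2 lam.
Proof.
split; [move=> g; split| |].
- by move=> c a b; apply: l2_ext.
- move=> a _; exists (lam g^-1%g a) => //.
  by apply: l2_ext => t /=; rewrite invgK mulVKg.
- move=> a b; apply: usumE.
  exact: (has_sum_reindex (mulVKg g) (mulKg g) (l2dotP a b)).
- by apply/funext => a; apply: l2_ext => t /=; rewrite invg1 mul1g.
- by move=> g h; apply/funext => a; apply: l2_ext => t /=; rewrite invgM mulgA.
Qed.

Lemma right_regular_dot g a b : dot2 (right_regular g a) (right_regular g b) = dot2 a b.
Proof.
apply: usumE; exact: (has_sum_reindex (mulgK g) (mulgVK g) (l2dotP a b)).
Qed.

Lemma right_regular_linear g : linear (right_regular g).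
Proof. by move=> c a b; apply: l2_ext. Qed.

Lemma right_regular_bmap g : bmap dot2 dot2 (right_regular g).
Proof.
split; first exact: right_regular_linear.
by exists 1 => // x; rewrite /nrm /rdot right_regular_dot mul1r.
Qed.

Lemma right_left_regular g h a :
  right_regular g (lam h a) = lam h (right_regular g a).
Proof. by apply: l2_ext => t /=; rewrite mulgA. Qed.

Lemma right_regular_commutant g : commutant dot2 (range lam) (right_regular g).
Proof.
apply: rep_commutant; first exact: right_regular_bmap.
by move=> h a; exact: right_left_regular.
Qed.

Lemma right_regularK g a : right_regular g (right_regular g^-1%g a) = a.
Proof. by apply: l2_ext => t /=; rewrite mulgK. Qed.

Lemma right_regular_adjoint g : adjoint dot2 (right_regular g) (right_regular g^-1%g).
Proof. by move=> a b; rewrite -[b in LHS](right_regularK g) right_regular_dot. Qed.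

Lemma left_regular_delta g h : lam g (l2delta h) = l2delta (g * h)%g :> l2 R G.
Proof.
apply: l2_ext => t /=; congr ((nat_of_bool _)%:R).
by apply/eqP/eqP => [<-|->]; rewrite ?mulVKg ?mulKg.
Qed.

Lemma right_regular_delta g h : right_regular g (l2delta h) = l2delta (h * g^-1)%g :> l2 R G.
Proof.
apply: l2_ext => t /=; congr ((nat_of_bool _)%:R).
by apply/eqP/eqP => [<-|->]; rewrite ?mulgK ?mulgVK.
Qed.

Lemma group_vN_comm S g a : group_vN_algebra S ->
  S (right_regular g a) = right_regular g (S a).
Proof.
by move=> [_ /(_ _ (right_regular_commutant g))] /(congr1 (fun f => f a)).
Qed.

Lemma group_vN_algebra_vN : vN_algebra dot2 (@group_vN_algebra R G).
Proof. exact: (rep_vN_algebra left_regular_rep (@l2_complete _ _)). Qed.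

Lemma group_vN_delta S g : group_vN_algebra S ->
  S (l2delta g) = right_regular g^-1%g (S (l2delta 1%g)).
Proof.
by move=> MS; rewrite -group_vN_comm// right_regular_delta invgK mul1g.
Qed.

Definition canonical_trace (S : l2 R G -> l2 R G) : R[i] := S (l2delta 1%g) 1%g.

Lemma canonical_traceE S : canonical_trace S = dot2 (S (l2delta 1%g)) (l2delta 1%g).
Proof. by rewrite l2dot_delta. Qed.

Lemma canonical_trace_left_regular g : canonical_trace (lam g) = (g == 1%g)%:R.
Proof.
by rewrite /canonical_trace left_regular_delta mulg1 /= eq_sym.
Qed.

(** The trace of A B is the sum over t of (B delta_1)(t) (A delta_1)(t^-1), an expression that is
    symmetric under t |-> t^-1. *)
Lemma canonical_trace_comm S T : group_vN_algebra S -> group_vN_algebra T ->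
  canonical_trace (S \o T) = canonical_trace (T \o S).
Proof.
move=> MS MT.
have half A B : group_vN_algebra A -> group_vN_algebra B ->
    has_sum (fun t => B (l2delta 1%g) t * A (l2delta 1%g) t^-1%g)
      (canonical_trace (A \o B)).
  move=> MA MB; have [A' MA' AA'] := vN_adj (@l2_complete _ _) group_vN_algebra_vN MA.
  rewrite canonical_traceE /= AA'.
  have := l2dotP (B (l2delta 1%g)) (A' (l2delta 1%g)).
  congr has_sum; apply/funext => t; congr (_ * _).
  rewrite -[A' _ t]l2dot_delta -dotC -AA' l2dot_delta group_vN_delta//=.
  by rewrite mul1g.
have h1 := half _ _ MS MT; have h2 := half _ _ MT MS.
rewrite -(usumE h1); apply: usumE.
have := has_sum_reindex (@invgK G) (@invgK G) h2.
by congr has_sum; apply/funext => t /=; rewrite invgK mulrC.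
Qed.

Lemma canonical_trace_gram S T : adjoint dot2 S T ->
  canonical_trace (T \o S) = dot2 (S (l2delta 1%g)) (S (l2delta 1%g)).
Proof. by move=> ST; rewrite canonical_traceE /= (adj_sym ST). Qed.

(** By the trace property the adjoint T also kills delta_1; commuting with right translations, it
    then kills every delta_t. *)
Lemma canonical_trace_faithful S T : group_vN_algebra S -> group_vN_algebra T ->
  adjoint dot2 S T -> canonical_trace (T \o S) = 0 -> S = 0.
Proof.
move=> MS MT ST S0.
have T0 : T (l2delta 1%g) = 0.
  apply: (@dot_eq0 _ _ dot2); rewrite -(canonical_trace_gram (adj_sym ST)).
  by rewrite canonical_trace_comm.
apply/funext => a; apply: l2_ext => t.
rewrite -l2dot_delta ST group_vN_delta// T0.
by rewrite (lin0 (right_regular_linear _)) dot0r.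
Qed.

End regular_representation.

Section icc_totality.
Context {R : realType} {G : groupType} {H : lmodType R[i]}
  (dot : {dot H for Num.conj}) (pi : G -> H -> H).
Hypotheses (Hc : hilbert_complete dot) (pi_rep : unitary_representation dot pi)
  (G_icc : icc G).
Local Notation dot2 := (@l2dot R G : {dot l2 R G for Num.conj}).
Local Notation lam := (@left_regular R G).
Variables (W0 : H -> l2 R G) (y0 : H).
Hypotheses (iW0 : intertwiner dot dot2 pi lam W0) (W0y0 : W0 y0 <> 0).

(* The orthogonal complement K of all ranges is invariant under both regular
   representations, so the projection of delta_1 to K is conjugation invariant,
   hence by icc a multiple of delta_1. *)
Lemma icc_total_intertwiners : total_intertwiners dot dot2 pi lam.
Proof.
pose K z := forall W y, intertwiner dot dot2 pi lam W -> dot2 (W y) z = 0.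
have lam_rep := @left_regular_rep R G.
have lamK g z : K z -> K (lam g z).
  move=> Kz W y iW; rewrite -[g]invgK -(rep_adjoint lam_rep).
  by have [_ Wpi] := iW; rewrite -Wpi Kz.
have rhoK g z : K z -> K (right_regular g z).
  move=> Kz W y [bW Wpi]; rewrite -[g]invgK -right_regular_adjoint.
  apply: (Kz (right_regular g^-1%g \o W) y); split.
    exact: bmap_comp (right_regular_bmap _) bW.
  by move=> h x /=; rewrite Wpi right_left_regular.
have linK c z w : K z -> K w -> K (c *: z + w).
  by move=> Kz Kw W y iW; rewrite dotDr dotZr Kz// Kw// mulr0 addr0.
(* p represents evaluation at 1 on K, so it is the projection of delta_1 to K. *)
have [||||p [_ pE pcl]] := riesz_representation (@l2_complete R G)
    (G := fun z c => K z /\ c = z 1%g) (K := 1).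
- by split=> // W y _; rewrite dot0r.
- by move=> c z _ w _ [Kz ->] [Kw ->]; split=> //; exact: linK.
- move=> z _ [_ ->]; rewrite mul1r -l2dot_delta (le_trans (rdot_le _ _ _))//.
  have -> : nrm dot2 (l2delta 1%g) = 1.
    by rewrite /nrm /rdot l2dot_delta /= eqxx sqrtr1.
  by rewrite mulr1.
- by [].
(* Riesz representation only yields p as a limit of elements of K; being an orthogonal complement, K
   is closed. *)
have Kp : K p.
  move=> W y iW; have [[lW _] _] := iW.
  have h u : rdot dot2 (W u) p = 0.
    apply/eqP; rewrite -normr_eq0 eq_le normr_ge0 andbT; apply: ler_epsP => e e0.
    have c0 : 0 < nrm dot2 (W u) + 1 by rewrite ltr_wpDl// nrm_ge0.
    have [z [c [[Kz _] zp]]] := pcl _ (divr_gt0 e0 c0).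
    have -> : rdot dot2 (W u) p = rdot dot2 (W u) (p - z).
      by rewrite rdotBr [X in _ - X](_ : _ = 0) ?subr0// /rdot Kz.
    rewrite add0r (le_trans (rdot_CS _ _ _))// nrmBC.
    apply: (@le_trans _ _ (nrm dot2 (W u) * (e / (nrm dot2 (W u) + 1)))).
      by rewrite ler_wpM2l ?nrm_ge0// ltW.
    by rewrite mulrCA ler_piMr ?(ltW e0)// ler_pdivrMr// mul1r lerDl.
  apply: Re_eq; first exact: h.
  by rewrite mulr0 -dotZl -(linZ lW); exact: h.
have Kdelta z : K z -> z 1%g = dot2 z p by move=> Kz; apply: pE.
have p_inv g t : p (g^-1 * t * g)%g = p t.
  pose q := lam g (right_regular g p).
  have Kq : K q by apply/lamK/rhoK.
  have Kqp : K (q - p) by rewrite addrC -scaleN1r; exact: linK.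
  suff pq : p = q by rewrite [in RHS]pq.
  apply/esym/eqP; rewrite -subr_eq0; apply/eqP/(@dot_eq0 _ _ dot2).
  rewrite dotBr -(Kdelta _ Kqp) {2}/q -(adj_sym (rep_adjoint lam_rep g)).
  rewrite -(adj_sym (right_regular_adjoint g)) -Kdelta; last exact/rhoK/lamK.
  by rewrite [X in X - _]/= invgK mul1g mulgV subrr.
have p0 t : t != 1%g -> p t = 0.
  move=> t1; apply/eqP; apply: contraT => pt.
  have a0 : 0 < abs2 (p t).
    rewrite lt_def abs2_ge0 andbT; apply: contra pt => /eqP pt.
    by rewrite -normr_eq0 -sqrf_eq0 abs2E pt.
  have [A At An] := infinite_set_fset (Num.bound (rdot dot2 p p / abs2 (p t))) (G_icc t1).
  have := l2_sum_le p A; rewrite leNgt => /negP[].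
  have -> : \sum_(s <- A) abs2 (p s) = #|` A|%:R * abs2 (p t).
    rewrite big_seq (eq_bigr (fun=> abs2 (p t))).
      by rewrite -big_seq big_const_seq count_predT iter_addr_0 mulr_natl.
    move=> s /At [g _ <-]; congr abs2; rewrite -(p_inv g t); congr (p _).
    by rewrite conjgE mulgA.
  rewrite -ltr_pdivrMr//; apply: lt_le_trans (archi_boundP _) _.
    by rewrite divr_ge0 ?rdot_ge0 ?(ltW a0).
  by rewrite ler_nat.
have pE1 : p = p 1%g *: l2delta 1%g.
  apply: l2_ext => t; have -> : (p 1%g *: l2delta 1%g : l2 R G) t =
    p 1%g * (t == 1%g)%:R by [].
  by have [->|/p0 ->] := eqVneq t 1%g; rewrite ?mulr1 ?mulr0.
(* Otherwise delta_1, and by translation every delta_t, would be orthogonal to all ranges, against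
   W0 y0 <> 0. *)
have p10 : p 1%g = 0.
  apply/eqP; apply: contraT => pn0; exfalso; apply: W0y0.
  have Kd : K (l2delta 1%g).
    have K0 : K 0 by move=> W y _; rewrite dot0r.
    by have := linK (p 1%g)^-1 _ _ Kp K0; rewrite addr0 {2}pE1 scalerA mulVf// scale1r.
  apply: l2_ext => t; rewrite -l2dot_delta -[t]mulg1 -left_regular_delta.
  exact: lamK.
move=> z Kz; apply: l2_ext => t.
have := Kdelta _ (lamK t^-1%g _ Kz).
by rewrite /= invgK mulg1 pE1 p10 scale0r dot0r.
Qed.
End icc_totality.

(** * Traces on group algebras *)

Section states.
Context {R : realType} {H : lmodType R[i]} (dot : {dot H for Num.conj}).
Hypothesis Hc : hilbert_complete dot.
Variable M : set (H -> H).
Hypothesis vM : vN_algebra dot M.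

Lemma vector_functional_positive v :
  positive_functional dot M (fun A => rdot dot (A v) v).
Proof.
split=> [A B _ _|t A _|A B _ _ AB]; first by rewrite rdotDl.
  by rewrite rdotZl.
by rewrite /= /rdot (adj_sym AB); exact: rdot_ge0.
Qed.

Lemma vector_functional_normal v :
  chain_normal dot M (fun A => rdot dot (A v) v).
Proof. by move=> D S [_ [_ _ lub]] c h; apply: lub. Qed.

Section trace.
Variable tau : (H -> H) -> R[i].
Hypothesis tau_tr : tracial_state dot M tau.

Definition re_trace A : R := complex.Re (tau A).

Lemma trace_lin c A B : M A -> M B -> tau (c *: A + B) = c * tau A + tau B.
Proof. by case: tau_tr => + _ _ _; apply. Qed.

Lemma trace0 : tau 0 = 0.
Proof.
have := trace_lin (-1) (vN0 vM) (vN0 vM).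
by rewrite scaler0 addr0 mulN1r addNr.
Qed.

Lemma traceZ c A : M A -> tau (c *: A) = c * tau A.
Proof.
by move=> MA; have := trace_lin c MA (vN0 vM); rewrite addr0 trace0 addr0.
Qed.

Lemma traceD A B : M A -> M B -> tau (A + B) = tau A + tau B.
Proof. by move=> MA MB; have := trace_lin 1 MA MB; rewrite scale1r mul1r. Qed.

Lemma trace_ge0 A B : M A -> M B -> adjoint dot A B -> 0 <= tau (B \o A).
Proof. by case: tau_tr => _ + _ _; apply. Qed.

Lemma trace_comm A B : M A -> M B -> tau (A \o B) = tau (B \o A).
Proof. by case: tau_tr => _ _ _; apply. Qed.

Lemma trace_id : tau id = 1.
Proof. by case: tau_tr. Qed.

Lemma re_trace_positive : positive_functional dot M re_trace.
Proof.
split=> [A B MA MB|t A MA|A B MA MB AB]; rewrite /re_trace.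
- by rewrite traceD// ReD.
- by rewrite traceZ// ReZ.
- exact/ge0_Re/trace_ge0.
Qed.

Lemma trace_gramE A B : M A -> M B -> adjoint dot A B ->
  tau (B \o A) = (re_trace (B \o A))%:C%C.
Proof. by move=> MA MB AB; exact/ge0_ReE/trace_ge0. Qed.

Lemma trace_segmentE A : M A -> segment dot id A -> tau A = (re_trace A)%:C%C.
Proof.
move=> MA As; have [c [Mc [[_ ac] _ _] ->]] := vN_sqrt Hc vM MA As.
exact: trace_gramE.
Qed.

(** The chain is an upward directed set with supremum S. Any upper bound B in M is self-adjoint,
    because B - A is positive for a member A of the chain, so the two notions of order agree on
    it. *)
Lemma normal_state_chain_normal : normal_state dot M tau ->
  chain_normal dot M re_trace.
Proof.
move=> ntau D S [[Dtot Dn DM MS] [Ss ubS lubS]] c hc.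
have sD A : D A -> selfadj dot A by case/DM => _ [].
have [sS _ _] := Ss.
have [||ub lub] := ntau D S.
- move=> A DA; apply: ole_op_le; [exact: selfadj0|exact: sD|].
  by case: (DM _ DA) => _ [].
- split=> //.
  + by move=> A /DM[].
  + move=> A B DA DB; have [AB|BA] := Dtot _ _ DA DB.
      by exists B => //; split; apply: ole_op_le => //; exact: sD.
    by exists A => //; split; apply: ole_op_le => //; exact: sD.
  + by split=> // A DA; apply: ole_op_le => //; [exact: sD|exact: ubS].
  + move=> B MB DB.
    have [A DA] := Dn.
    have sB : selfadj dot B.
      have : selfadj dot (B - A).
        apply: op_ge0_selfadj => [|v]; last by rewrite subr0; exact: DB.
        by apply: (vN_linear vM); apply: (vNB vM) => //; case: (DM _ DA).
      by move=> /selfadjD /(_ (sD _ DA)); rewrite subrK.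
    apply: ole_op_le => // v; apply: lubS => A' DA'.
    exact: (op_le_ole (DB _ DA')).
have : tau S <= c%:C%C.
  apply: lub => _ [A DA <-]; have [MA As] := DM _ DA.
  by rewrite (trace_segmentE MA As) lecR hc.
by rewrite lecE => /andP[].
Qed.

Lemma re_trace_comm A B : M A -> M B -> adjoint dot A B ->
  re_trace (B \o A) = re_trace (A \o B).
Proof. by move=> MA MB _; rewrite /re_trace trace_comm. Qed.

(** Only positivity is available: tau of (A + c) composed after with its adjoint is real, and c = 1
    and c = i give the two halves of the identity. *)
Lemma trace_adjoint A B : M A -> M B -> adjoint dot A B ->
  tau B = Num.conj (tau A).
Proof.
move=> MA MB AB.
have h c : complex.Im (c * tau B + Num.conj c * tau A) = 0.
  have Mc : M (c *: id) := vNZ vM c (vN_id vM).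
  have McJ : M (Num.conj c *: id) := vNZ vM _ (vN_id vM).
  have cJ : adjoint dot (c *: id) (Num.conj c *: id).
    by move=> v w; rewrite dotZl dotZr conjCK.
  have MAc := vND vM MA Mc; have MBc := vND vM MB McJ.
  have aAc : adjoint dot (A + c *: id) (B + Num.conj c *: id).
    by move=> v w; rewrite [LHS]dotDl [RHS]dotDr AB cJ.
  have := trace_ge0 MAc MBc aAc.
  have -> : (B + Num.conj c *: id) \o (A + c *: id) = B \o A +
      (c *: B + (Num.conj c *: A + (Num.conj c * c) *: id)).
    have lB := vN_linear vM MB.
    apply/funext => v; rewrite /= !fctE /= (linD lB) (linZ lB) scalerDr scalerA.
    by rewrite !addrA.
  have MI := vN_id vM.
  rewrite traceD; [|exact: (vN_comp vM)|do ?[apply: (vN_lin vM) => //]; exact: (vNZ vM)].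
  rewrite trace_lin//; last by apply: (vN_lin vM) => //; exact: (vNZ vM).
  rewrite trace_lin ?traceZ//; last exact: (vNZ vM).
  move=> /ger0_Im; have /ger0_Im := trace_ge0 MA MB AB.
  have : complex.Im (Num.conj c * c * tau id) = 0.
    by rewrite trace_id mulr1 mulrC mulJ_abs2.
  move: (tau _) (c * tau B) (Num.conj c * tau A) (_ * tau id).
  by move=> [? ?] [? ?] [? ?] [? ?] /= -> ->; rewrite add0r addr0.
have := h 1; have := h 'i%C; rewrite conj_iC rmorph1 !mul1r.
case: (tau A) (tau B) => a b [c d] /=.
rewrite !(mul0r, mul1r, mulN1r, mulNr, add0r, subr0, oppr0) => h1 h2.
by apply/eqP; rewrite eq_complex /=; apply/andP; split; apply/eqP; lra.
Qed.

(** The variance is nonnegative: positivity is applied to A - t with t the real part of tau(A). *)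
Lemma re_trace_CS A B : M A -> M B -> adjoint dot A B ->
  re_trace A ^+ 2 <= re_trace (B \o A).
Proof.
move=> MA MB AB; set t := re_trace A.
have MI := vN_id vM; have MtI := vNZ vM (- t)%:C%C MI.
have MAc := vND vM MA MtI; have MBc := vND vM MB MtI.
have aAc : adjoint dot (A + (- t)%:C%C *: id) (B + (- t)%:C%C *: id).
  by move=> v w; rewrite [LHS]dotDl [RHS]dotDr AB dotZl dotZr conj_realC.
have := ge0_Re (trace_ge0 MAc MBc aAc).
have -> : (B + (- t)%:C%C *: id) \o (A + (- t)%:C%C *: id) = B \o A +
    ((- t)%:C%C *: B + ((- t)%:C%C *: A + ((- t)%:C%C * (- t)%:C%C) *: id)).
  have lB := vN_linear vM MB.
  apply/funext => v; rewrite /= !fctE /= (linD lB) (linZ lB) scalerDr scalerA.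
  by rewrite !addrA.
rewrite traceD; [|exact: (vN_comp vM)|do ?[apply: (vN_lin vM) => //]; exact: (vNZ vM)].
rewrite trace_lin//; last by apply: (vN_lin vM) => //; exact: (vNZ vM).
rewrite trace_lin ?traceZ//; last exact: (vNZ vM).
rewrite (trace_adjoint MA MB AB) trace_id mulr1 -rmorphM/= !ReD !ReZ ReJ /=.
rewrite -/t -[complex.Re _]/(re_trace (B \o A)); nra.
Qed.

Lemma re_trace_faithful : faithful_state dot M tau ->
  forall A B, M A -> M B -> adjoint dot A B -> re_trace (B \o A) = 0 -> A = 0.
Proof.
move=> ftau A B MA MB AB h; apply: (ftau A B) => //.
by rewrite trace_gramE// h.
Qed.

End trace.
End states.

Section group_sums.
Context {R : realType} {G : groupType} {H : lmodType R[i]}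
  (dot : {dot H for Num.conj}) (pi : G -> H -> H).
Hypotheses (Hc : hilbert_complete dot) (pi_rep : unitary_representation dot pi).
Variable M : set (H -> H).
Hypotheses (vM : vN_algebra dot M) (Mpi : forall g, M (pi g)).
Variable tau : (H -> H) -> R[i].
Hypothesis tau_tr : tracial_state dot M tau.

Definition rep_sum (s : seq (R[i] * G)) : H -> H := \sum_(p <- s) p.1 *: pi p.2.

Definition rep_sumV (s : seq (R[i] * G)) : H -> H :=
  \sum_(p <- s) Num.conj p.1 *: pi p.2^-1%g.

Lemma rep_sumE s v : rep_sum s v = \sum_(p <- s) p.1 *: pi p.2 v.
Proof. by rewrite /rep_sum fct_sumE. Qed.

Lemma rep_sumVE s v : rep_sumV s v = \sum_(p <- s) Num.conj p.1 *: pi p.2^-1%g v.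
Proof. by rewrite /rep_sumV fct_sumE. Qed.

Lemma vN_sum (I : Type) (s : seq I) (F : I -> H -> H) :
  (forall i, M (F i)) -> M (\sum_(i <- s) F i).
Proof.
move=> MF; elim: s => [|i s IH]; first by rewrite big_nil; exact: (vN0 vM).
by rewrite big_cons; exact: (vND vM).
Qed.

Lemma trace_sum (I : Type) (s : seq I) (F : I -> H -> H) :
  (forall i, M (F i)) -> tau (\sum_(i <- s) F i) = \sum_(i <- s) tau (F i).
Proof.
move=> MF; elim: s => [|i s IH]; first by rewrite !big_nil (trace0 vM tau_tr).
by rewrite !big_cons (traceD tau_tr) ?IH//; exact: vN_sum.
Qed.

Lemma vN_rep_sum s : M (rep_sum s).
Proof. by apply: vN_sum => p; exact: (vNZ vM). Qed.

Lemma vN_rep_sumV s : M (rep_sumV s).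
Proof. by apply: vN_sum => p; exact: (vNZ vM). Qed.

Lemma rep_sum_adjoint s : adjoint dot (rep_sum s) (rep_sumV s).
Proof.
move=> v w; rewrite rep_sumE rep_sumVE dot_suml dot_sumr; apply: eq_bigr => p _.
by rewrite dotZl dotZr conjCK (rep_adjoint pi_rep).
Qed.

Lemma trace_rep_sum s :
  tau (rep_sumV s \o rep_sum s) = \sum_(p <- s) \sum_(q <- s)
    Num.conj p.1 * q.1 * tau (pi (p.2^-1 * q.2)%g).
Proof.
have -> : rep_sumV s \o rep_sum s = \sum_(p <- s) \sum_(q <- s)
    (Num.conj p.1 * q.1) *: pi (p.2^-1 * q.2)%g.
  apply/funext => v; rewrite /= rep_sumVE fct_sumE; apply: eq_bigr => p _.
  rewrite rep_sumE fct_sumE (lin_sum (rep_linear pi_rep _)) scaler_sumr.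
  apply: eq_bigr => q _; rewrite (linZ (rep_linear pi_rep _)) scalerA.
  by rewrite -(repM pi_rep).
have Mpq (p q : R[i] * G) : M ((Num.conj p.1 * q.1) *: pi (p.2^-1 * q.2)%g).
  exact: (vNZ vM).
rewrite trace_sum; last by move=> p; exact: vN_sum.
apply: eq_bigr => p _; rewrite trace_sum//; apply: eq_bigr => q _.
by rewrite (traceZ vM tau_tr).
Qed.

Lemma trace_rep_sum_delta (c : G -> R[i]) (A : {fset G}) :
  (forall g, tau (pi g) = (g == 1%g)%:R) ->
  let s := [seq (c g, g) | g <- A] in
  re_trace tau (rep_sumV s \o rep_sum s) = \sum_(g <- A) abs2 (c g).
Proof.
move=> tau_pi s; rewrite /re_trace trace_rep_sum big_map.
rewrite -[RHS]/(complex.Re (_%:C%C : R[i])) rmorph_sum/=; congr complex.Re.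
rewrite big_seq [RHS]big_seq; apply: eq_bigr => g gA.
rewrite big_map (big_fsetD1 g)//= mulVg tau_pi eqxx mulr1 mulrC mulJ_abs2.
rewrite big1_fset ?addr0// => h; rewrite !inE => /andP[hg _] _ /=.
by rewrite tau_pi mulg_eq1 (inj_eq (@invg_inj G)) eq_sym (negPf hg) mulr0.
Qed.

End group_sums.

Section regular_trace.
Context {R : realType} {G : groupType} {H : lmodType R[i]}
  (dot : {dot H for Num.conj}) (pi : G -> H -> H).
Hypotheses (Hc : hilbert_complete dot) (pi_rep : unitary_representation dot pi).
Local Notation M := (bicommutant dot (range pi)).
Local Notation dot2 := (@l2dot R G : {dot l2 R G for Num.conj}).
Local Notation lam := (@left_regular R G).
Variable tau : (H -> H) -> R[i].
Hypotheses (tau_tr : tracial_state dot M tau) (tau_f : faithful_state dot M tau)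
  (tau_n : normal_state dot M tau).
Hypothesis tau_pi : forall g, tau (pi g) = (g == 1%g)%:R.

Let vM := rep_vN_algebra pi_rep Hc.
Let Mpi := rep_bicommutant pi_rep.

(** The vector functional of v is at most C tau, so pi(g) |-> pi(g) v extends boundedly to the GNS
    space of tau. *)
Definition trace_bounded v := exists2 C : R, 0 <= C & forall A B,
  M A -> M B -> adjoint dot A B ->
  rdot dot (A v) (A v) <= C * re_trace tau (B \o A).

(** [dominated_approx] for the vector functional of v yields b such that b v is bounded, and |v - b
    v|^2 <= <(1 - b) v, v>. *)
Lemma trace_bounded_dense v e : 0 < e ->
  exists2 w, trace_bounded w & nrm dot (v - w) < e.
Proof.
move=> e0.
have [|b [C [Mb bs wb C0 Cb]]] := dominated_approx Hc vM
  (re_trace_positive vM tau_tr) (normal_state_chain_normal Hc vM tau_tr tau_n)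
  (re_trace_comm tau_tr) (re_trace_faithful tau_tr tau_f)
  (vector_functional_positive dot M v) (@vector_functional_normal _ _ _ M v)
  (e := (e / 2) ^+ 2); first by rewrite exprn_gt0// divr_gt0.
have [sb b0 b1] := bs; exists (b v).
  exists C => // A B MA MB AB; apply: le_trans (Cb A B MA MB AB).
  by rewrite /= (selfadj_rdotC _ _ sb) {2}/rdot (adj_sym AB).
apply: (@le_lt_trans _ _ (e / 2)); last by rewrite ltr_pdivrMr// ltr_pMr// ltr1n.
rewrite -(@ler_pXn2r _ 2) ?nnegrE ?nrm_ge0 ?divr_ge0 ?(ltW e0)//.
apply: le_trans _ wb; rewrite nrm2E.
exact: (segment_nrm2 v (segment_sub bs (segment_id dot) b1)).
Qed.

(** Test the bound on a = sum <u, pi g v> pi g over A. Then <u, a v> is the sum S itself, while |a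
    v|^2 <= C tau(a' a) = C S, with a' the adjoint of a; Cauchy-Schwarz gives S^2 <= |u|^2 C S. *)
Lemma coefficient_square_sum v C u (A : {fset G}) : 0 <= C ->
  (forall A B, M A -> M B -> adjoint dot A B ->
    rdot dot (A v) (A v) <= C * re_trace tau (B \o A)) ->
  \sum_(g <- A) abs2 (dot u (pi g v)) <= C * rdot dot u u.
Proof.
move=> C0 hC; set S := \sum_(g <- A) _.
pose s := [seq (dot u (pi g v), g) | g <- A].
have := hC _ _ (vN_rep_sum vM Mpi s) (vN_rep_sumV vM Mpi s)
  (rep_sum_adjoint pi_rep s).
rewrite (trace_rep_sum_delta pi_rep vM Mpi tau_tr _ _ tau_pi) -/S.
have -> : rep_sum pi s v = \sum_(g <- A) dot u (pi g v) *: pi g v.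
  by rewrite rep_sumE big_map.
set P := \sum_(g <- A) _ => h.
have uP : rdot dot u P = S.
  rewrite /rdot /P dot_sumr.
  have -> : S = complex.Re (S%:C%C : R[i]) by [].
  rewrite /S rmorph_sum/=; congr complex.Re; apply: eq_bigr => g _.
  by rewrite dotZr mulrC mulJ_abs2.
have S0 : 0 <= S by apply: sumr_ge0 => g _; exact: abs2_ge0.
have := rdot_CS2 dot u P; rewrite uP => h'.
have [->|Sn0] := eqVneq S 0; first by rewrite mulr_ge0// rdot_ge0.
have S1 : 0 < S by rewrite lt_def Sn0.
rewrite -(ler_pM2r S1) -expr2 (le_trans h')//.
rewrite (_ : C * _ * S = rdot dot u u * (C * S)); last by ring.
by rewrite ler_wpM2l ?rdot_ge0.
Qed.

(* The analysis operator of a bounded vector v, u |-> (<u, pi g v>)_g. *)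
Lemma trace_bounded_intertwiner v : trace_bounded v ->
  exists2 W, intertwiner dot dot2 pi lam W & forall u, W u 1%g = dot u v.
Proof.
move=> [C C0 hC].
have S u : (fun g => dot u (pi g v)) \in @square_summable R G.
  apply: square_summableP; exists (C * rdot dot u u) => A.
  exact: coefficient_square_sum.
exists (fun u => L2 (S u)); last by move=> u /=; rewrite (rep1 pi_rep).
split.
  split; first by move=> a x y; apply: l2_ext => g /=; rewrite dotDl dotZl.
  exists (Num.sqrt C) => [|u]; first exact: sqrtr_ge0.
  rewrite /nrm -sqrtrM// ler_wsqrtr//; apply: l2_le => A /=.
  exact: coefficient_square_sum.
move=> h x; apply: l2_ext => g /=.
by rewrite (rep_adjoint pi_rep) -(repM pi_rep).
Qed.

Lemma regular_trace_isomorphism : icc G -> extends_to_vN_isomorphism dot pi.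
Proof.
move=> iccG; have lam_rep := @left_regular_rep R G.
have l2c := @l2_complete R G.
(* The adjoint of the intertwiner attached to a bounded vector v maps delta_1 to v, so the ranges
   contain all bounded vectors, and these are dense. *)
have tot : total_intertwiners dot2 dot lam pi.
  move=> z hz.
  have bz v : trace_bounded v -> dot v z = 0.
    move=> /trace_bounded_intertwiner[W iW Wv].
    have [V iV WV] := intertwiner_adj Hc pi_rep lam_rep iW.
    have := hz V (l2delta 1%g) iV; rewrite dotC -WV l2dot_delta Wv -dotC.
    by [].
  apply: (@nrm_eq0 _ _ dot); apply/eqP; rewrite eq_le nrm_ge0 andbT.
  apply: ler_epsP => e e0; have [v bv zv] := trace_bounded_dense z e0.
  rewrite add0r leNgt; apply/negP => ez.
  have nz : 0 < nrm dot z := lt_trans e0 ez.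
  have := rdot_le dot (z - v) z; rewrite rdotBl {2}/rdot bz// subr0 -nrm2E.
  rewrite leNgt => /negP[]; rewrite expr2 ltr_pM2r//.
  exact: lt_trans zv ez.
(* tau(1) = 1 excludes the zero space. A nonzero bounded vector provides the single nonzero
   intertwiner from which [icc_total_intertwiners] starts. *)
have [v bv vn0] : exists2 v, trace_bounded v & v <> 0.
  apply: contrapT => h.
  have H0 (x : H) : x = 0.
    apply: (@nrm_eq0 _ _ dot); apply/eqP; rewrite eq_le nrm_ge0 andbT.
    apply: ler_epsP => e e0; have [v bv xv] := trace_bounded_dense x e0.
    have v0 : v = 0 by apply: contrapT => vn0; apply: h; exists v.
    by rewrite add0r -[x]subr0 -v0 ltW.
  have := trace_id tau_tr; have -> : id = 0 :> (H -> H) by apply/funext.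
  by rewrite (trace0 vM tau_tr) => /esym/eqP; rewrite oner_eq0.
have [W iW Wv] := trace_bounded_intertwiner bv.
have Wvn0 : W v <> 0.
  move=> /(congr1 (fun a : l2 R G => a 1%g)); rewrite Wv => /dot_eq0.
  exact: vn0.
have tot' := icc_total_intertwiners iccG iW Wvn0.
exact: (total_intertwiners_isomorphism l2c Hc lam_rep pi_rep tot tot').
Qed.

End regular_trace.

(** * Order and normality under isomorphisms *)

Section order_isomorphism.
Context {R : realType} {H K : lmodType R[i]} (dH : {dot H for Num.conj})
  (dK : {dot K for Num.conj}).
Hypothesis Hc : hilbert_complete dH.
Variables (M : set (H -> H)) (N : set (K -> K)) (phi : (H -> H) -> K -> K).
Hypotheses (vM : vN_algebra dH M) (vN : vN_algebra dK N)
  (iso : vN_isomorphism dH dK M N phi).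

Lemma iso_in A : M A -> N (phi A).
Proof. by case: iso => -[+ _ _] _ _ _; apply. Qed.

Lemma iso_lin c A B : M A -> M B -> phi (c *: A + B) = c *: phi A + phi B.
Proof. by case: iso => _ + _ _; apply. Qed.

Lemma iso_comp A B : M A -> M B -> phi (A \o B) = phi A \o phi B.
Proof. by case: iso => _ _ + _; apply. Qed.

Lemma iso_adj A B : M A -> M B -> adjoint dH A B -> adjoint dK (phi A) (phi B).
Proof. by case: iso => _ _ _; apply. Qed.

Lemma iso_inj A B : M A -> M B -> phi A = phi B -> A = B.
Proof. by case: iso => -[_ + _] _ _ _ MA MB; apply; exact: mem_set. Qed.

Lemma iso_surj T : N T -> exists2 A, M A & phi A = T.
Proof. by case: iso => -[_ _ +] _ _ _; apply. Qed.

Lemma iso0 : phi 0 = 0.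
Proof.
have := iso_lin (-1) (vN0 vM) (vN0 vM).
by rewrite scaler0 addr0 scaleN1r addNr.
Qed.

Lemma isoZ c A : M A -> phi (c *: A) = c *: phi A.
Proof.
by move=> MA; have := iso_lin c MA (vN0 vM); rewrite addr0 iso0 addr0.
Qed.

Lemma isoB A B : M A -> M B -> phi (A - B) = phi A - phi B.
Proof.
by move=> MA MB; rewrite addrC -scaleN1r iso_lin// scaleN1r addrC.
Qed.

Lemma iso_id : phi id = id.
Proof.
have [A MA EA] := iso_surj (vN_id vN).
have := iso_comp MA (vN_id vM); rewrite -[LHS]/(phi A) EA.
by move/esym.
Qed.

Lemma iso_selfadj A : M A -> selfadj dH A -> selfadj dK (phi A).
Proof.
move=> MA [_ aA]; split; first exact: (vN_linear vN (iso_in MA)).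
exact: iso_adj.
Qed.

(** Positivity is algebraic: up to a positive scalar A is the square of a self-adjoint c in M, and
    phi maps it to the square of phi c. *)
Lemma iso_ge0 A : M A -> selfadj dH A -> ole dH 0 A -> ole dK 0 (phi A).
Proof.
move=> MA sA A0; have [t t0 ts] := selfadj_scale_segment vM MA sA A0.
have [c [Mc [[_ ac] _ _] E]] := vN_sqrt Hc vM (vNZ vM _ MA) ts.
have h : phi (t%:C%C *: A) = phi c \o phi c by rewrite E iso_comp.
apply/ole0E => v; rewrite -(pmulr_rge0 _ t0) -rdotZl.
have -> : t%:C%C *: phi A v = phi c (phi c v).
  by rewrite -[LHS]/((t%:C%C *: phi A) v) -isoZ// h.
by rewrite (rdot_gram v (iso_adj Mc Mc ac)) rdot_ge0.
Qed.

Lemma iso_ole A B : M A -> M B -> selfadj dH A -> selfadj dH B ->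
  ole dH A B -> ole dK (phi A) (phi B).
Proof.
move=> MA MB sA sB AB; have MBA := vNB vM MB MA.
have : ole dK 0 (phi (B - A)).
  apply: iso_ge0 => //; first exact: selfadjB.
  by apply/ole0E => v; rewrite rdotBl subr_ge0.
by rewrite isoB// => /ole0E h v; have := h v; rewrite rdotBl subr_ge0.
Qed.

Lemma iso_segment A : M A -> segment dH id A -> segment dK id (phi A).
Proof.
move=> MA [sA A0 A1]; split; [exact: iso_selfadj|exact: iso_ge0|].
by rewrite -iso_id; apply: iso_ole => //; exact: (vN_id vM).
Qed.

Lemma iso_inverse : exists psi, vN_isomorphism dK dH N M psi /\
  forall A, M A -> psi (phi A) = A.
Proof.
have ex T : exists A, N T -> M A /\ phi A = T.
  have [/iso_surj[A MA AT]|nT] := pselect (N T); first by exists A.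
  by exists 0.
have [psi hpsi] := choice ex.
have Mpsi T : N T -> M (psi T) by move=> /hpsi[].
have phiK T : N T -> phi (psi T) = T by move=> /hpsi[].
have psiK A : M A -> psi (phi A) = A.
  by move=> MA; apply: iso_inj; rewrite ?phiK//; [apply: Mpsi|]; exact: iso_in.
exists psi; split=> //; split.
- split; first by move=> T /Mpsi.
    by move=> T T' /set_mem NT /set_mem NT' E; rewrite -(phiK T)// E phiK.
  by move=> A MA; exists (phi A); [exact: iso_in|exact: psiK].
- move=> c A B NA NB; apply: iso_inj; [|apply: (vN_lin vM)|]; try exact: Mpsi.
    by apply: Mpsi; exact: (vN_lin vN).
  rewrite phiK; last exact: (vN_lin vN).
  by rewrite iso_lin ?phiK//; exact: Mpsi.
- move=> A B NA NB; apply: iso_inj; [|apply: (vN_comp vM)|]; try exact: Mpsi.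
    by apply: Mpsi; exact: (vN_comp vN).
  rewrite phiK; last exact: (vN_comp vN).
  by rewrite iso_comp ?phiK//; exact: Mpsi.
- move=> A B NA NB AB; have [C MC AC] := vN_adj Hc vM (Mpsi _ NA).
  suff -> : psi B = C by [].
  apply: iso_inj => //; first exact: Mpsi.
  rewrite phiK//; apply/funext => v; apply: (@dotr_inj _ _ dK) => w.
  by rewrite -AB -(iso_adj (Mpsi _ NA) MC AC) phiK.
Qed.

End order_isomorphism.

Section pulled_back_trace.
Context {R : realType} {G : groupType} {H : lmodType R[i]}
  (dot : {dot H for Num.conj}) (pi : G -> H -> H).
Hypotheses (Hc : hilbert_complete dot) (pi_rep : unitary_representation dot pi).
Local Notation N := (bicommutant dot (range pi)).
Local Notation dot2 := (@l2dot R G : {dot l2 R G for Num.conj}).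
Variable phi : (H -> H) -> l2 R G -> l2 R G.
Hypotheses (iso : vN_isomorphism dot dot2 N (@group_vN_algebra R G) phi)
  (phi_pi : forall g, phi (pi g) = left_regular g).

Let vN := rep_vN_algebra pi_rep Hc.
Let vL := @group_vN_algebra_vN R G.
Let t0 A := canonical_trace (phi A).

Lemma pulled_back_trace_state : tracial_state dot N t0.
Proof.
split.
- by move=> c A B NA NB; rewrite /t0 (iso_lin iso).
- move=> A B NA NB AB; rewrite /t0 (iso_comp iso NB NA).
  rewrite canonical_trace_gram; first exact: dot_ge0.
  exact: (iso_adj iso).
- rewrite /t0 (iso_id vN vL iso) /canonical_trace /= eqxx; by [].
- move=> A B NA NB; rewrite /t0 (iso_comp iso NA NB) (iso_comp iso NB NA).
  by apply: canonical_trace_comm; exact: (iso_in iso).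
Qed.

Lemma pulled_back_trace_faithful : faithful_state dot N t0.
Proof.
move=> A B NA NB AB; rewrite /t0 (iso_comp iso NB NA) => h.
apply: (iso_inj iso) => //; first exact: (vN0 vN).
rewrite (iso0 vN iso); apply: canonical_trace_faithful h; try exact: (iso_in iso).
exact: (iso_adj iso).
Qed.

(** Since phi and its inverse preserve the order, phi S lies below the supremum S2 of the image
    chain. The trace is the vector functional at delta_1, and at that vector S2 is controlled by the
    members of the chain. *)
Lemma pulled_back_trace_normal : chain_normal dot N (re_trace t0).
Proof.
move=> D S [[Dtot Dn DN NS] [Ss ubS lubS]] c hc.
have [psi [iso' psiK]] := iso_inverse Hc vN vL iso.
have [sS _ _] := Ss.
have DL : phi @` D `<=` @group_vN_algebra R G `&` segment dot2 id.
  move=> _ [A /DN[NA As] <-]; split; first exact: (iso_in iso).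
  exact: (iso_segment Hc vN vL iso).
have [||S2 [[_ _ _ LS2] [S2s ub2 lub2]]] := vN_chain_sup (@l2_complete R G) vL _ _ DL.
- move=> _ _ [A DA <-] [B DB <-].
  have [[NA [sA _ _]] [NB [sB _ _]]] := (DN _ DA, DN _ DB).
  by have [AB|BA] := Dtot _ _ DA DB; [left|right]; apply: (iso_ole Hc vN iso).
- by case: Dn => A DA; exists (phi A), A.
have [sS2 _ _] := S2s.
have NS2 := iso_in iso' LS2.
have sP : selfadj dot (psi S2) := iso_selfadj vN iso' LS2 sS2.
have SS2 : ole dot S (psi S2).
  move=> v; apply: lubS => A DA; have [NA [sA _ _]] := DN _ DA.
  rewrite -{1}(psiK _ NA); move: v.
  apply: (iso_ole (@l2_complete R G) vL iso') => //.
  - exact: (iso_in iso).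
  - exact: (iso_selfadj vL iso).
  - by apply: ub2; exists A.
have : ole dot2 (phi S) S2.
  have [T NT TE] := iso_surj iso LS2.
  have E : phi (psi S2) = S2 by rewrite -TE psiK.
  by rewrite -E; apply: (iso_ole Hc vN iso).
move=> /(_ (l2delta 1%g)) h.
rewrite /re_trace /t0 canonical_traceE (le_trans h)//.
apply: lub2 => _ [A DA <-].
by have := hc _ DA; rewrite /re_trace /t0 canonical_traceE.
Qed.

Lemma pulled_back_trace_pi g : t0 (pi g) = (g == 1%g)%:R.
Proof. by rewrite /t0 phi_pi canonical_trace_left_regular. Qed.

(* Averages over many distinct conjugates of h are small for the canonical
   trace, hence, by domination, for any normal trace on a larger algebra. *)
Lemma icc_normal_trace_regular (M : set (H -> H)) (tau : (H -> H) -> R[i]) :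
  icc G -> vN_algebra dot M -> N `<=` M -> tracial_state dot M tau ->
  normal_state dot M tau -> forall h, h != 1%g -> tau (pi h) = 0.
Proof.
move=> iccG vM NM tau_tr tau_n h h1.
have tau_trN : tracial_state dot N tau.
  case: tau_tr => a1 a2 a3 a4; split=> //.
  - by move=> c A B /NM MA /NM MB; exact: a1.
  - by move=> A B /NM MA /NM MB; exact: a2.
  - by move=> A B /NM MA /NM MB; exact: a4.
have tau_nN : chain_normal dot N (re_trace tau).
  move=> D S [[Dtot Dn DN NS] sup]; apply: (normal_state_chain_normal Hc vM tau_tr tau_n).
  split=> //; split=> //; last exact: NM.
  by move=> A /DN[/NM MA As].
have wpos := re_trace_positive vN tau_trN.
have Npi := rep_bicommutant pi_rep.
have conj_tau g : tau (pi (h ^ g)%g) = tau (pi h).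
  rewrite conjgE.
  have -> : pi (g^-1 * (h * g))%g = pi g^-1%g \o pi (h * g)%g.
    by apply/funext => v /=; rewrite -(repM pi_rep).
  rewrite (trace_comm tau_trN)//; congr tau; apply/funext => v /=.
  by rewrite -(repM pi_rep) -mulgA mulgV mulg1.
(* z = 1 and z = i give the real part and minus the imaginary part of tau(pi h). *)
suff key (z : R[i]) : abs2 z = 1 -> complex.Re (z * tau (pi h)) = 0.
  apply: Re_eq; last by rewrite mulr0 key// /abs2 /= expr0n expr1n add0r.
  by have := key 1; rewrite mul1r; apply; rewrite /abs2 /= expr0n expr1n addr0.
move=> z1; set r := complex.Re _.
suff small d : 0 < d -> `|r| <= d *+ 2.
  apply/eqP; rewrite -normr_eq0 eq_le normr_ge0 andbT; apply: ler_epsP => e e0.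
  have e2 : 0 < e / 2 by rewrite divr_gt0.
  by have := small _ e2; rewrite mulr2n -splitr add0r.
move=> d0.
have [|b [C [Nb bs wb C0 Cb]]] := dominated_approx Hc vN
  (re_trace_positive vN pulled_back_trace_state) pulled_back_trace_normal
  (re_trace_comm pulled_back_trace_state)
  (re_trace_faithful pulled_back_trace_state pulled_back_trace_faithful)
  wpos tau_nN (e := d ^+ 2); first exact: exprn_gt0.
have [sb b0 b1] := bs; have [lb ab] := sb.
(* The average a over n distinct conjugates of h has canonical trace t0(a' a) = 1 / n, and n is
   taken large enough for C / n <= d^2. The successor keeps n positive. *)
have [A Aconj An] := infinite_set_fset (Num.bound (C / d ^+ 2)).+1 (iccG _ h1).
pose n := #|` A|.
have n0 : 0 < n%:R :> R by rewrite ltr0n (leq_trans _ An).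
have hn : n%:R^-1 *+ n = 1 :> R by rewrite -[LHS]mulr_natr mulVf// gt_eqF.
have Cn : C / n%:R <= d ^+ 2.
  rewrite ler_pdivrMr// mulrC -ler_pdivrMr ?exprn_gt0//.
  apply/ltW/(lt_le_trans (archi_boundP _)); first by rewrite divr_ge0// sqr_ge0.
  by rewrite ler_nat ltnW.
pose c (g : G) := (n%:R^-1)%:C%C * z.
pose s := [seq (c g, g) | g <- A].
pose a := rep_sum pi s; pose a' := rep_sumV pi s.
have Na : N a := vN_rep_sum vN Npi s.
have Na' : N a' := vN_rep_sumV vN Npi s.
have aa' : adjoint dot a a' := rep_sum_adjoint pi_rep s.
have [la la'] := (vN_linear vN Na, vN_linear vN Na').
have ta : re_trace t0 (a' \o a) = n%:R^-1.
  rewrite (trace_rep_sum_delta pi_rep vN Npi pulled_back_trace_state _ _ pulled_back_trace_pi).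
  rewrite (eq_bigr (fun=> abs2 (c 1%g)))// big_const_seq count_predT iter_addr_0.
  rewrite -/n; have -> : abs2 (c 1%g) = n%:R^-1 ^+ 2.
    rewrite /c; move: z1; rewrite /abs2; case: (z) => x y /= z1.
    by rewrite !mul0r subr0 addr0 !exprMn -mulrDr z1 mulr1.
  by rewrite expr2 -mulrnAl hn mul1r.
have wa : re_trace tau a = r.
  rewrite /re_trace /a /rep_sum (trace_sum vN tau_trN) /s ?big_map /=; last first.
    by move=> p; exact: (vNZ vN).
  rewrite big_seq (eq_bigr (fun=> (n%:R^-1)%:C%C * (z * tau (pi h)))).
    rewrite -big_seq big_const_seq count_predT iter_addr_0 -/n.
    by rewrite -mulrnAl -rmorphMn/= hn rmorph1 mul1r.
  move=> g /Aconj[k _ <-].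
  by rewrite (traceZ vN tau_trN)// conj_tau -mulrA.
(* tau(a b)^2 <= tau(b a' a b) <= C t0(a' a) = C / n, in real parts. *)
have ab_le : `|re_trace tau (a \o b)| <= d.
  rewrite -(@ler_pXn2r _ 2) ?nnegrE ?normr_ge0 ?(ltW d0)// real_normK ?num_real//.
  have h2 := re_trace_CS vN tau_trN (vN_comp vN Na Nb) (vN_comp vN Nb Na')
    (compress_adjoint sb aa').
  apply: (le_trans h2); apply: le_trans Cn; rewrite -ta.
  exact: Cb.
(* An average of unitaries is a contraction, so (1 - b) a' a (1 - b) <= (1 - b)^2 <= 1 - b, whose
   trace is at most d^2. *)
have ar_le : `|re_trace tau (a \o (id - b))| <= d.
  rewrite -(@ler_pXn2r _ 2) ?nnegrE ?normr_ge0 ?(ltW d0)// real_normK ?num_real//.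
  have Nr := vNB vN (vN_id vN) Nb.
  have rs : segment dot id (id - b) := segment_sub bs (segment_id dot) b1.
  have [sr r0 r1] := rs.
  have h2 := re_trace_CS vN tau_trN (vN_comp vN Na Nr) (vN_comp vN Nr Na')
    (compress_adjoint sr aa').
  apply: (le_trans h2); apply: le_trans wb.
  apply: (posfun_le Hc vN wpos) => //.
  - exact: (vN_comp vN (vN_comp vN Nr Na') (vN_comp vN Na Nr)).
  - apply: selfadj_gram; last exact: compress_adjoint.
      exact: (vN_linear vN (vN_comp vN Na Nr)).
    exact: (vN_linear vN (vN_comp vN Nr Na')).
  - move=> v; rewrite (rdot_gram v (compress_adjoint sr aa')).
    apply: le_trans (segment_nrm2 v rs); rewrite -!nrm2E.
    rewrite ler_pXn2r ?nnegrE ?nrm_ge0//=.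
    rewrite /a rep_sumE /s big_map.
    apply: (@le_trans _ _ (\sum_(g <- A) n%:R^-1 * nrm dot ((id - b) v))).
      elim: (enum_fset A) => [|g B IH]; first by rewrite !big_nil nrm0.
      rewrite !big_cons (le_trans (nrmD _ _ _))// lerD// nrmZC.
      rewrite (rep_nrm pi_rep) ler_wpM2r ?nrm_ge0//.
      rewrite /c; move: z1; rewrite /abs2; case: (z) => x y /= z1.
      rewrite !mul0r subr0 addr0 !exprMn -mulrDr z1 mulr1 sqrtr_sqr.
      by rewrite ger0_norm// invr_ge0.
    rewrite big_const_seq count_predT iter_addr_0 -/n -mulrnAl.
    by rewrite hn mul1r.
rewrite -wa.
have -> : a = (a \o b) + (a \o (id - b)).
  by apply/funext => v; rewrite !fctE /= (linB la) addrC subrK.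
rewrite (posfunD wpos).
- by rewrite (le_trans (ler_normD _ _))// mulr2n lerD.
- exact: (vN_comp vN).
- by apply: (vN_comp vN) => //; apply: (vNB vN) => //; exact: (vN_id vN).
Qed.

End pulled_back_trace.

(** * Kernels of positive maps *)

Section product_space.
Context {R : realType} (J : choiceType).

(** Functions with the topology of pointwise convergence, given the locally convex structure under
    which [coamenable] applies to sets of kernels. *)
Definition rspace := J -> R^o.

HB.instance Definition _ := Uniform.copy rspace (prod_topology (fun _ : J => R^o)).
HB.instance Definition _ := GRing.Lmodule.copy rspace (J -> R^o).
HB.instance Definition _ := isPointed.Build rspace 0.

Lemma cvg_rspace (F : set_system rspace) (x : rspace) : Filter F ->
  (forall j, (fun y : rspace => y j) @ F --> x j) -> F --> x.
Proof.
move=> FF h; apply/cvg_sup => j U.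
have /= -> := @nbhsE (initial_topology (fun f : J -> R^o => f j)) x.
case=> B [[C oC <-] Cx] /filterS; apply.
by apply: (h j C); apply: open_nbhs_nbhs.
Qed.

Lemma rspace_proj_continuous j : continuous (fun x : rspace => x j : R).
Proof. exact: (@proj_continuous J (fun=> R^o) j). Qed.

Lemma rspace_continuous (T : topologicalType) (f : T -> rspace) :
  (forall j, continuous (fun t => f t j : R)) -> continuous f.
Proof. by move=> h t; apply: cvg_rspace => j; exact: (h j t). Qed.

Let rspace_add_continuous : continuous (fun x : rspace * rspace => x.1 + x.2).
Proof.
apply: rspace_continuous => j [x y].
apply: (@cvgD R R^o _ _ _ (fun z : rspace * rspace => z.1 j) (fun z => z.2 j)).
  by apply: (@cvg_comp _ _ _ fst (fun y : rspace => y j : R) _ (nbhs x));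
    [exact: cvg_fst|exact: rspace_proj_continuous].
by apply: (@cvg_comp _ _ _ snd (fun y : rspace => y j : R) _ (nbhs y));
  [exact: cvg_snd|exact: rspace_proj_continuous].
Qed.

Let rspace_scale_continuous : continuous (fun z : R^o * rspace => z.1 *: z.2).
Proof.
apply: rspace_continuous => j [a y].
apply: (@cvgM R _ _ _ (fun z : R^o * rspace => z.1) (fun z => z.2 j)).
  exact: cvg_fst.
by apply: (@cvg_comp _ _ _ snd (fun y : rspace => y j : R) _ (nbhs y));
  [exact: cvg_snd|exact: rspace_proj_continuous].
Qed.

Definition rbox (x : rspace) (D : seq J) (e : R) : set rspace :=
  [set y | forall j, j \in D -> `|y j - x j| < e].

Lemma open_rbox x D e : open (rbox x D e).
Proof.
elim: D => [|j D IH].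
  by rewrite (_ : rbox _ _ _ = setT)//; [exact: openT|apply/seteqP; split].
have -> : rbox x (j :: D) e = [set y | `|y j - x j| < e] `&` rbox x D e.
  apply/seteqP; split=> y.
    by move=> h; split=> [|i iD]; apply: h; rewrite inE ?eqxx ?iD ?orbT.
  by case=> h1 h2 i; rewrite inE => /orP[/eqP->//|]; exact: h2.
apply: openI => //; apply: (@open_comp _ _ (fun y : rspace => y j : R) [set z | `|z - x j| < e]).
  by move=> y _; exact: rspace_proj_continuous.
by under eq_set do rewrite distrC; have := @ball_open R R^o (x j) e; rewrite -ball_normE.
Qed.

Lemma convex_rbox x D e : convex_set (rbox x D e).
Proof.
apply/convex_setW => y z; rewrite !inE => hy hz l l0 l1; rewrite inE => j jD.
rewrite (_ : _ - _ = l%:num * (y j - x j) + (1 - l%:num) * (z j - x j)); last first.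
  by rewrite [X in X - _](_ : _ = l%:num * y j + (1 - l%:num) * z j)//; ring.
have := hy j jD; have := hz j jD.
have l0' : 0 <= 1 - l%:num by rewrite subr_ge0 ltW.
move=> hz' hy'; apply: (le_lt_trans (ler_normD _ _)); rewrite !normrM.
rewrite (ger0_norm (ltW l0)) (ger0_norm l0').
rewrite [ltRHS](_ : e = l%:num * e + (1 - l%:num) * e); last by ring.
by rewrite ltr_leD ?ltr_pM2l ?ler_wpM2l// ltW.
Qed.

Let rspace_locally_convex :
  exists2 B : set_system rspace, (forall b, b \in B -> convex_set b) & basis B.
Proof.
exists [set B | exists x D e, B = rbox x D e].
  by move=> B; rewrite inE => -[x [D [e ->]]]; exact: convex_rbox.
split; first by move=> B [x [D [e ->]]]; exact: open_rbox.
move=> x V Vx.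
pose F : set_system rspace := filter_from [set De : seq J * R | 0 < De.2] (fun De => rbox x De.1 De.2).
have FF : Filter F.
  apply: filter_from_filter; first by exists ([::], 1) => /=.
  move=> [D e] [D' e'] /= e0 e'0; exists (D ++ D', Num.min e e') => /=.
    by rewrite lt_min e0.
  move=> y h; split=> j jD.
    by have := h j; rewrite mem_cat jD lt_min => /(_ isT)/andP[].
  by have := h j; rewrite mem_cat jD orbT lt_min => /(_ isT)/andP[].
have /(_ V Vx)[[D e] /= e0 DV] : F --> x.
  apply: cvg_rspace => j; apply/cvgrPdist_lt => e e0.
  exists ([:: j], e) => //= y h /=; rewrite distrC; apply: h.
  by rewrite inE.
exists (rbox x D e) => //; split; first by exists x, D, e.
by move=> j _; rewrite subrr normr0.
Qed.

HB.instance Definition _ := PreTopologicalNmodule_isTopologicalNmodule.Build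
  rspace rspace_add_continuous.
HB.instance Definition _ := TopologicalNmodule_isTopologicalLmodule.Build
  R rspace rspace_scale_continuous.
HB.instance Definition _ := Uniform_isTvs.Build R rspace rspace_locally_convex.

Lemma rspace_hausdorff : hausdorff_space rspace.
Proof. by apply: (@hausdorff_product J (fun=> R^o)) => _; exact: norm_hausdorff. Qed.

Lemma compact_rspace (B : J -> R) : compact [set x : rspace | forall j, `|x j| <= B j].
Proof.
apply: (@tychonoff J (fun=> R^o) (fun j => [set y : R | `|y| <= B j])) => j.
rewrite (_ : [set y | _] = `[- B j, B j]%classic); first exact: segment_compact.
by apply/seteqP; split=> y /=; rewrite in_itv/= ler_norml.
Qed.

End product_space.

Section real_sums.
Context {R : realType} {T : choiceType}.
Implicit Types (f g : T -> R) (A B : {fset T}).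

Definition rsum f : R := complex.Re (usum (fun t => (f t)%:C%C)).

Definition rsummable f := exists M, forall A, \sum_(t <- A) `|f t| <= M.

Lemma has_sum_rsum f : rsummable f -> has_sum (fun t => (f t)%:C%C) (rsum f)%:C%C.
Proof.
move=> [M fM]; have [|s hs] := @norm_has_sum R T (fun t => (f t)%:C%C) (M%:C)%C.
  move=> A; under eq_bigr do rewrite normc_def/= expr0n/= addr0 sqrtr_sqr.
  by rewrite -rmorph_sum lecR.
have sJ : s^* = s.
  have := has_sumJ hs; under eq_fun do rewrite conj_Creal ?complex_real//.
  by move=> /usumE <-; rewrite (usumE hs).
rewrite /rsum (usumE hs).
by have -> : (complex.Re s)%:C%C = s by rewrite RRe_real//; apply/CrealP.
Qed.

Lemma rsum_approx f e : rsummable f -> 0 < e -> exists A, forall B,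
  (A `<=` B)%fset -> `|\sum_(t <- B) f t - rsum f| < e.
Proof.
move=> /has_sum_rsum h e0; have [|A hA] := h e%:C%C; first by rewrite ltcR.
exists A => B /hA; rewrite -rmorph_sum -rmorphB/=.
by rewrite normc_def/= expr0n/= addr0 sqrtr_sqr ltcR.
Qed.

Lemma eq_rsum f s : has_sum (fun t => (f t)%:C%C) s%:C%C -> rsum f = s.
Proof. by rewrite /rsum => /usumE ->. Qed.

Lemma rsummable_lin c f g : rsummable f -> rsummable g ->
  rsummable (fun t => c * f t + g t).
Proof.
move=> [M fM] [N gN]; exists (`|c| * M + N) => A.
apply: (@le_trans _ _ (\sum_(t <- A) (`|c| * `|f t| + `|g t|))).
  by apply: ler_sum => t _; rewrite -normrM ler_normD.
by rewrite big_split/= -mulr_sumr lerD// ler_wpM2l.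
Qed.

Lemma rsum_lin c f g : rsummable f -> rsummable g ->
  rsum (fun t => c * f t + g t) = c * rsum f + rsum g.
Proof.
move=> /has_sum_rsum hf /has_sum_rsum hg; apply: eq_rsum.
rewrite rmorphD rmorphM; have := has_sumD (has_sumZ c%:C%C hf) hg.
by congr has_sum; apply/funext => t; rewrite rmorphD rmorphM.
Qed.

Lemma rsummable0 : rsummable (fun=> 0).
Proof. by exists 0 => A; rewrite big1// => t _; rewrite normr0. Qed.

Lemma rsum0 : rsum (fun=> 0) = 0.
Proof.
by apply: eq_rsum => e e0; exists fset0 => B _; rewrite big1// subrr normr0.
Qed.

Lemma rsum_big (I : Type) (s : seq I) (c : I -> R) (F : I -> T -> R) :
  (forall i, rsummable (F i)) ->
  rsummable (fun t => \sum_(i <- s) c i * F i t) /\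
  rsum (fun t => \sum_(i <- s) c i * F i t) = \sum_(i <- s) c i * rsum (F i).
Proof.
move=> hF; elim: s => [|i s [IH1 IH2]].
  under eq_fun do rewrite big_nil.
  by rewrite big_nil; split; [exact: rsummable0|exact: rsum0].
under eq_fun do rewrite big_cons; rewrite big_cons; split.
  exact: rsummable_lin.
by rewrite rsum_lin// IH2.
Qed.

Lemma rsum_ge f A : rsummable f -> (forall t, 0 <= f t) -> \sum_(t <- A) f t <= rsum f.
Proof.
move=> hf f0; apply: ler_epsP => e e0; have [B hB] := rsum_approx hf e0.
have := hB (A `|` B)%fset (fsubsetUr _ _); rewrite ltr_distlC => /andP[h _].
rewrite -lerBlDr; apply/ltW/(le_lt_trans _ h); rewrite lerD2r.
rewrite (big_fsetID _ (fun t => t \in A) (A `|` B)%fset)/=.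
rewrite (_ : [fset t in (A `|` B) | t \in A]%fset = A); first by rewrite lerDl sumr_ge0.
by apply/fsetP => t; rewrite !inE/= andbC; apply: andb_idr => ->.
Qed.

Lemma rsum_ge0 f : rsummable f -> (forall t, 0 <= f t) -> 0 <= rsum f.
Proof. by move=> hf f0; have := rsum_ge fset0 hf f0; rewrite big_seq_fset0. Qed.

Lemma rsum_le f M : rsummable f -> (forall A, \sum_(t <- A) f t <= M) -> rsum f <= M.
Proof.
move=> hf fM; apply: ler_epsP => e e0; have [B hB] := rsum_approx hf e0.
have := hB B (fsubset_refl _); rewrite ltr_distlC => /andP[_ h].
by apply: (le_trans (ltW h)); rewrite lerD2r.
Qed.

End real_sums.

(** * Positive semidefinite real kernels *)

Section quadratic_forms.
Context {R : realType} {Y : Type}.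
Implicit Types (r : Y -> Y -> R) (c d : seq (R * Y)).

Definition bform r c d := \sum_(p <- c) \sum_(q <- d) p.1 * q.1 * r p.2 q.2.

Definition psd r := forall c, 0 <= bform r c c.

Definition symmetric_kernel r := forall y z, r y z = r z y.

Lemma bformC r c d : symmetric_kernel r -> bform r c d = bform r d c.
Proof.
move=> rC; rewrite /bform exchange_big/=; apply: eq_bigr => p _.
by apply: eq_bigr => q _; rewrite rC [p.1 * _]mulrC.
Qed.

Lemma bform_catl r c c' d : bform r (c ++ c') d = bform r c d + bform r c' d.
Proof. by rewrite /bform big_cat. Qed.

Lemma bform_catr r c d d' : bform r c (d ++ d') = bform r c d + bform r c d'.
Proof. by rewrite /bform -big_split; apply: eq_bigr => p _; rewrite big_cat. Qed.

Lemma bform_lin a r r' c d :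
  bform (fun y z => a * r y z + r' y z) c d = a * bform r c d + bform r' c d.
Proof.
rewrite /bform mulr_sumr -big_split; apply: eq_bigr => p _.
rewrite mulr_sumr -big_split; apply: eq_bigr => q _ /=; ring.
Qed.

Lemma psd_lin a r r' : 0 <= a -> psd r -> psd r' -> psd (fun y z => a * r y z + r' y z).
Proof. by move=> a0 r0 r'0 c; rewrite bform_lin addr_ge0 ?mulr_ge0. Qed.

Lemma psdZ a r : 0 <= a -> psd r -> psd (fun y z => a * r y z).
Proof.
move=> a0 r0 c; rewrite (_ : bform _ c c = a * bform r c c) ?mulr_ge0//.
rewrite /bform mulr_sumr; apply: eq_bigr => p _.
rewrite mulr_sumr; apply: eq_bigr => q _; ring.
Qed.

Lemma eq_bform r r' c d : (forall y z, r y z = r' y z) -> bform r c d = bform r' c d.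
Proof. by move=> rr; apply: eq_bigr => p _; apply: eq_bigr => q _; rewrite rr. Qed.

Lemma bform_map r (u : Y -> Y) c d :
  bform (fun y z => r (u y) (u z)) c d =
  bform r [seq (p.1, u p.2) | p <- c] [seq (p.1, u p.2) | p <- d].
Proof. by rewrite /bform big_map; apply: eq_bigr => p _; rewrite big_map. Qed.

Lemma bform1 r y : bform r [:: (1, y)] [:: (1, y)] = r y y.
Proof. by rewrite /bform !big_seq1 !mul1r. Qed.

Lemma psd_diag_ge0 r y : psd r -> 0 <= r y y.
Proof. by move=> /(_ [:: (1, y)]); rewrite bform1. Qed.

(** Positivity at t y + z and t y - z. This weighted Cauchy-Schwarz is used with r z z of order t^2,
    which makes r y z of order t. *)
Lemma psd_amgm r t y z : psd r -> symmetric_kernel r -> 0 <= t ->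
  2 * t * `|r y z| <= t ^+ 2 * r y y + r z z.
Proof.
move=> r0 rC t0; have E a : bform r [:: (t, y); (a, z)] [:: (t, y); (a, z)] =
    t ^+ 2 * r y y + 2 * t * a * r y z + a ^+ 2 * r z z.
  by rewrite /bform !big_cons !big_nil/= [r z y]rC; ring.
have := r0 [:: (t, y); (1, z)]; have := r0 [:: (t, y); (- 1, z)].
rewrite !E sqrrN expr1n !mul1r mulr1 mulrN1 mulNr => h1 h2.
have [?|?] := ger0P (r y z).
  by rewrite -subr_ge0 (le_trans h1)// le_eqVlt; apply/orP; left; apply/eqP; ring.
by rewrite -subr_ge0 (le_trans h2)// le_eqVlt; apply/orP; left; apply/eqP; ring.
Qed.

Lemma psd_diag0 r : psd r -> symmetric_kernel r -> (forall y, r y y = 0) ->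
  forall y z, r y z = 0.
Proof.
move=> r0 rC rd y z; have := @psd_amgm _ 1 y z r0 rC ler01.
rewrite !rd mulr0 addr0 mulr1 pmulr_rle0// => h.
by apply/eqP; rewrite -normr_le0.
Qed.

(* Orthonormality turns r <= kappa into Bessel's inequality. *)
Lemma psd_bessel (I : choiceType) (e : I -> Y) (kappa r : Y -> Y -> R) c (A : {fset I}) :
  psd r -> symmetric_kernel r -> psd (fun y z => kappa y z - r y z) ->
  (forall i j, kappa (e i) (e j) = (i == j)%:R) ->
  \sum_(i <- A) (\sum_(p <- c) p.1 * r p.2 (e i)) ^+ 2 <= bform r c c.
Proof.
move=> r0 rC kr kE; pose a i := \sum_(p <- c) p.1 * r p.2 (e i).
(* c + d is c minus its Bessel projection; positivity of r at c + d, with r <= kappa on d, gives the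
   bound. *)
pose d := [seq (- a i, e i) | i <- A].
have cross : bform r c d = - \sum_(i <- A) a i ^+ 2.
  rewrite /bform exchange_big big_map -sumrN; apply: eq_bigr => i _ /=.
  rewrite expr2 -mulNr {3}/a mulr_sumr; apply: eq_bigr => p _; ring.
have diag : bform kappa d d = \sum_(i <- A) a i ^+ 2.
  rewrite /bform big_map; apply: eq_big_seq => i iA; rewrite big_map/=.
  rewrite (big_fsetD1 i)//= kE eqxx mulr1 big_seq big1 ?addr0; first by rewrite mulrNN expr2.
  by move=> j; rewrite !inE kE eq_sym => /andP[/negbTE-> _]; rewrite mulr0.
have := r0 (c ++ d); rewrite bform_catl !bform_catr [bform r d c]bformC// cross.
have := kr d; rewrite (@eq_bform _ (fun y z => -1 * r y z + kappa y z)); last first.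
  by move=> y z; rewrite mulN1r addrC.
rewrite bform_lin diag; move: (\sum_(i <- A) _) (bform r d d) (bform r c c) => *.
lra.
Qed.

End quadratic_forms.

Section closed_sets.
Context {R : realType} {T : topologicalType}.

Lemma closed_forall (I : Type) (P : I -> set T) : (forall i, closed (P i)) ->
  closed [set x | forall i, P i x].
Proof.
move=> cP; rewrite (_ : [set x | _] = \bigcap_i P i).
  by apply: closed_bigI => i _; exact: cP.
by apply/seteqP; split=> x h; [move=> i _; exact: h|move=> i; exact: h].
Qed.

Lemma closed_imp (A : Prop) (P : set T) : closed P -> closed [set x | A -> P x].
Proof.
move=> cP; have [a|na] := pselect A.
  by rewrite (_ : [set x | _] = P)//; apply/seteqP; split=> x /=; [move=> /(_ a)|move=> Px _].
by rewrite (_ : [set x | _] = setT); [exact: closedT|apply/seteqP; split=> x // _ /na].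
Qed.

Lemma continuous_lin a (f g : T -> R) : continuous f -> continuous g ->
  continuous (fun x => a * f x + g x).
Proof.
by move=> cf cg x; apply: cvgD; [apply: cvgM; [exact: cvg_cst|exact: cf]|exact: cg].
Qed.

Lemma closed_eq_real (f g : T -> R) : continuous f -> continuous g ->
  closed [set x | f x = g x].
Proof.
move=> cf cg; rewrite (_ : [set x | _] = (f \- g) @^-1` [set 0]).
  apply: closed_comp; last exact: closed_eq.
  by move=> x _; apply: cvgB; [exact: cf|exact: cg].
by apply/seteqP; split=> x /= => [->|/subr0_eq]; rewrite ?subrr.
Qed.

Lemma closed_ge0_real (f : T -> R) : continuous f -> closed [set x | 0 <= f x].
Proof.
move=> cf; apply: (@closed_comp _ _ f [set y | 0 <= y]); last exact: closed_ge.
by move=> x _; exact: cf.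
Qed.

Lemma continuous_sum (I : Type) (s : seq I) (F : I -> T -> R) :
  (forall i, continuous (F i)) -> continuous (fun x => \sum_(i <- s) F i x).
Proof.
move=> cF; elim: s => [|i s IH].
  by under [X in continuous X]eq_fun do rewrite big_nil; move=> x; exact: cvg_cst.
under [X in continuous X]eq_fun do rewrite big_cons.
by move=> x; apply: cvgD; [exact: cF|exact: IH].
Qed.

Lemma continuous_bform (Y : Type) (r : T -> Y -> Y -> R) c d :
  (forall y z, continuous (fun x => r x y z)) -> continuous (fun x => bform (r x) c d).
Proof.
move=> cr; apply: continuous_sum => p; apply: continuous_sum => q x.
by apply: cvgM; [exact: cvg_cst|exact: cr].
Qed.

End closed_sets.

Section kernels.
Context {R : realType} {G : groupType} {Y : choiceType} (yact : G -> Y -> Y).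
Hypotheses (yact1 : forall y, yact 1%g y = y)
  (yactM : forall s t y, yact (s * t)%g y = yact s (yact t y)).
Local Notation J := ((G -> R) * Y * Y)%type.
Local Notation E := (@rspace R J).
Implicit Types (f : G -> R) (k : E) (y z : Y) (s t : G).

Definition bounded_real f := exists M, forall g, `|f g| <= M.

(* The kernels of positive maps from bounded functions on G to operators; the
   value 0 at unbounded f keeps the set of kernels compact. *)
Definition operator_kernel k :=
  [/\ forall f y z, ~ bounded_real f -> k (f, y, z) = 0,
      forall a f f' y z, bounded_real f -> bounded_real f' ->
        k (fun g => a * f g + f' g, y, z) = a * k (f, y, z) + k (f', y, z),
      forall f, symmetric_kernel (fun y z => k (f, y, z)) &
      forall f, bounded_real f -> (forall g, 0 <= f g) ->
        psd (fun y z => k (f, y, z))].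

Definition kernel_unit k y z := k (fun=> 1, y, z).

(** Conjugation: if U_s is the unitary moving y to s y, this is f |-> U_s k(f(s .)) U_s^-1. Its
    fixed points are the equivariant maps. *)
Definition kact s k : E :=
  fun j => k (fun g => j.1.1 (s * g)%g, yact s^-1 j.1.2, yact s^-1 j.2).

Lemma bounded_real_cst (a : R) : bounded_real (fun=> a).
Proof. by exists `|a|. Qed.

Lemma bounded_real_shift s f : bounded_real f -> bounded_real (fun g => f (s * g)%g).
Proof. by move=> [M fM]; exists M => g; exact: fM. Qed.

Lemma bounded_real_lin a f f' : bounded_real f -> bounded_real f' ->
  bounded_real (fun g => a * f g + f' g).
Proof.
move=> [M fM] [N f'N]; exists (`|a| * M + N) => g.
by rewrite (le_trans (ler_normD _ _))// normrM lerD// ler_wpM2l.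
Qed.

Lemma operator_kernel_comb (a b : R) k k' : 0 <= a -> 0 <= b ->
  operator_kernel k -> operator_kernel k' -> operator_kernel (a *: k + b *: k').
Proof.
have combE j : (a *: k + b *: k') j = a * k j + b * k' j by [].
move=> a0 b0 [k1 k2 k3 k4] [k'1 k'2 k'3 k'4]; split.
- by move=> f y z nf; rewrite combE k1// k'1// !mulr0 addr0.
- by move=> c f f' y z bf bf'; rewrite !combE k2// k'2//; ring.
- by move=> f y z; rewrite !combE k3 k'3.
- by move=> f bf f0; apply: psd_lin => //; [exact: k4|apply: psdZ => //; exact: k'4].
Qed.


Variable kappa : Y -> Y -> R.
Hypothesis kappa1 : forall y, kappa y y = 1.

Lemma kernel0 k y z : operator_kernel k -> k (fun=> 0, y, z) = 0.
Proof.
move=> [_ /(_ 1 (fun=> 0) (fun=> 0) y z (bounded_real_cst 0) (bounded_real_cst 0)) + _ _].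
under eq_fun do rewrite mulr0 addr0.
by rewrite mul1r => /eqP; rewrite eq_sym -subr_eq0 addrK => /eqP.
Qed.

Lemma kernel_cst k a y z : operator_kernel k ->
  k (fun=> a, y, z) = a * kernel_unit k y z.
Proof.
move=> hk; have [_ + _ _] := hk.
move=> k2; rewrite [X in k (X, _, _)](_ : _ = fun=> a * 1 + 0); last first.
  by apply/funext => g; rewrite mulr1 addr0.
by rewrite k2 ?kernel0 ?addr0//; exact: bounded_real_cst.
Qed.

(** k(f) is half the difference of the positive kernels k(M + f) and k(M - f), whose diagonal
    entries add up to 2 M k(1) <= 2 M. *)
Lemma operator_kernel_bound k f (M : R) y z : operator_kernel k ->
  psd (fun y z => kappa y z - kernel_unit k y z) -> (forall g, `|f g| <= M) ->
  `|k (f, y, z)| <= M.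
Proof.
move=> [k1 k2 k3 k4] kk fM; have M0 : 0 <= M by apply: le_trans (fM 1%g).
have bf : bounded_real f by exists M.
pose r (s : R) (y z : Y) : R := k (fun g => s * f g + M, y, z).
have rE (s : R) y' z' : r s y' z' = s * k (f, y', z') + M * kernel_unit k y' z'.
  by rewrite /r k2 ?kernel_cst//; exact: bounded_real_cst.
have rP (s : R) : s = 1 \/ s = -1 -> 2 * 1 * `|r s y z| <= 1 ^+ 2 * r s y y + r s z z.
  move=> s1; apply: psd_amgm => //; last by move=> ? ?; rewrite /r k3.
  apply: k4; first by apply: bounded_real_lin => //; exact: bounded_real_cst.
  move=> g; have := fM g; rewrite ler_norml => /andP[].
  by case: s1 => -> ? ?; rewrite ?mul1r ?mulN1r -lerBlDr sub0r// ?lerN2// -ler_oppr.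
have unit_le y' : kernel_unit k y' y' <= 1.
  by rewrite -(kappa1 y') -subr_ge0; exact: (psd_diag_ge0 y' kk).
have h1 := rP 1 (or_introl erefl); have h2 := rP (-1) (or_intror erefl).
have -> : k (f, y, z) = (r 1 y z - r (-1) y z) / 2 by rewrite !rE; field.
rewrite normrM [X in _ * X]ger0_norm ?invr_ge0// ler_pdivrMr//.
apply: (le_trans (ler_normB _ _)); move: h1 h2 (ler_wpM2l M0 (unit_le y)) (ler_wpM2l M0 (unit_le z)).
rewrite !(rE _ y y) !(rE _ z z); move: (`| _ |) (`| _ |) (k _) (k _) (M * _) (M * _); clear; move=> *; lra.
Qed.

Lemma closed_operator_kernel : closed [set k | operator_kernel k].
Proof.
have kc f y z : continuous (fun k : E => k (f, y, z) : R) by exact: rspace_proj_continuous.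
rewrite (_ : [set k | _] =
  [set k : E | forall f y z, ~ bounded_real f -> k (f, y, z) = 0] `&`
  [set k : E | forall a f f' y z, bounded_real f -> bounded_real f' ->
        k (fun g => a * f g + f' g, y, z) = a * k (f, y, z) + k (f', y, z)] `&`
  [set k : E | forall f, symmetric_kernel (fun y z => k (f, y, z))] `&`
  [set k : E | forall f, bounded_real f -> (forall g, 0 <= f g) ->
        psd (fun y z => k (f, y, z))]); last first.
  by apply/seteqP; split=> k; [case=> ? ? ? ?; split; [split; [split|]|]|case=> -[[? ?] ?] ?; split].
apply: closedI; first apply: closedI; first apply: closedI.
- do 3 apply: closed_forall => ?; apply: closed_imp; apply: closed_eq_real; first exact: kc.
  exact: cst_continuous.
- do 5 apply: closed_forall => ?; do 2 apply: closed_imp.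
  apply: closed_eq_real; first exact: kc.
  by apply: continuous_lin; exact: kc.
- by do 3 apply: closed_forall => ?; exact: closed_eq_real.
- apply: closed_forall => f; do 2 apply: closed_imp; apply: closed_forall => c.
  by apply: closed_ge0_real; apply: continuous_bform.
Qed.

End kernels.

Section kernel_sets.
Context {R : realType} {G : groupType} {Y : choiceType} (yact : G -> Y -> Y).
Hypotheses (yact1 : forall y, yact 1%g y = y)
  (yactM : forall s t y, yact (s * t)%g y = yact s (yact t y)).
Local Notation J := ((G -> R) * Y * Y)%type.
Local Notation E := (@rspace R J).
Local Notation kact := (@kact R G Y yact).
Implicit Types (f : G -> R) (k : E) (y z : Y) (s t : G).

Lemma operator_kernel_kact s k : operator_kernel k -> operator_kernel (kact s k).
Proof.
move=> [k1 k2 k3 k4]; split=> [f y z nf|a f f' y z bf bf'|f y z|f bf f0 c].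
- apply: k1 => bf; apply: nf; have := bounded_real_shift s^-1 bf.
  by under eq_fun do rewrite /= mulVKg.
- by rewrite /kact k2//; exact: bounded_real_shift.
- exact: k3.
- rewrite (@bform_map _ _ (fun y z => k (fun g => f (s * g)%g, y, z)) (yact s^-1)).
  by apply: k4 => //; exact: bounded_real_shift.
Qed.

Lemma kact_continuous s : continuous (kact s).
Proof. by apply: rspace_continuous => j; exact: rspace_proj_continuous. Qed.

Lemma kact1 k : kact 1%g k = k.
Proof.
apply/funext => -[[f y] z]; rewrite /kact /= invg1 !yact1.
by congr (k (_, _, _)); apply/funext => g; rewrite mul1g.
Qed.

Lemma kactM s t k : kact (s * t)%g k = kact s (kact t k).
Proof.
apply/funext => -[[f y] z]; rewrite /kact /= invgM !yactM.
by congr (k (_, _, _)); apply/funext => g; rewrite mulgA.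
Qed.

Variable kappa : Y -> Y -> R.
Hypotheses (kappa1 : forall y, kappa y y = 1) (kappa_psd : psd kappa)
  (kappaC : symmetric_kernel kappa)
  (kappa_act : forall s y z, kappa (yact s y) (yact s z) = kappa y z).

Definition full_kernels : set E :=
  [set k | operator_kernel k /\ forall y z, kernel_unit k y z = kappa y z].

(** Asking only for k(1) <= kappa leaves room to enlarge k(1) by pieces supported on single orbits;
    equality is reached by maximising. *)
Definition invariant_kernels (S : pred G) : set E :=
  [set k | [/\ operator_kernel k, psd (fun y z => kappa y z - kernel_unit k y z) &
    forall s, s \in S -> forall j, kact s k j = k j]].

Let proj_cont (j : J) : continuous (fun k : E => k j : R).
Proof. exact: rspace_proj_continuous. Qed.

Lemma compact_dominated_kernels : compact [set k : E | operator_kernel k /\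
  psd (fun y z => kappa y z - kernel_unit k y z)].
Proof.
(* At an unbounded f the default 0 is the right bound, since an operator kernel vanishes there. *)
pose B (j : J) := xget 0 [set M : R | forall g, `|j.1.1 g| <= M].
apply: (subclosed_compact _ (compact_rspace (B := B))).
  apply: closedI; first exact: closed_operator_kernel.
  apply: closed_forall => c; apply: closed_ge0_real; apply: continuous_bform => y z.
  rewrite (_ : (fun k => _) = fun k : E => -1 * k (fun=> 1, y, z) + kappa y z).
    by apply: continuous_lin; [exact: proj_cont|exact: cst_continuous].
  by apply/funext => k; rewrite mulN1r addrC.
move=> k [hk kk] [[f y] z]; rewrite /B; case: xgetP => [M _ fM|nb].
  exact: (operator_kernel_bound kappa1 _ _ hk kk fM).
by have [-> //] := hk; rewrite ?normr0// => -[M /nb].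
Qed.

Lemma compact_full_kernels : compact full_kernels.
Proof.
apply: (subclosed_compact _ compact_dominated_kernels).
  apply: closedI; first exact: closed_operator_kernel.
  do 2 apply: closed_forall => ?; apply: closed_eq_real; first exact: proj_cont.
  exact: cst_continuous.
move=> k [hk kE]; split=> // c; rewrite (@eq_bform _ _ _ (fun y z => 0 * kappa y z)).
  exact: psdZ.
by move=> y z; rewrite kE subrr mul0r.
Qed.

Lemma compact_invariant_kernels S : compact (invariant_kernels S).
Proof.
apply: (subclosed_compact _ compact_dominated_kernels); last by move=> k [].
rewrite (_ : invariant_kernels S = [set k : E | operator_kernel k /\
    psd (fun y z => kappa y z - kernel_unit k y z)] `&`
    [set k | forall s, s \in S -> forall j, kact s k j = k j]).
  apply: closedI; first by apply: compact_closed; [exact: rspace_hausdorff|exact: compact_dominated_kernels].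
  apply: closed_forall => s; apply: closed_imp; apply: closed_forall => j.
  by apply: closed_eq_real; exact: proj_cont.
by apply/seteqP; split=> k; [case|case=> -[]].
Qed.

Local Open Scope convex_scope.
Lemma convex_full_kernels : convex_set full_kernels.
Proof.
apply/convex_setW => k k'; rewrite !inE => -[hk kE] [hk' k'E] l l0 l1; rewrite inE.
have E1 : k <| l |> k' = l%:num *: k + (1 - l%:num) *: k' by [].
split; first by rewrite E1; apply: operator_kernel_comb => //; rewrite ?subr_ge0 ltW.
move=> y z; rewrite /kernel_unit E1.
rewrite (_ : (_ + _) _ = l%:num * kernel_unit k y z + (1 - l%:num) * kernel_unit k' y z)//.
by rewrite kE k'E; ring.
Qed.

Lemma full_kernels_kact s k : full_kernels k -> full_kernels (kact s k).
Proof.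
move=> [hk kE]; split; first exact: operator_kernel_kact.
by move=> y z; rewrite -(kappa_act s^-1 y z) -kE.
Qed.

Lemma coamenable_invariant_kernel (S : pred G) : coamenable R S ->
  (exists2 k, full_kernels k & forall h, h \in S -> kact h k = k) ->
  exists2 k, full_kernels k & forall s, kact s k = k.
Proof.
move=> coam [k kF kS]; apply: (coam E full_kernels kact).
- exact: rspace_hausdorff.
- exact: compact_full_kernels.
- exact: convex_full_kernels.
- by exists k.
- split=> //.
  + by move=> s k'; exact: full_kernels_kact.
  + by move=> s; apply: continuous_subspaceT; exact: kact_continuous.
  + by move=> k' _; exact: kact1.
  + by move=> s t k' _; exact: kactM.
- by exists k.
Qed.

End kernel_sets.

(** * An invariant kernel from orthonormal orbits *)

Section orbit_kernel.
Context {R : realType} {G : groupType} {Y : choiceType} (yact : G -> Y -> Y).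
Hypotheses (yact1 : forall y, yact 1%g y = y)
  (yactM : forall s t y, yact (s * t)%g y = yact s (yact t y)).
Local Notation J := ((G -> R) * Y * Y)%type.
Local Notation E := (@rspace R J).
Local Notation kact := (@kact R G Y yact).
Context (S : pred G) (Lam : subGroupType S).
Implicit Types (f : G -> R) (k : E) (y z b : Y) (s t : G) (h : Lam).

Variable kappa : Y -> Y -> R.
Hypotheses (kappa_psd : psd kappa) (kappaC : symmetric_kernel kappa)
  (kappa_act : forall s y z, kappa (yact s y) (yact s z) = kappa y z)
  (kappa_orth : forall b h h',
    kappa (yact (val h) b) (yact (val h') b) = (h == h')%:R).

Section one_orbit.
Variables (r : Y -> Y -> R) (b : Y).
Hypotheses (r0 : psd r) (rC : symmetric_kernel r)
  (kr : psd (fun y z => kappa y z - r y z))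
  (r_act : forall s, s \in S -> forall y z, r (yact s y) (yact s z) = r y z).

Let e h := yact (val h) b.
Let coef (c : seq (R * Y)) h := \sum_(p <- c) p.1 * r p.2 (e h).

Let bessel c (A : {fset Lam}) : \sum_(h <- A) coef c h ^+ 2 <= bform r c c.
Proof. exact: psd_bessel r0 rC kr (kappa_orth b). Qed.

Lemma orbit_term_summable f y z : bounded_real f ->
  rsummable (fun h => f (val h) * (r y (e h) * r z (e h))).
Proof.
move=> [M fM]; exists (M * (r y y + r z z)) => A.
have M0 : 0 <= M by apply: le_trans (fM 1%g).
apply: (@le_trans _ _ (\sum_(h <- A) M * (coef [:: (1, y)] h ^+ 2 + coef [:: (1, z)] h ^+ 2))).
  apply: ler_sum => h _; rewrite /coef !big_seq1 !mul1r normrM ler_pM//.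
  rewrite normrM -[r y _ ^+ 2]real_normK ?num_real// -[r z _ ^+ 2]real_normK ?num_real//.
  have : 0 <= (`|r y (e h)| - `|r z (e h)|) ^+ 2 + `|r y (e h)| * `|r z (e h)|.
    by rewrite addr_ge0 ?sqr_ge0 ?mulr_ge0.
  by rewrite -subr_ge0; congr (_ <= _); ring.
rewrite -mulr_sumr ler_wpM2l// big_split lerD//.
  by have := bessel [:: (1, y)] A; rewrite bform1.
by have := bessel [:: (1, z)] A; rewrite bform1.
Qed.

(** Reading r as a positive contraction, this is f |-> r D_f r with D_f diagonal with entries f(h)
    along the orthonormal vectors e h. The outer factors r keep the value at 1 below r^2 <= r, which
    is [orbit_kernel_le]. Unbounded f get the value 0 required of an operator kernel. *)
Definition orbit_kernel : E := fun j => if `[< bounded_real j.1.1 >] then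
  rsum (fun h => j.1.1 (val h) * (r j.1.2 (e h) * r j.2 (e h))) else 0.

Lemma orbit_kernelE f y z : bounded_real f ->
  orbit_kernel (f, y, z) = rsum (fun h => f (val h) * (r y (e h) * r z (e h))).
Proof. by move=> bf; rewrite /orbit_kernel /= asboolT. Qed.

Lemma bform_orbit_kernel f c : bounded_real f ->
  rsummable (fun h => f (val h) * coef c h ^+ 2) /\
  bform (fun y z => orbit_kernel (f, y, z)) c c =
  rsum (fun h => f (val h) * coef c h ^+ 2).
Proof.
move=> bf; pose F (p q : R * Y) h := f (val h) * (r p.2 (e h) * r q.2 (e h)).
have sF p q : rsummable (F p q) by exact: orbit_term_summable.
have inner p := rsum_big c (fun q => p.1 * q.1) (sF p).
have [sum1 sum2] := rsum_big c (fun=> 1) (fun p => (inner p).1).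
have E1 : (fun h => \sum_(p <- c) 1 * \sum_(q <- c) p.1 * q.1 * F p q h) =
    fun h => f (val h) * coef c h ^+ 2.
  apply/funext => h; rewrite expr2 /coef mulr_suml mulr_sumr; apply: eq_bigr => p _.
  rewrite mul1r mulrCA mulr_sumr mulr_sumr; apply: eq_bigr => q _; rewrite /F; ring.
rewrite E1 in sum1 sum2; split=> //; rewrite sum2 /bform; apply: eq_bigr => p _.
rewrite mul1r (inner p).2; apply: eq_bigr => q _.
by rewrite orbit_kernelE.
Qed.

Lemma orbit_kernel_operator : operator_kernel orbit_kernel.
Proof.
split=> [f y z nf|a f f' y z bf bf'|f y z|f bf f0 c].
- by rewrite /orbit_kernel /= asboolF.
- rewrite !orbit_kernelE//; last exact: bounded_real_lin.
  rewrite -rsum_lin; try exact: orbit_term_summable.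
  by congr rsum; apply/funext => h; ring.
- rewrite /orbit_kernel /=; case: ifP => // _.
  by congr rsum; apply/funext => h; rewrite [r y _ * _]mulrC.
- have [sc ->] := bform_orbit_kernel c bf.
  by apply: rsum_ge0 => // h; rewrite mulr_ge0 ?sqr_ge0.
Qed.

Lemma orbit_kernel_le : psd (fun y z => r y z - kernel_unit orbit_kernel y z).
Proof.
move=> c; rewrite (@eq_bform _ _ _ (fun y z => -1 * kernel_unit orbit_kernel y z + r y z)).
  have [sc rc] := bform_orbit_kernel c (bounded_real_cst 1).
  rewrite bform_lin mulN1r addrC subr_ge0 rc; apply: rsum_le => // A.
  by under eq_bigr do rewrite mul1r; exact: bessel.
by move=> y z; rewrite mulN1r addrC.
Qed.

Lemma orbit_kernel_kact s : s \in S -> kact s orbit_kernel = orbit_kernel.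
Proof.
move=> sS; pose u : Lam := Sub s sS.
have uE : val u = s by exact: SubK.
have term y h : r (yact s^-1 y) (e h) = r y (e (u * h)%g).
  rewrite -(r_act sS) /e valM uE -!yactM; congr r.
  by rewrite mulgV yact1.
apply/funext => -[[f y] z]; rewrite /kact /=.
have [bf|nf] := pselect (bounded_real f); last first.
  have [k1 _ _ _] := orbit_kernel_operator; rewrite !k1// => bf; apply: nf.
  have := bounded_real_shift s^-1 bf; by under eq_fun do rewrite /= mulVKg.
rewrite !orbit_kernelE//; last exact: bounded_real_shift.
have := has_sum_rsum (orbit_term_summable y z bf).
move=> /(has_sum_reindex (mulKg u) (mulVKg u)) hs.
apply: eq_rsum; move: hs; congr has_sum; apply/funext => h /=.
by rewrite !term valM uE.
Qed.

(** The term at h = 1 is already r(b, b)^2. *)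
Lemma orbit_kernel_gt0 : 0 < r b b -> 0 < kernel_unit orbit_kernel b b.
Proof.
move=> rb; have [sc] := bform_orbit_kernel [:: (1, b)] (bounded_real_cst 1).
rewrite /kernel_unit bform1 => ->; apply: lt_le_trans (rsum_ge [fset 1%g]%fset sc _).
  rewrite big_seq_fset1 /coef big_seq1 !mul1r /e val1 yact1.
  by rewrite exprn_gt0.
by move=> h; rewrite mul1r sqr_ge0.
Qed.

End one_orbit.
Local Notation invariant_kernels := (invariant_kernels yact kappa S).

Let kappa1 y : kappa y y = 1.
Proof. by have := kappa_orth y 1%g 1%g; rewrite eqxx val1 yact1. Qed.

Lemma invariant_kernel_diag_le1 k y : invariant_kernels k -> kernel_unit k y y <= 1.
Proof.
by move=> [_ kk _]; rewrite -(kappa1 y) -subr_ge0; exact: (psd_diag_ge0 y kk).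
Qed.

(** Take for r the defect kappa - k(1). The orbit kernel of r at b has unit at most r, so adding it
    does not exceed kappa, and it raises the entry at b. *)
Lemma invariant_kernel_increase k b : invariant_kernels k -> kernel_unit k b b < 1 ->
  exists2 k', invariant_kernels k' & kernel_unit k b b < kernel_unit k' b b /\
    forall y, kernel_unit k y y <= kernel_unit k' y y.
Proof.
move=> [hk kk kS] kb; have [k1 k2 k3 k4] := hk.
pose r y z := kappa y z - kernel_unit k y z.
have rC : symmetric_kernel r by move=> y z; rewrite /r kappaC /kernel_unit k3.
have kr : psd (fun y z => kappa y z - r y z).
  move=> c; rewrite (@eq_bform _ _ _ (kernel_unit k)).
    by apply: k4 => //; exact: bounded_real_cst.
  by move=> y z; rewrite /r opprB addrC subrK.
have r_act s : s \in S -> forall y z, r (yact s y) (yact s z) = r y z.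
  move=> sS y z; rewrite /r kappa_act; congr (_ - _).
  have := kS s sS (fun=> 1, yact s y, yact s z); rewrite /kact /kernel_unit /= => <-.
  by rewrite -!yactM mulVg !yact1.
pose k' := orbit_kernel r b.
have k'E y z : kernel_unit (k + k') y z = kernel_unit k y z + kernel_unit k' y z by [].
have hk' : operator_kernel k' by exact: orbit_kernel_operator.
have k'_ge0 y : 0 <= kernel_unit k' y y.
  have [_ _ _ h4] := hk'.
  by apply: (@psd_diag_ge0 _ _ (kernel_unit k')); apply: h4 => //; exact: bounded_real_cst.
exists (k + k').
  split.
  - by have := operator_kernel_comb ler01 ler01 hk hk'; rewrite !scale1r.
  - move=> c; rewrite (@eq_bform _ _ _ (fun y z => r y z - kernel_unit k' y z)).
      exact: orbit_kernel_le.
    by move=> y z; rewrite k'E /r opprD addrA.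
  - move=> s sS j.
    rewrite (_ : kact s (k + k') j = kact s k j + kact s k' j)// kS//.
    by rewrite orbit_kernel_kact.
split; last by move=> y; rewrite k'E lerDl.
rewrite k'E ltrDl; apply: orbit_kernel_gt0 => //.
by rewrite /r kappa1 subr_gt0.
Qed.

(** By compactness some kernel maximises the sum of the diagonal entries over L; an entry below 1
    could still be increased without lowering the others. *)
Lemma invariant_kernel_full_on (L : seq Y) : exists2 k, invariant_kernels k &
  forall b, b \in L -> kernel_unit k b b = 1.
Proof.
have ne : invariant_kernels !=set0.
  exists 0; split=> //.
  - split=> // [a f f' y z _ _|f _ _ c]; first by rewrite mulr0 addr0.
    by rewrite /bform big1// => p _; rewrite big1// => q _; rewrite mulr0.
  - move=> c; rewrite (@eq_bform _ _ _ kappa)//.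
    by move=> y z; rewrite [X in _ - X](_ : _ = 0)// subr0.
have [|k] := compact_EVT_max (f := fun k : E => \sum_(b <- L) kernel_unit k b b)
    ne (@compact_invariant_kernels _ _ _ yact _ kappa1 S).
  apply: continuous_subspaceT; apply: continuous_sum => b.
  exact: rspace_proj_continuous.
rewrite inE => hk kmax; exists k => // b bL; apply/eqP.
rewrite eq_le invariant_kernel_diag_le1// leNgt; apply/negP => kb.
have [k' hk' [k'b k'_ge]] := invariant_kernel_increase hk kb.
have := kmax k'; rewrite inE => /(_ hk'); apply/negP; rewrite -ltNge.
rewrite (big_rem b)//= [ltRHS](big_rem b)//= ltr_leD//.
by apply: ler_sum => y _.
Qed.

(** Only finite sums of diagonal entries can be maximised, so the finite intersection property
    passes from finite lists to all of Y. The defect is then positive semidefinite with zero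
    diagonal, hence zero. *)
Lemma invariant_full_kernel (y0 : Y) : exists2 k, full_kernels kappa k &
  forall s, s \in S -> kact s k = k.
Proof.
have cK := @compact_invariant_kernels _ _ _ yact _ kappa1 S.
pose A b := invariant_kernels `&` [set k : E | kernel_unit k b b = 1].
have [||k hk] := (eq_ind _ (fun P : set E -> Prop => P invariant_kernels) cK _
  (@compact_In0 E)) Y setT A.
- exists (fun b => [set k : E | kernel_unit k b b = 1]) => // b _.
  by apply: closed_eq_real; [exact: rspace_proj_continuous|exact: cst_continuous].
- move=> D _; have [k hk kD] := invariant_kernel_full_on D.
  by exists k => b bD; split=> //; exact: kD.
have [[hk1 kk kS] _] := hk y0 I.
have kd y : kappa y y - kernel_unit k y y = 0.
  by have [_ /= ->] := hk y I; rewrite kappa1 subrr.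
have k0 := psd_diag0 kk _ kd; exists k; last by move=> s sS; apply/funext => j; exact: kS.
split=> // y z; apply/esym/eqP; rewrite -subr_eq0; apply/eqP/k0 => y' z'.
by have [_ _ k3 _] := hk1; rewrite kappaC /kernel_unit k3.
Qed.

End orbit_kernel.

(** * Positive functionals on continuous functions *)

Section positive_functionals_on_continuous_functions.
Context {R : realType} {X : ptopologicalType}.
Hypotheses (Xcompact : compact [set: X]) (Xhausdorff : hausdorff_space X).
Implicit Types (f g u : X -> R) (U V W : set X).

Lemma urysohn_function (A B : set X) : closed A -> closed B -> A `&` B = set0 ->
  exists u : X -> R, [/\ continuous u, forall x, 0 <= u x <= 1,
    forall x, A x -> u x = 0 & forall x, B x -> u x = 1].
Proof.
move=> cA cB AB; have nX := compact_normal Xhausdorff Xcompact.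
have sep : uniform_separator A B by exact: (normal_separatorP.1 nX).
exists (Urysohn A B); split.
- exact: Urysohn_continuous.
- by move=> x; have := @Urysohn_range X R A B _ (imageT _ x); rewrite /= in_itv.
- by move=> x Ax; apply: (@Urysohn_sub0 X R A B sep); exists x.
- by move=> x Bx; apply: (@Urysohn_sub1 X R A B sep); exists x.
Qed.

Definition continuous_functional (m : (X -> R) -> R) :=
  [/\ forall a f g, continuous f -> continuous g ->
        m (fun x => a * f x + g x) = a * m f + m g,
      forall f, continuous f -> (forall x, 0 <= f x) -> 0 <= m f &
      m (fun=> 1) = 1].

Variable m : (X -> R) -> R.
Hypothesis mP : continuous_functional m.

Lemma cst_cont (a : R) : continuous (fun _ : X => a).
Proof. by move=> x; exact: cvg_cst. Qed.

Lemma addr_cont f g : continuous f -> continuous g -> continuous (fun x => f x + g x).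
Proof. by move=> cf cg x; apply: cvgD; [exact: cf|exact: cg]. Qed.

Lemma mulr_cont f g : continuous f -> continuous g -> continuous (fun x => f x * g x).
Proof. by move=> cf cg x; apply: cvgM; [exact: cf|exact: cg]. Qed.

Lemma min_cont f g : continuous f -> continuous g ->
  continuous (fun x => Num.min (f x) (g x)).
Proof. by move=> cf cg x; apply: continuous_min; [exact: cf|exact: cg]. Qed.

Lemma max_cont f g : continuous f -> continuous g ->
  continuous (fun x => Num.max (f x) (g x)).
Proof. by move=> cf cg x; apply: continuous_max; [exact: cf|exact: cg]. Qed.

Lemma sub_cont f g : continuous f -> continuous g -> continuous (fun x => f x - g x).
Proof. by move=> cf cg x; apply: cvgB; [exact: cf|exact: cg]. Qed.

Lemma functionalD f g : continuous f -> continuous g ->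
  m (fun x => f x + g x) = m f + m g.
Proof.
case: mP => lin _ _ cf cg; have := lin 1 _ _ cf cg; rewrite mul1r => <-.
by congr m; apply/funext => x; rewrite mul1r.
Qed.

Lemma functional0 : m (fun=> 0) = 0.
Proof.
have c0 := @cst_cont 0; have := functionalD c0 c0.
under [in LHS]eq_fun do rewrite addr0.
by move=> /eqP; rewrite addrC -subr_eq subrr eq_sym => /eqP.
Qed.

Lemma functionalZ a f : continuous f -> m (fun x => a * f x) = a * m f.
Proof.
case: mP => lin _ _ cf; have := lin a _ _ cf (@cst_cont 0).
rewrite functional0 addr0 => <-.
by congr m; apply/funext => x; rewrite addr0.
Qed.

Lemma functional_cst a : m (fun=> a) = a.
Proof.
have := functionalZ a (@cst_cont 1); case: mP => _ _ ->; rewrite mulr1 => {2}<-.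
by congr m; apply/funext => x; rewrite mulr1.
Qed.

Lemma functional_le f g : continuous f -> continuous g ->
  (forall x, f x <= g x) -> m f <= m g.
Proof.
case: mP => _ pos _ cf cg fg.
have -> : g = fun x => (g x - f x) + f x by apply/funext => x; rewrite subrK.
rewrite functionalD//; last exact: sub_cont.
by rewrite lerDr pos//; [exact: sub_cont|move=> x; rewrite subr_ge0].
Qed.

Definition below U f :=
  [/\ continuous f, forall x, 0 <= f x <= 1 & forall x, ~ U x -> f x = 0].

(** The Riesz-Markov content of an open set. Competitors have to vanish off U, with no condition on
    their closed supports. *)
Definition content U : R := sup [set m f | f in below U].

Lemma below0 U : below U (fun=> 0).
Proof. by split=> //; [exact: cst_cont|move=> x; rewrite lexx ler01]. Qed.

Lemma below_le1 U f : below U f -> m f <= 1.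
Proof.
move=> [cf f01 _]; rewrite -[leRHS]functional_cst; apply: functional_le => //.
  exact: cst_cont.
by move=> x; case/andP: (f01 x).
Qed.

Lemma has_sup_content U : has_sup [set m f | f in below U].
Proof.
split; first by exists (m (fun=> 0)), (fun=> 0) => //; exact: below0.
by exists 1 => _ [f /below_le1 ? <-].
Qed.

Lemma content_ub U f : below U f -> m f <= content U.
Proof.
by move=> Uf; apply: sup_upper_bound; [exact: has_sup_content|exists f].
Qed.

Lemma content_le U a : (forall f, below U f -> m f <= a) -> content U <= a.
Proof.
move=> h; apply: ge_sup; first by case: (has_sup_content U).
by move=> _ [f Uf <-]; exact: h.
Qed.

Lemma content_adherent U e : 0 < e -> exists2 f, below U f & content U - e < m f.
Proof.
by move=> e0; have [_ [f Uf <-] h] := sup_adherent e0 (has_sup_content U); exists f.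
Qed.

Lemma content_ge0 U : 0 <= content U.
Proof. by rewrite -functional0; apply: content_ub; exact: below0. Qed.

Lemma le_content U V : U `<=` V -> content U <= content V.
Proof.
move=> UV; apply: content_le => f [cf f01 f0]; apply: content_ub; split=> // x nV.
by apply: f0 => /UV.
Qed.

Lemma content_setT : content setT = 1.
Proof.
apply/eqP; rewrite eq_le; apply/andP; split.
  by apply: content_le => f; exact: below_le1.
rewrite -[leLHS](functional_cst 1); apply: content_ub; split=> //.
  exact: cst_cont.
  by move=> x; rewrite ler01 lexx.
by move=> x /(_ I).
Qed.

Lemma content_set0 : content set0 = 0.
Proof.
apply/eqP; rewrite eq_le content_ge0 andbT; apply: content_le => f [_ _ f0].
have -> : f = fun=> 0 by apply/funext => x; exact: f0.
by rewrite functional0.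
Qed.

(** (f - e)^+ vanishes off the closed set where e <= f. It stands in for functions with compact
    support inside U and costs at most e in m. *)
Definition trunc e f : X -> R := fun x => Num.max (f x - e) 0.

Lemma trunc_cont e f : continuous f -> continuous (trunc e f).
Proof.
move=> cf; apply: max_cont; last exact: cst_cont.
by apply: sub_cont => //; exact: cst_cont.
Qed.

Lemma trunc_ge0 e f x : 0 <= trunc e f x.
Proof. by rewrite /trunc le_max lexx orbT. Qed.

Lemma trunc_le e f x : 0 <= e -> 0 <= f x -> trunc e f x <= f x.
Proof. by move=> e0 fx; rewrite /trunc ge_max fx andbT gerBl. Qed.

Lemma trunc_eq0 e f x : f x < e -> trunc e f x = 0.
Proof. by move=> fe; rewrite /trunc max_r// subr_le0 ltW. Qed.

Lemma functional_trunc e f : continuous f -> m f <= m (trunc e f) + e.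
Proof.
move=> cf; have ct := @trunc_cont e _ cf.
rewrite -[X in _ + X]functional_cst -functionalD//; last exact: cst_cont.
apply: functional_le => //; first by apply: addr_cont => //; exact: cst_cont.
by move=> x; rewrite -lerBlDr /trunc le_max lexx.
Qed.

Lemma closed_ge e f : continuous f -> closed [set x | e <= f x].
Proof.
move=> cf; apply: (closed_comp (f := f) (D := [set y | e <= y])).
  by move=> x _; exact: cf.
exact: closed_ge.
Qed.

Lemma open_gt e f : continuous f -> open [set x | e < f x].
Proof.
move=> cf; apply: (open_comp (f := f) (D := [set y | e < y])).
  by move=> x _; exact: cf.
exact: open_gt.
Qed.

(* A Urysohn function separating C \ U from C \ V splits f into two parts. *)
Lemma content_setU U V : open U -> open V ->
  content (U `|` V) <= content U + content V.
Proof.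
move=> oU oV; apply: content_le => f [cf f01 f0]; apply: ler_epsP => e e0.
have f0' x : 0 <= f x by case/andP: (f01 x).
have cC := @closed_ge e _ cf; set C := [set x | _] in cC.
have [||| u [cu u01 uU uV]] := @urysohn_function (C `&` ~` U) (C `&` ~` V).
- by apply: closedI => //; exact: open_closedC.
- by apply: closedI => //; exact: open_closedC.
- rewrite -subset0 => x [[Cx nU] [_ nV]].
  by move: Cx; rewrite /C /= f0 ?leNgt ?e0// => -[].
have ct := @trunc_cont e _ cf.
have ct1 : continuous (fun x => trunc e f x * u x) by exact: mulr_cont.
have ct2 : continuous (fun x => trunc e f x * (1 - u x)).
  by apply: mulr_cont => //; apply: sub_cont => //; exact: cst_cont.
have t01 x : 0 <= trunc e f x <= 1.
  rewrite trunc_ge0 (le_trans (trunc_le (ltW e0) (f0' x)))//.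
  by case/andP: (f01 x).
rewrite (le_trans (functional_trunc e cf))// lerD2r.
have -> : trunc e f = fun x => trunc e f x * u x + trunc e f x * (1 - u x).
  by apply/funext => x; rewrite -mulrDr addrC subrK mulr1.
have far W x : ~ (C `&` ~` W) x -> ~ W x -> trunc e f x = 0.
  move=> nC nW; apply: trunc_eq0; rewrite ltNge; apply/negP => fe.
  by apply: nC; split.
rewrite functionalD// lerD//; apply: content_ub; split=> //.
- move=> x; have /andP[t0 t1] := t01 x; have /andP[u0 u1] := u01 x.
  by rewrite mulr_ge0//= mulr_ile1.
- move=> x nU; have [Cx|nC] := pselect ((C `&` ~` U) x).
    by rewrite uU// mulr0.
  by rewrite (far U)// mul0r.
- move=> x; have /andP[t0 t1] := t01 x; have /andP[u0 u1] := u01 x.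
  by rewrite mulr_ge0 ?subr_ge0//= mulr_ile1 ?subr_ge0// gerBl.
- move=> x nV; have [Cx|nC] := pselect ((C `&` ~` V) x).
    by rewrite uV// subrr mulr0.
  by rewrite (far V)// mul0r.
Qed.

Lemma content_bigsetU (U : nat -> set X) n : (forall i, open (U i)) ->
  content (\big[setU/set0]_(i < n) U i) <= \sum_(i < n) content (U i).
Proof.
move=> oU; elim: n => [|n IH]; first by rewrite !big_ord0 content_set0.
rewrite !big_ord_recr/= (le_trans (content_setU _ (oU n)))// ?lerD2r//.
by rewrite -bigcup_mkord; apply: bigcup_open => i _; exact: oU.
Qed.

(** The set where e <= f is compact, so finitely many U_i cover it and the truncation of f lies
    below their union. *)
Lemma content_bigcup (U : nat -> set X) f e : (forall i, open (U i)) ->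
  below (\bigcup_i U i) f -> 0 < e ->
  exists n, m f <= \sum_(i < n) content (U i) + e.
Proof.
move=> oU [cf f01 f0] e0.
have f0' x : 0 <= f x by case/andP: (f01 x).
have cC := @closed_ge e _ cf; set C := [set x | _] in cC.
have Cco : compact C by exact: (subclosed_compact cC Xcompact).
rewrite compact_cover in Cco.
have [||D _ CD] := Cco nat setT U.
- by move=> i _; exact: oU.
- move=> x Cx; have [//|nU] := pselect ((\bigcup_i U i) x).
  by move: Cx; rewrite /C /= f0 ?leNgt ?e0.
pose n := (\max_(i <- D) i).+1; exists n.
rewrite (le_trans (functional_trunc e cf))// lerD2r.
apply: le_trans (content_bigsetU n oU); apply: content_ub; split.
- exact: trunc_cont.
- move=> x; rewrite trunc_ge0 (le_trans (trunc_le (ltW e0) (f0' x)))//.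
  by case/andP: (f01 x).
- move=> x nU; apply: trunc_eq0; rewrite ltNge; apply/negP => fe; apply: nU.
  have [i iD Uix] := CD _ fe; rewrite -bigcup_mkord; exists i => //=.
  by rewrite /n ltnS (big_fsetD1 i)//= leq_maxl.
Qed.

Definition outer (A : set X) : R := inf [set content U | U in [set U | open U /\ A `<=` U]].

Lemma has_inf_outer A : has_inf [set content U | U in [set U | open U /\ A `<=` U]].
Proof.
split; first by exists (content setT), setT => //; split=> //; exact: openT.
by exists 0 => _ [U _ <-]; exact: content_ge0.
Qed.

Lemma outer_le A U : open U -> A `<=` U -> outer A <= content U.
Proof.
move=> oU AU; apply: ge_inf; first by case: (has_inf_outer A).
by exists U.
Qed.

Lemma outer_ge0 A : 0 <= outer A.
Proof.
apply: lb_le_inf; first by case: (has_inf_outer A).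
by move=> _ [U _ <-]; exact: content_ge0.
Qed.

Lemma outer_adherent A e : 0 < e ->
  exists U, [/\ open U, A `<=` U & content U < outer A + e].
Proof.
move=> e0; have [_ [U [oU AU] <-] h] := inf_adherent e0 (has_inf_outer A).
by exists U.
Qed.

Lemma outer_open U : open U -> outer U = content U.
Proof.
move=> oU; apply/eqP; rewrite eq_le outer_le//=.
apply: lb_le_inf; first by case: (has_inf_outer U).
by move=> _ [V [oV UV] <-]; exact: le_content.
Qed.

Lemma le_outer A B : A `<=` B -> outer A <= outer B.
Proof.
move=> AB; apply: lb_le_inf; first by case: (has_inf_outer B).
move=> _ [V [oV BV] <-]; apply: outer_le => //; exact: subset_trans BV.
Qed.

(** Caratheodory's criterion for an open U. Here f nearly exhausts W inside U, and g nearly exhausts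
    W off the set where d <= f; the truncation of f by d and the function g are never both nonzero,
    so their sum is still below W. *)
Lemma outer_open_split A U : open U ->
  outer (A `&` U) + outer (A `&` ~` U) <= outer A.
Proof.
move=> oU; apply: ler_epsP => e e0.
(* Four losses of d: the open set W around A, the functions f and g, and the truncation of f. *)
pose d := e / 4; have d0 : 0 < d by rewrite divr_gt0.
have [W [oW AW hW]] := outer_adherent A d0.
have [f [cf f01 f0] hf] := content_adherent (W `&` U) d0.
have f0' x : 0 <= f x by case/andP: (f01 x).
have cC := @closed_ge d _ cf; set C := [set x | _] in cC.
have oC : open (W `&` ~` C) by apply: openI => //; exact: closed_openC.
have [g [cg g01 g0] hg] := content_adherent (W `&` ~` C) d0.
have h1 : outer (A `&` U) <= content (W `&` U).
  by apply: outer_le; [exact: openI|exact: setSI].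
have h2 : outer (A `&` ~` U) <= content (W `&` ~` C).
  apply: outer_le => // x [Ax nU]; split; first exact: AW.
  by rewrite /C /= f0; [move=> h; move: d0; rewrite ltNge h|case].
have h3 : m (trunc d f) + m g <= content W.
  have ct := @trunc_cont d _ cf.
  rewrite -functionalD//; apply: content_ub; split; first exact: addr_cont.
    move=> x; have /andP[gx0 gx1] := g01 x; have /andP[_ fx1] := f01 x.
    rewrite addr_ge0 ?trunc_ge0//=.
    have [fx|fx] := ltP (f x) d; first by rewrite trunc_eq0// add0r.
    by rewrite [g x]g0 ?addr0 ?(le_trans (trunc_le (ltW d0) (f0' x)))// => -[_].
  move=> x nW; rewrite g0 ?addr0; last by case.
  by apply: trunc_eq0; rewrite f0// => -[].
have h4 := functional_trunc d cf.
move: d0 h1 h2 h3 h4 hf hg hW; rewrite /d.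
move: (outer _) (outer _) (outer _) (content _) (content _) (content _).
move: (m f) (m g) (m _) => *; lra.
Qed.

Lemma borel_measurable f : continuous f ->
  measurable_fun [set: borel X] (f : borel X -> R).
Proof.
move=> cf; apply: (measurability _ (RGenOInfty.measurableE R)).
move=> _ [_ [a ->] <-]; rewrite setTI; apply: sub_sigma_algebra.
have -> : f @^-1` `]a, +oo[%classic = [set x | a < f x].
  by apply/seteqP; split => x /=; rewrite in_itv/= andbT.
exact: open_gt.
Qed.

Lemma outer_probability : exists nu : probability (borel X) R,
  forall A, nu A = (outer A)%:E.
Proof.
pose mu (A : set X) : \bar R := (outer A)%:E.
have mu0 : mu set0 = 0%E.
  by rewrite /mu outer_open; [rewrite content_set0|exact: open0].
have mu_ge0 A : (0 <= mu A)%E by rewrite lee_fin outer_ge0.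
have le_mu : {homo mu : A B / A `<=` B >-> (A <= B)%E}.
  by move=> A B AB; rewrite lee_fin le_outer.
have mu_sub : sigma_subadditive mu.
  move=> F; apply/lee_addgt0Pr => e e0.
  have e2 : 0 <= e / 2 by rewrite divr_ge0// ltW.
  (* Half of e is spread geometrically over the open neighbourhoods of the F i; the other half pays
     for the passage to a finite subcover. *)
  apply: (@le_trans _ _ (\sum_(i <oo) (mu (F i) + (e / 2 / (2 ^ i.+1)%:R)%:E) + (e / 2)%:E)%E);
    last first.
    rewrite [leRHS](_ : _ = (\sum_(i <oo) mu (F i) + (e / 2)%:E) + (e / 2)%:E)%E.
      by rewrite leeD2r// epsilon_trick.
    by rewrite -addeA -EFinD -splitr.
  have ex i : exists U, [/\ open U, F i `<=` U &
      content U < outer (F i) + e / 2 / (2 ^ i.+1)%:R].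
    by apply: outer_adherent; rewrite !divr_gt0// ltr0n expn_gt0.
  have [U hU] := choice ex.
  have oU i : open (U i) by case: (hU i).
  have FU i : F i `<=` U i by case: (hU i).
  have cU i : content (U i) <= outer (F i) + e / 2 / (2 ^ i.+1)%:R.
    by case: (hU i) => _ _ /ltW.
  apply: (@le_trans _ _ (content (\bigcup_i U i))%:E).
    rewrite lee_fin; apply: outer_le; first exact: bigcup_open.
    by move=> x [i _ Fix]; exists i => //; exact: FU.
  suff : forall f, below (\bigcup_i U i) f -> ((m f)%:E <=
      \sum_(i <oo) (mu (F i) + (e / 2 / (2 ^ i.+1)%:R)%:E) + (e / 2)%:E)%E.
    set s := (_ + _)%E; case: s => [r| |] h; last 2 first.
    - by rewrite leey.
    - by have := h _ (below0 _).
    by rewrite lee_fin; apply: content_le => f /h; rewrite lee_fin.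
  move=> f Uf; have e2' : 0 < e / 2 by rewrite divr_gt0.
  have [n hn] := content_bigcup oU Uf e2'.
  apply: (@le_trans _ _ ((\sum_(i < n) content (U i))%:E + (e / 2)%:E)%E).
    by rewrite -EFinD lee_fin.
  rewrite leeD2r//; apply: le_trans (nneseries_lim_ge n _); last first.
    by move=> i _ _; rewrite adde_ge0// lee_fin !divr_ge0// ltW.
  rewrite big_mkord -sumEFin; apply: lee_sum => i _.
  by rewrite -EFinD lee_fin.
pose om : {outer_measure set X -> \bar R} :=
  HB.pack mu (isOuterMeasure.Build R X mu mu0 mu_ge0 le_mu mu_sub).
have bc : (@measurable _ (borel X)) `<=` om.-caratheodory.
  apply: (smallest_sub (@sigma_algebra_measurable _ (caratheodory_type om))).
  move=> U oU; apply: le_caratheodory_measurable => A.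
  by rewrite -EFinD lee_fin; exact: outer_open_split.
have mu_add : semi_sigma_additive (mu : set (borel X) -> \bar R).
  move=> F mF tF mUF; have := @caratheodory_measure_sigma_additive R X om.
  by move=> /(_ F (fun i => bc _ (mF i)) tF (bc _ mUF)).
pose mum := isMeasure.Build _ _ _ (mu : set (borel X) -> \bar R) mu0 mu_ge0 mu_add.
pose mu_ : {measure set (borel X) -> \bar R} := HB.pack (mu : set (borel X) -> \bar R) mum.
have mu1 : mu_ setT = 1%E.
  by rewrite /= /mu outer_open ?content_setT//; exact: openT.
pose prob := Measure_isProbability.Build _ _ _ mu_ mu1.
pose nu : probability (borel X) R := HB.pack (Measure.sort mu_) prob.
by exists nu.
Qed.

Lemma level_sum_le (d y : R) n : 0 < d -> 0 <= y ->
  \sum_(j < n) d * (j%:R * d < y)%R%:R <= y + d.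
Proof.
move=> d0 y0; have triv k : \sum_(j < k) d * (j%:R * d < y)%R%:R <= k%:R * d.
  rewrite mulr_natl -[k in leRHS]card_ord -sumr_const; apply: ler_sum => j _.
  by case: (_ < y); rewrite ?mulr1// mulr0 ltW.
elim: n => [|n IH]; first by rewrite big_ord0 addr_ge0// ltW.
rewrite big_ord_recr/=; have [ny|ny] := ltP (n%:R * d) y; last by rewrite mulr0 addr0.
by rewrite mulr1 lerD2r (le_trans (triv n))// ltW.
Qed.

(* Cutting f at the levels j d and comparing with the contents of {f > j d}. *)
Lemma functional_levels f d n : continuous f -> (forall x, 0 <= f x) -> 0 < d ->
  m (fun x => Num.min (f x) (n%:R * d)) <=
  \sum_(j < n) d * content [set x | j%:R * d < f x].
Proof.
move=> cf f0 d0; elim: n => [|n IH].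
  rewrite big_ord0 le_eqVlt; apply/orP; left; apply/eqP.
  have -> : (fun x => Num.min (f x) (0%:R * d)) = fun=> 0.
    by apply/funext => x; rewrite mul0r min_r.
  exact: functional0.
pose G k x := Num.min (f x) (k%:R * d).
have cG k : continuous (G k) by apply: min_cont => //; exact: cst_cont.
pose h x := d^-1 * (G n.+1 x - G n x).
have ch : continuous h by apply: mulr_cont; [exact: cst_cont|exact: sub_cont].
have E : G n.+1 = fun x => G n x + d * h x.
  apply/funext => x; rewrite /h mulrA mulfV ?gt_eqF// mul1r.
  by rewrite addrC subrK.
have dn : n.+1%:R * d = n%:R * d + d by rewrite -natr1 mulrDl mul1r.
rewrite big_ord_recr/= -/(G n.+1) E functionalD//; last first.
  by apply: mulr_cont => //; exact: cst_cont.
rewrite lerD// functionalZ// ler_pM2l//; apply: content_ub; split=> //.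
  move=> x; rewrite /h /G dn mulrC ler_pdivlMr// ler_pdivrMr// mul0r mul1r.
  move: (n%:R * d) (f x) => p q; rewrite /Num.min.
  by case: (ltP q (p + d)) => h1; case: (ltP q p) => h2; apply/andP; split; lra.
move=> x /negP; rewrite -leNgt /h /G dn => fx.
rewrite !min_l ?subrr ?mulr0// (le_trans fx)// lerDl ltW//.
Qed.

Lemma continuous_bounded f : continuous f -> exists B, forall x, f x <= B.
Proof.
move=> cf; have : compact (f @` setT).
  apply: continuous_compact => //; apply: continuous_subspaceT => //.
move=> /(@compact_bounded R R^o)[B [_ hB]]; exists (B + 1) => x.
have := hB (B + 1); rewrite ltrDl ltr01 => /(_ isT (f x)) h.
by rewrite (le_trans (ler_norm _))// h//; exists x.
Qed.

(** An upper bound suffices because m is to be made small. [functional_levels] bounds m f by the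
    integral of a step function that is at most f + d. *)
Lemma functional_le_integral (nu : probability (borel X) R) f :
  (forall A, nu A = (outer A)%:E) -> continuous f -> (forall x, 0 <= f x) ->
  ((m f)%:E <= \int[nu]_x (f x)%:E)%E.
Proof.
move=> nuE cf f0; apply/lee_addgt0Pr => d d0.
have [B hB] := continuous_bounded cf.
pose n := Num.bound (B / d).
have fn x : f x <= n%:R * d.
  rewrite (le_trans (hB x))// -ler_pdivrMr// ltW// archi_boundP//.
  by rewrite divr_ge0 ?(ltW d0)// (le_trans (f0 point)).
have := functional_levels n cf f0 d0.
have -> : (fun x => Num.min (f x) (n%:R * d)) = f.
  by apply/funext => x; rewrite min_l.
rewrite -lee_fin => h; apply: (le_trans h).
have oU j : open [set x | j%:R * d < f x] by exact: open_gt.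
have mU j : measurable ([set x | j%:R * d < f x] : set (borel X)).
  by apply: sub_sigma_algebra; exact: oU.
have mf : measurable_fun [set: borel X] (EFin \o (f : borel X -> R)).
  by apply/measurable_EFinP; exact: borel_measurable.
pose s (x : borel X) : \bar R := (\sum_(j < n) (d%:E * (\1_[set x | j%:R * d < f x] x)%:E))%E.
have -> : (\sum_(j < n) d * content [set x | j%:R * d < f x])%:E =
    (\int[nu]_x s x)%E.
  rewrite /s ge0_integral_sum//; last 2 first.
  - move=> j; apply: measurable_funeM; apply/measurable_EFinP.
    exact: measurable_indic.
  - by move=> j x _; rewrite -EFinM lee_fin mulr_ge0// ltW.
  rewrite -sumEFin; apply: eq_bigr => j _.
  rewrite ge0_integralZl//; last first.
  - by rewrite lee_fin ltW.
  - by apply/measurable_EFinP; exact: measurable_indic.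
  rewrite integral_indic// setIT -(outer_open (oU j)) EFinM; congr (_ * _)%E.
  exact/esym/nuE.
have -> : d%:E = (\int[nu]_(x in setT) (cst d%:E) x)%E.
  rewrite integral_cst//; set t := (X in (_ * X)%E).
  have -> : t = 1%E by exact: probability_setT.
  by rewrite mule1.
rewrite -ge0_integralD//; last by move=> x _; rewrite lee_fin ltW.
apply: ge0_le_integral => //.
- by move=> x _; apply: sume_ge0 => j _; rewrite -EFinM lee_fin mulr_ge0// ltW.
- apply: emeasurable_sum => j; apply: measurable_funeM; apply/measurable_EFinP.
  exact: measurable_indic.
- by apply: emeasurable_funD.
- move=> x _; rewrite /s /= -EFinD; under eq_bigr do rewrite -EFinM.
  rewrite sumEFin lee_fin (le_trans _ (level_sum_le n d0 (f0 x)))//.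
  rewrite le_eqVlt; apply/orP; left; apply/eqP/eq_bigr => j _.
  rewrite indicE; congr (_ * (nat_of_bool _)%:R).
  by apply/idP/idP => [/set_mem|jf] //; exact: mem_set.
by move=> x _; rewrite lee_fin.
Qed.

(** Boundaries are defined by probability measures, so m is replaced by the measure [nu] it induces.
    A member g i of the net far enough out moves [nu] so close to the point mass at x that f, which
    vanishes at x, has integral below e. *)
Lemma boundary_functional (G : groupType) (act : G -> X -> X) x f (e : R) :
  continuous_action act -> topological_boundary R act ->
  continuous f -> (forall y, 0 <= f y) -> f x = 0 -> 0 < e ->
  exists s, m (fun y => f (act s y)) < e.
Proof.
move=> [cact _ _] bd cf f0 fx e0; have [nu nuE] := outer_probability.
have [I [le [g [[_ lexx _ _] cvg]]]] := bd nu x.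
have mf : measurable_fun [set: borel X] (EFin \o (f : borel X -> R)).
  by apply/measurable_EFinP; exact: borel_measurable.
have := cvg f cf; rewrite integral_dirac// diracT mul1e fx => h.
have : nbhs (0%E : \bar R) [set y : \bar R | (y < e%:E)%E].
  by apply: open_nbhs_nbhs; split; [exact: open_ereal_lt_ereal|rewrite /= lte_fin].
move=> /h [i _ /(_ i (lexx i))] /=.
have mact : measurable_fun [set: borel X] (act (g i) : borel X -> borel X).
  apply: (@measurability _ _ (borel X) (borel X) _ _ (@open X)) => // _ [U oU <-].
  rewrite setTI; apply: sub_sigma_algebra.
  by apply: open_comp => // y _; exact: cact.
rewrite (ge0_integral_pushforward mact)//; last by move=> y _; rewrite lee_fin.
move=> hi; exists (g i); rewrite -lte_fin; apply: le_lt_trans hi.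
apply: functional_le_integral => //.
by move=> y; apply: continuous_comp; [exact: cact|exact: cf].
Qed.

End positive_functionals_on_continuous_functions.

Section boundary_groups.
Context {R : realType} {X : ptopologicalType} {G : groupType} (act : G -> X -> X).
Hypotheses (Xcompact : compact [set: X]) (Xhausdorff : hausdorff_space X).
Hypotheses (actC : continuous_action act) (bd : topological_boundary R act).

Lemma separating_function (x y : X) : x <> y ->
  exists F : X -> R, [/\ continuous F, forall z, 0 <= F z <= 1, F x = 1 & F y = 0].
Proof.
move=> xy; have closed1 (z : X) : closed [set z].
  by apply: compact_closed => //; exact: compact_set1.
have [|u [cu u01 uy ux]] := @urysohn_function R X Xcompact Xhausdorff _ _
  (closed1 y) (closed1 x).
  by rewrite -subset0 => z [] /= -> /esym.
by exists u; split=> //; [exact: ux|exact: uy].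
Qed.

(* With F x = 1 and F (c x) = 0, the function (1 - F) + F o c vanishes at x, so
   the boundary pushes its integral to 0. *)
Lemma displacement_function (c : G) (x : X) : act c x <> x ->
  exists2 F : X -> R, continuous F /\ (forall z, 0 <= F z <= 1) &
    forall (m : (X -> R) -> R) e, continuous_functional m -> 0 < e ->
      exists s, m (fun y => (1 - F (act s y)) + F (act (c * s)%g y)) < e.
Proof.
move=> cx; have [act_cont act1 actM] := actC.
have [F [cF F01 Fx Fcx]] := @separating_function x (act c x) (nesym cx).
exists F => // m e mP e0.
have [|||s hs] := @boundary_functional R X Xcompact Xhausdorff m mP G act x
    (fun y => (1 - F y) + F (act c y)) e actC bd _ _ _ e0.
- apply: addr_cont; first by apply: sub_cont => //; exact: cst_cont.
  by move=> y; apply: continuous_comp; [exact: act_cont|exact: cF].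
- by move=> y; rewrite addr_ge0 ?subr_ge0//; case/andP: (F01 y) (F01 (act c y)) => // ? ? /andP[].
- by rewrite Fx Fcx subrr addr0.
by exists s; under eq_fun do rewrite actM.
Qed.

(** If the conjugates of c formed a finite list L, let m average over the points a p with a in 1 ::
    L. The displacement function at s is then below 1/2 at each of them. For a = 1 this forces F(c s
    p) < 1/2, and for a = s^-1 c s, where s a = c s, it forces F(c s p) > 1/2. *)
Lemma boundary_icc : faithful_action act -> icc G.
Proof.
move=> faith c c1; have [act_cont act1 actM] := actC.
have [x /eqP cx] : exists x, act c x != x.
  by apply: contrapT => /forallNP h; apply: (faith c c1) => x; have /negP := h x; rewrite negbK => /eqP.
have [F [cF F01] hF] := displacement_function cx.
move=> /finite_seqP[L LE].
have n0 : 0 < (size L).+1%:R :> R by rewrite ltr0n.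
pose m (f : X -> R) := (size L).+1%:R^-1 * \sum_(a <- 1%g :: L) f (act a point).
have mP : continuous_functional m.
  split=> [a f g _ _|f _ f0|].
  - by rewrite /m big_split/= -mulr_sumr; ring.
  - by apply: mulr_ge0; [rewrite invr_ge0 ltW|exact: sumr_ge0].
  - rewrite /m big_const_seq count_predT iter_addr_0 [size _]/=.
    by rewrite mulVf ?gt_eqF.
(* All terms are nonnegative, so this bound on the average puts each of them below 1/2. *)
have e0 : 0 < (size L).+1%:R^-1 / 2 :> R by rewrite divr_gt0 ?invr_gt0.
have [s] := hF m _ mP e0; rewrite /m ltr_pM2l ?invr_gt0// => hs.
pose f y := 1 - F (act s y) + F (act (c * s)%g y).
have f_ge0 y : 0 <= f y.
  by rewrite addr_ge0 ?subr_ge0//; case/andP: (F01 (act s y)) (F01 (act (c * s)%g y)) => // ? ? /andP[].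
have fa a : a \in 1%g :: L -> f (act a point) < 2^-1.
  move=> aL; apply: le_lt_trans hs; rewrite (big_rem a)//= lerDl sumr_ge0// => b _.
  exact: f_ge0.
have csL : (c ^ s)%g \in 1%g :: L.
  rewrite inE; apply/orP; right.
  have : [set (c ^ h)%g | h in [set: G]] (c ^ s)%g by exists s.
  by rewrite LE.
have := fa 1%g (mem_head _ _); have := fa _ csL; rewrite /f -!actM.
have scs : (s * c ^ s = c * s)%g by rewrite conjgE !mulgA mulgV mul1g.
rewrite -mulgA scs !mulg1.
have := F01 (act s point); have := F01 (act (c * s) point)%g.
have := F01 (act (c * (c * s)) point)%g.
move: (F _) (F _) (F _); clear; move=> p q r *; lra.
Qed.

End boundary_groups.

(** * Traces of boundary groups *)

Section boundary_kernels.
Context {R : realType} {G : groupType}.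
Local Notation Y := (G * bool)%type.

Definition pair_act (s : G) (y : Y) : Y := ((s * y.1)%g, y.2).

Lemma pair_act1 y : pair_act 1%g y = y.
Proof. by case: y => g a; rewrite /pair_act mul1g. Qed.

Lemma pair_actM s t y : pair_act (s * t)%g y = pair_act s (pair_act t y).
Proof. by rewrite /pair_act /= mulgA. Qed.

Variable kappa : Y -> Y -> R.
Hypotheses (kappa1 : forall y, kappa y y = 1).

Context {X : ptopologicalType} (act : G -> X -> X).
Hypotheses (Xcompact : compact [set: X]) (Xhausdorff : hausdorff_space X).
Hypotheses (actC : continuous_action act) (bd : topological_boundary R act).

(* A point is moved away from itself by g while the boundary lets us push both
   of the diagonal masses k_F(gs, gs) and k_{1-F}(s, s) to 0. *)
Lemma boundary_kernel_small (k : @rspace R ((G -> R) * Y * Y)%type) g x t a b :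
  full_kernels kappa k -> (forall s, kact pair_act s k = k) ->
  act g x <> x -> 0 < t :> R ->
  exists s, `|kappa ((g * s)%g, a) (s, b)| <= 3 * t.
Proof.
move=> [hk kE] kact_id gx t0; have [k1 k2 k3 k4] := hk.
have [act_cont act1 actM] := actC.
have [F [cF F01] hF] := displacement_function Xcompact Xhausdorff actC bd gx.
pose orb (f : X -> R) (h : G) := f (act h point).
have borb (f : X -> R) : continuous f -> bounded_real (orb f).
  move=> cf; have [|B hB] := @continuous_bounded R X Xcompact (fun x => `|f x|).
    by move=> y; apply: (@cvg_norm _ R^o); exact: cf.
  by exists B => h; exact: hB.
(* Averaging over both Boolean coordinates controls the masses at (g s, a) and at (s, b) with one s,
   also when a and b differ. *)
pose m (f : X -> R) : R := (k (orb f, (1%g, false), (1%g, false)) +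
  k (orb f, (1%g, true), (1%g, true))) / 2.
have psd_orb (f : X -> R) : continuous f -> (forall y, 0 <= f y) ->
    psd (fun y z => k (orb f, y, z)).
  by move=> cf f0; apply: k4 => [|h]; [exact: borb|exact: f0].
have diag_orb (f : X -> R) (y : Y) : continuous f -> (forall z, 0 <= f z) -> 0 <= k (orb f, y, y).
  move=> cf f0; exact: (@psd_diag_ge0 _ _ (fun y z => k (orb f, y, z)) y (psd_orb _ cf f0)).
have mP : continuous_functional m.
  split=> [c f f' cf cf'|f cf f0|].
  - have h d : k (orb (fun x => c * f x + f' x), (1%g, d), (1%g, d)) =
        c * k (orb f, (1%g, d), (1%g, d)) + k (orb f', (1%g, d), (1%g, d)).
      exact: k2 (borb _ cf) (borb _ cf').
    by rewrite /m !h; field.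
  - by rewrite /m divr_ge0// addr_ge0//; exact: diag_orb.
  - have := kE (1%g, false) (1%g, false); have := kE (1%g, true) (1%g, true).
    by rewrite /kernel_unit !kappa1 /m => -> ->; field.
(* m is half a sum of four nonnegative masses, each of which is then at most t^2. *)
have e0 : 0 < t ^+ 2 / 2 by rewrite divr_gt0 ?exprn_gt0.
have [s hs] := hF m _ mP e0; exists s.
pose F1 y := 1 - F y.
have cF1 : continuous F1 by apply: sub_cont => //; exact: cst_cont.
have F_ge0 y : 0 <= F y by case/andP: (F01 y).
have F1_ge0 y : 0 <= F1 y by rewrite subr_ge0; case/andP: (F01 y).
have shift (u : G) (f : G -> R) c : k (fun h => f (u * h)%g, (1%g, c), (1%g, c)) = k (f, (u, c), (u, c)).
  have := congr1 (fun k => k (f, (u, c), (u, c))) (kact_id u).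
  by rewrite /kact /pair_act /= mulVg => <-.
have massE c : k (orb (fun y => 1 - F (act s y) + F (act (g * s)%g y)), (1%g, c), (1%g, c)) =
    k (orb F1, (s, c), (s, c)) + k (orb F, ((g * s)%g, c), ((g * s)%g, c)).
  have := k2 1 _ _ (1%g, c) (1%g, c) (bounded_real_shift s (borb _ cF1))
    (bounded_real_shift (g * s)%g (borb _ cF)).
  rewrite mul1r !shift => <-; congr (k (_, _, _)); apply/funext => h.
  by rewrite mul1r /orb /F1 !actM.
move: hs; rewrite /m !massE ltr_pM2r ?invr_gt0// => hs.
have d1 c := diag_orb F1 (s, c) cF1 F1_ge0.
have d2 c := diag_orb F ((g * s)%g, c) cF F_ge0.
have small c : k (orb F1, (s, c), (s, c)) <= t ^+ 2 /\
    k (orb F, ((g * s)%g, c), ((g * s)%g, c)) <= t ^+ 2.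
  have := d1 false; have := d2 false; have := d1 true; have := d2 true; move: hs.
  by case: c; move: (k _) (k _) (k _) (k _) (t ^+ 2); clear; move=> *; split; lra.
have unit_sum y z : kappa y z = k (orb F1, y, z) + k (orb F, y, z).
  have := k2 1 _ _ y z (borb _ cF1) (borb _ cF); rewrite mul1r => <-.
  rewrite -kE /kernel_unit; congr (k (_, _, _)); apply/funext => h.
  by rewrite mul1r /orb /F1 subrK.
have le1 (f : X -> R) (y : Y) : (f = F \/ f = F1) -> k (orb f, y, y) <= 1.
  have := unit_sum y y; rewrite kappa1 => ->; case=> ->; [rewrite lerDr|rewrite lerDl]; exact: diag_orb.
have := psd_amgm ((g * s)%g, a) (s, b) (psd_orb F1 cF1 F1_ge0) (k3 _) (ltW t0).
have := psd_amgm (s, b) ((g * s)%g, a) (psd_orb F cF F_ge0) (k3 _) (ltW t0).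
rewrite [k (orb F, (s, b), ((g * s)%g, a))]k3 => h1 h2.
have t2 : 0 <= t ^+ 2 by rewrite exprn_ge0// ltW.
have h1' : 2 * t * `|k (orb F, ((g * s)%g, a), (s, b))| <= 2 * t ^+ 2.
  apply: (le_trans h1); rewrite mulr2n mulrDl mul1r lerD ?(small _).2//.
  by rewrite ler_piMr// le1//; left.
have h2' : 2 * t * `|k (orb F1, ((g * s)%g, a), (s, b))| <= 2 * t ^+ 2.
  apply: (le_trans h2); rewrite mulr2n mulrDl mul1r lerD ?(small _).1//.
  by rewrite ler_piMr// le1//; right.
rewrite unit_sum; apply: (le_trans (ler_normD _ _)).
have t2' : 0 < 2 * t by rewrite mulr_gt0.
rewrite -(ler_pM2l t2') mulrDr; apply: (le_trans (lerD h2' h1')).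
rewrite -subr_ge0 (_ : _ - _ = 2 * t ^+ 2); [exact: mulr_ge0|ring].
Qed.

End boundary_kernels.

Section trace_kernel.
Context {R : realType} {G : groupType} {H : lmodType R[i]}
  (dot : {dot H for Num.conj}) (pi : G -> H -> H).
Hypotheses (Hc : hilbert_complete dot) (pi_rep : unitary_representation dot pi).
Local Notation M := (bicommutant dot (range pi)).
Variable tau : (H -> H) -> R[i].
Hypothesis tau_tr : tracial_state dot M tau.

Let vM := rep_vN_algebra pi_rep Hc.
Let Mpi := rep_bicommutant pi_rep.
Local Notation Y := (G * bool)%type.

Definition phase (a : bool) : R[i] := if a then 'i%C else 1.

(* The boolean coordinate multiplies by i, so that this real kernel also
   remembers the imaginary part of the trace. *)
Definition trace_kernel (y z : Y) : R := complex.Re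
  (Num.conj (phase y.2) * phase z.2 * tau (pi (y.1^-1 * z.1)%g)).

Lemma phase_unit a : Num.conj (phase a) * phase a = 1.
Proof.
by case: a; rewrite /phase ?conj_iC ?mulNr ?mul_iC_iC ?opprK// rmorph1 mulr1.
Qed.

Lemma trace_kernel_psd : psd trace_kernel.
Proof.
move=> c; pose s := [seq (p.1%:C%C * phase p.2.2, p.2.1) | p <- c].
have := trace_ge0 tau_tr (vN_rep_sum vM Mpi s) (vN_rep_sumV vM Mpi s)
  (rep_sum_adjoint pi_rep s).
rewrite (trace_rep_sum pi_rep vM Mpi tau_tr) => /ge0_Re; congr (0 <= _).
rewrite raddf_sum big_map; apply: eq_bigr => p _.
rewrite raddf_sum big_map; apply: eq_bigr => q _ /=.
rewrite rmorphM/= conj_realC -ReZ.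
rewrite (_ : p.1%:C%C * _ * _ * _ = (p.1 * q.1)%:C%C * (Num.conj (phase p.2.2) * phase q.2.2 *
  tau (pi (p.2.1^-1 * q.2.1)%g))) ?ReZ//.
by rewrite rmorphM/=; ring.
Qed.

Lemma trace_kernelC : symmetric_kernel trace_kernel.
Proof.
move=> y z; rewrite /trace_kernel -[LHS]ReJ; congr complex.Re.
rewrite !rmorphM/= conjCK [Num.conj (phase z.2) * _]mulrC; congr (_ * _).
rewrite -(trace_adjoint vM tau_tr (Mpi _) (Mpi _) (rep_adjoint pi_rep _)).
by rewrite invgM invgK.
Qed.

Lemma trace_kernel1 y : trace_kernel y y = 1.
Proof.
rewrite /trace_kernel phase_unit mul1r mulVg (_ : pi 1%g = id) ?(trace_id tau_tr)//.
by apply/funext => x; rewrite (rep1 pi_rep).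
Qed.

Lemma trace_kernel_act s y z :
  trace_kernel (pair_act s y) (pair_act s z) = trace_kernel y z.
Proof. by rewrite /trace_kernel /= invgM -mulgA mulKg. Qed.

Lemma trace_conj g s : tau (pi (s^-1 * (g * s))%g) = tau (pi g).
Proof.
have piM u v : pi (u * v)%g = pi u \o pi v by case: pi_rep => _ _ ->.
by rewrite piM (trace_comm tau_tr (Mpi _) (Mpi _)) -piM -mulgA mulgV mulg1.
Qed.

Variables (S : pred G) (Lam : subGroupType S).
Hypothesis tau_Lam : forall h : Lam, h != 1%g -> tau (pi (val h)) = 0.

Lemma trace_kernel_orth (b : Y) (h h' : Lam) :
  trace_kernel (pair_act (val h) b) (pair_act (val h') b) = (h == h')%:R.
Proof.
have [->|hh'] := eqVneq; first exact: trace_kernel1.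
rewrite /trace_kernel phase_unit mul1r /= invgM -mulgA [((\val h)^-1 * _)%g]mulgA trace_conj.
have -> : ((\val h)^-1 * \val h')%g = val (h^-1 * h')%g by rewrite valM gmulfV.
rewrite tau_Lam//; apply: contra hh' => /eqP /(congr1 (fun u => h * u)%g).
by rewrite mulVKg mulg1 => ->.
Qed.

Lemma boundary_trace_regular : admits_faithful_topological_boundary R G ->
  coamenable R S -> forall g, tau (pi g) = (g == 1%g)%:R.
Proof.
move=> [X [act [Xc Xh actC bd faith]]] coam g.
have [->|g1] := eqVneq.
  rewrite (_ : pi 1%g = id) ?(trace_id tau_tr)//.
  by apply/funext => x; rewrite (rep1 pi_rep).
have [k0 k0F k0S] := invariant_full_kernel pair_act1 pair_actM
  trace_kernel_psd trace_kernelC trace_kernel_act trace_kernel_orth (1%g, false).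
have [k kF kG] := coamenable_invariant_kernel pair_act1 pair_actM trace_kernel1
  trace_kernel_psd trace_kernel_act coam (ex_intro2 _ _ k0 k0F k0S).
(* The kernel between g^-1 and 1 involves tau(pi g), so it is g^-1 that has to move a point. *)
have gV1 : g^-1%g != 1%g by rewrite invg_eq1.
have [x gx] : exists x, act g^-1%g x <> x.
  apply: contrapT => /forallNP h; apply: (faith _ gV1) => x.
  exact: contrapT (h x).
(* By the trace property the kernel between g^-1 s and s does not depend on s, while for each e some
   s makes it at most e. The two values of b then give the real and the imaginary part of tau(pi
   g). *)
have kernel0 b : trace_kernel (g^-1%g, false) (1%g, b) = 0.
  apply/eqP; rewrite -normr_le0; apply: ler_epsP => e e0; rewrite add0r.
  have e3 : 0 < e / 3 by rewrite divr_gt0.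
  have [s] := boundary_kernel_small trace_kernel1 Xc Xh actC bd false b kF kG gx e3.
  rewrite [3 * _]mulrC divfK// /trace_kernel /= invgM invgK mulg1 -mulgA.
  by rewrite trace_conj.
have := kernel0 false; have := kernel0 true; rewrite /trace_kernel /= rmorph1 !mul1r invgK mulg1.
by move=> h1 h2; apply: Re_eq; rewrite ?h1 ?h2 ?mulr0.
Qed.

End trace_kernel.

Theorem mainTheorem10 (R : realType) (Gamma : groupType)
  (Gamma_countable : countable [set: Gamma])
  (Gamma_boundary : admits_faithful_topological_boundary R Gamma)
  (S : pred Gamma) (Lambda : subGroupType S)
  (Lambda_icc : icc Lambda) (Lambda_coamenable : coamenable R S)
  (H : lmodType R[i]) (dot : {dot H for Num.conj})
  (H_complete : hilbert_complete dot)
  (pi : Gamma -> H -> H) (pi_rep : unitary_representation dot pi)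
  (pi_finite : finite_vN_algebra dot (bicommutant dot (range pi)))
  (pi_Lambda : extends_to_vN_isomorphism dot (fun h : Lambda => pi (\val h))) :
  extends_to_vN_isomorphism dot pi.
Proof.
have [tau [tau_tr tau_f tau_n]] := pi_finite.
have [phi [iso phi_pi]] := pi_Lambda.
have [u1 u2 u3] := pi_rep.
have Lrep : unitary_representation dot (fun h : Lambda => pi (\val h)).
  by split=> [h||g h]; [exact: u1|rewrite val1|rewrite valM].
have NM : bicommutant dot (range (fun h : Lambda => pi (\val h))) `<=`
    bicommutant dot (range pi).
  move=> A [bA hA]; split=> // B [bB hB]; apply: hA; split=> // _ [h _ <-].
  by apply: hB; exists (\val h).
have icc_Gamma : icc Gamma.
  by have [X [act [Xc Xh actC bd faith]]] := Gamma_boundary; exact: boundary_icc faith.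
have tau_Lam : forall h : Lambda, h != 1%g -> tau (pi (\val h)) = 0.
  apply: (icc_normal_trace_regular H_complete Lrep iso phi_pi) NM tau_tr tau_n => //.
  exact: rep_vN_algebra.
apply: (regular_trace_isomorphism H_complete pi_rep tau_tr tau_f tau_n) icc_Gamma.
exact: (boundary_trace_regular H_complete pi_rep tau_tr tau_Lam Gamma_boundary).
Qed.
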